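(* Let $k\in\mathbb R^d\setminus\{0\}$, let $V\in L^2(\Omega)$ be a real-valued centered stationary random field, denote by $\widehat{\mathcal C}$ the (nonnegative measure) Fourier transform of its covariance function $\mathcal C(x)=\mathbb E[V(x+y)V(y)]$, and assume that $\widehat{\mathcal C}$ does not vanish identically on the sphere $\partial B_{|k|}(-k)$ in the sense that $$\lim_{\varepsilon\downarrow0}\frac1\varepsilon\,\widehat{\mathcal C}\big(B_{|k|+\varepsilon}(-k)\setminus B_{|k|-\varepsilon}(-k)\big)>0.$$ Then, for every $\delta>0$, there exists no branch $$[0,\delta)\to\mathbb R\times L^2(\Omega):\ \lambda\mapsto(E_{k,\lambda},\psi_{k,\lambda})$$ of class $C^2$ with $$H^{\mathrm{st}}_{k,\lambda}\psi_{k,\lambda}=E_{k,\lambda}\psi_{k,\lambda},\qquad (E_{k,\lambda},\psi_{k,\lambda})|_{\lambda=0}=(0,1).$$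
   Context: $(\Omega,\mathbb P)$ is a complete probability space with a measurable action $\tau=(\tau_x)_{x\in\mathbb R^d}$ of $(\mathbb R^d,+)$: $\tau_x\circ\tau_y=\tau_{x+y}$, each $\tau_x$ is measurable and measure-preserving, and $(x,\omega)\mapsto\tau_x\omega$ is jointly measurable. A random field is stationary if $\phi(x,\omega)=\phi_\circ(\tau_{-x}\omega)$ for some random variable $\phi_\circ$; one identifies $\phi_\circ$ with its stationary extension $\phi$, in particular $V(x,\omega)=V(\tau_{-x}\omega)$. The stationary gradient $\nabla^{\mathrm{st}}$ on $L^2(\Omega)$ is the infinitesimal generator of the unitary group $(T_x\phi_\circ)(\omega)=\phi_\circ(\tau_{-x}\omega)$, and $\triangle^{\mathrm{st}}=\nabla^{\mathrm{st}}\cdot\nabla^{\mathrm{st}}$. The operator $H^{\mathrm{st}}_{k,0}=-\triangle^{\mathrm{st}}-2ik\cdot\nabla^{\mathrm{st}}$ is self-adjoint on $H^2(\Omega)$ (the space of $\phi_\circ\in L^2(\Omega)$ with stationary extension in $H^2_{\mathrm{loc}}(\mathbb R^d;L^2(\Omega))$), and $H^{\mathrm{st}}_{k,\lambda}=H^{\mathrm{st}}_{k,0}+\lambda V$. For $V\in L^2(\Omega)$ the operator $H^{\mathrm{st}}_{k,\lambda}$ is well defined on all of $L^2(\Omega)$ with values in $L^1(\Omega)+H^{-2}(\Omega)$, where $H^{-2}(\Omega)$ is the dual of $H^2(\Omega)$, and the eigenvalue equation is understood in that sense. $B_r(x)$ is the ball of radius $r$ centered at $x$ in $\mathbb R^d$.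 The Fourier transform is $\widehat f(k)=\int e^{-ik\cdot x}f(x)\,dx$. *)

(* Defs.v *)
(* MathComp-Analysis, over an arbitrary realType R; R^d is 'rV[R]_d. *)
From HB Require Import structures.
From mathcomp Require Import all_boot all_order all_algebra.
From mathcomp Require Import complex.
From mathcomp Require Import all_classical all_reals all_analysis.

Set Implicit Arguments.
Unset Strict Implicit.
Unset Printing Implicit Defensive.

Import Order.TTheory GRing.Theory Num.Theory.
Import numFieldNormedType.Exports.

Local Open Scope classical_set_scope.
Local Open Scope ring_scope.

(* The norm of MathComp-Analysis on 'rV[R]_d is the sup norm, hence a
   separate Euclidean one. *)

Definition dotv (R : realType) (d : nat) (x y : 'rV[R]_d) : R :=
  \sum_(j < d) x ord0 j * y ord0 j.

Definition enorm (R : realType) (d : nat) (x : 'rV[R]_d) : R :=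
  Num.sqrt (dotv x x).

Definition eball (R : realType) (d : nat) (c : 'rV[R]_d) (r : R) :
    set 'rV[R]_d := [set x | enorm (x - c) < r].

Definition basis_vec (R : realType) (d : nat) (j : 'I_d) : 'rV[R]_d :=
  delta_mx ord0 j.

Definition measure_rV_display : measure_display -> measure_display.
Proof. exact. Qed.

(* The sigma-algebra on row vectors generated by the coordinates; over R it is
   the Borel sigma-algebra of R^n. *)
Section measurable_rV.
Context {disp : measure_display} {T : measurableType disp} (n : nat).

Let coords : 'I_n -> 'rV[T]_n -> T := fun i x => x ord0 i.

Let rV_set0 : g_sigma_preimage coords set0.
Proof. exact: sigma_algebra0. Qed.

Let rV_setC A : g_sigma_preimage coords A -> g_sigma_preimage coords (~` A).
Proof. exact: sigma_algebraC. Qed.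

Let rV_bigcup (F : (set 'rV[T]_n)^nat) :
  (forall i, g_sigma_preimage coords (F i)) ->
  g_sigma_preimage coords (\bigcup_i (F i)).
Proof. exact: sigma_algebra_bigcup. Qed.

HB.instance Definition _ := @isMeasurable.Build (measure_rV_display disp)
  'rV[T]_n (g_sigma_preimage coords) rV_set0 rV_setC rV_bigcup.

Lemma measurable_coord_rV (i : 'I_n) :
  measurable_fun [set: 'rV[T]_n] (fun x : 'rV[T]_n => x ord0 i).
Proof.
move=> _ Y mY; rewrite setTI; apply: sub_sigma_algebra => /=.
rewrite -bigcup_seq/=; exists i => /=; first by rewrite mem_index_enum.
by exists Y => //; rewrite setTI.
Qed.

Lemma measurable_fun_rV (d1 : measure_display) (T1 : measurableType d1)
    (f : T1 -> 'rV[T]_n) :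
  (forall i, measurable_fun [set: T1] (fun t => f t ord0 i)) ->
  measurable_fun [set: T1] f.
Proof.
move=> mf _ Y; rewrite setTI; apply: (@smallest_sub _ _ _
  [set A | measurable (f @^-1` A)]) Y.
  split => /=.
  - by rewrite preimage_set0.
  - by move=> A mA; rewrite setTD preimage_setC; exact: measurableC.
  - by move=> F mF; rewrite preimage_bigcup; exact: bigcupT_measurable.
move=> A; rewrite -bigcup_seq/= => -[i _ [B mB <-]].
by rewrite setTI; have := mf i measurableT B mB; rewrite setTI.
Qed.

End measurable_rV.

(* Lebesgue measure on R^n, by iterating the product
   R^(n.+1) = R x R^n from the point mass on R^0. *)
Section lebesgue_rV.
Context {R : realType}.

Definition cons_rV (n : nat) (p : measurableTypeR R * 'rV[R]_n) : 'rV[R]_n.+1 :=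
  \row_j oapp (p.2 ord0) p.1 (unlift ord0 j).

Definition uncons_rV (n : nat) (x : 'rV[R]_n.+1) : measurableTypeR R * 'rV[R]_n :=
  (x ord0 ord0, \row_j x ord0 (lift ord0 j)).

Lemma measurable_cons_rV (n : nat) : measurable_fun [set: _] (@cons_rV n).
Proof.
apply: measurable_fun_rV => i; under eq_fun do rewrite mxE.
case: unliftP => [j _|_] /=; last exact: measurable_fst.
exact: (measurableT_comp (measurable_coord_rV j) measurable_snd).
Qed.

Lemma measurable_uncons_rV (n : nat) : measurable_fun [set: _] (@uncons_rV n).
Proof.
apply: measurable_fun_pair; first exact: measurable_coord_rV.
apply: measurable_fun_rV => i; under eq_fun do rewrite mxE.
exact: measurable_coord_rV.
Qed.

Lemma cons_rVK (n : nat) : cancel (@cons_rV n) (@uncons_rV n).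
Proof.
case=> t x; rewrite /uncons_rV /cons_rV; congr pair.
  by rewrite mxE unlift_none.
by apply/rowP => j; rewrite !mxE liftK.
Qed.

Section step.
Variables (n : nat) (mu : {sigma_finite_measure set 'rV[R]_n -> \bar R}).

Definition lebesgue_rV_step : set 'rV[R]_n.+1 -> \bar R :=
  pushforward (@lebesgue_measure R \x mu)%E (@cons_rV n).

Let step0 : lebesgue_rV_step set0 = 0%E.
Proof. by rewrite /lebesgue_rV_step /pushforward preimage_set0 measure0. Qed.

Let step_ge0 A : (0 <= lebesgue_rV_step A)%E.
Proof. exact: (measure_ge0 (@lebesgue_measure R \x mu)%E). Qed.

Let step_sigma_additive : semi_sigma_additive lebesgue_rV_step.
Proof.
move=> F mF tF mUF; rewrite /lebesgue_rV_step /pushforward preimage_bigcup.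
apply: measure_semi_sigma_additive.
- by move=> i; rewrite -[X in measurable X]setTI; exact: measurable_cons_rV.
- apply/trivIsetP => /= i j _ _ ij; rewrite -preimage_setI.
  by move/trivIsetP : tF => /(_ _ _ _ _ ij) ->//; rewrite preimage_set0.
- rewrite -preimage_bigcup -[X in measurable X]setTI.
  exact: measurable_cons_rV.
Qed.

HB.instance Definition _ := isMeasure.Build _ _ _ lebesgue_rV_step
  step0 step_ge0 step_sigma_additive.

Let step_sigma_finite : sigma_finite setT lebesgue_rV_step.
Proof.
pose leb : {sigma_finite_measure set (measurableTypeR R) -> \bar R} :=
  @lebesgue_measure R.
have /sigma_finiteP[F [TF ndF Foo]] := sigma_finiteT leb.
have /sigma_finiteP[G [TG ndG Goo]] := sigma_finiteT mu.
exists (fun i => @uncons_rV n @^-1` (F i `*` G i)).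
  rewrite -preimage_bigcup -(preimage_setT (@uncons_rV n)).
  congr (_ @^-1` _); apply/seteqP; split => // -[x y] _.
  have [a _ Fax] : (\bigcup_i F i) x by rewrite -TF.
  have [b _ Gby] : (\bigcup_i G i) y by rewrite -TG.
  exists (maxn a b) => //; split => /=.
    by move: x Fax; exact/subsetPset/ndF/leq_maxl.
  by move: y Gby; exact/subsetPset/ndG/leq_maxr.
move=> i; have [mF Fi] := Foo i; have [mG Gi] := Goo i; split.
  rewrite -[X in measurable X]setTI; apply: measurable_uncons_rV => //.
  exact: measurableX.
rewrite /lebesgue_rV_step /pushforward -comp_preimage.
rewrite (_ : _ \o _ = id); last by apply/funext => p /=; rewrite cons_rVK.
rewrite preimage_id (product_measure1E leb) //.
by rewrite lte_mul_pinfty// ge0_fin_numE.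
Qed.

HB.instance Definition _ := Measure_isSigmaFinite.Build _ _ _ lebesgue_rV_step
  step_sigma_finite.

End step.

Fixpoint lebesgue_rV (n : nat) : {sigma_finite_measure set 'rV[R]_n -> \bar R} :=
  match n with
  | 0 => \d_(0 : 'rV[R]_0)
  | m.+1 => lebesgue_rV_step (lebesgue_rV m)
  end.

End lebesgue_rV.

Definition cmeasurable (disp : measure_display) (T : measurableType disp)
    (R : realType) (f : T -> R[i]) : Prop :=
  measurable_fun setT (fun t => complex.Re (f t)) /\
  measurable_fun setT (fun t => complex.Im (f t)).

Definition cintegral (disp : measure_display) (T : measurableType disp)
    (R : realType) (mu : {measure set T -> \bar R}) (f : T -> R[i]) : R[i] :=
  ((\int[mu]_(t in setT) complex.Re (f t)) +i*
   (\int[mu]_(t in setT) complex.Im (f t)))%C.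

(* Elements of the complex space L^p(T) are given by representatives, the
   equality of L^p(T) being equality almost everywhere. *)
Definition cLnorm (disp : measure_display) (T : measurableType disp)
    (R : realType) (mu : {measure set T -> \bar R}) (p : \bar R)
    (f : T -> R[i]) : \bar R :=
  Lnorm mu p (fun t => (Normc.normc (f t))%:E).

Definition in_cLp (disp : measure_display) (T : measurableType disp)
    (R : realType) (mu : {measure set T -> \bar R}) (p : \bar R)
    (f : T -> R[i]) : Prop :=
  cmeasurable f /\ (cLnorm mu p f < +oo)%E.

Definition inner (disp : measure_display) (T : measurableType disp)
    (R : realType) (mu : {measure set T -> \bar R}) (f g : T -> R[i]) : R[i] :=
  cintegral mu (fun t => conjc (f t) * g t).

Fixpoint iter_pderiv (R : realType) (d : nat) (s : seq 'I_d)
    (f : 'rV[R]_d -> R) : 'rV[R]_d -> R :=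
  match s with
  | [::] => f
  | j :: s' => fun x => 'D_(basis_vec R j) (iter_pderiv s' f) x
  end.

Definition smooth (R : realType) (d : nat) (f : 'rV[R]_d -> R) : Prop :=
  forall s : seq 'I_d, continuous (iter_pderiv s f) /\
    forall (j : 'I_d) (x : 'rV[R]_d),
      derivable (iter_pderiv s f) x (basis_vec R j).

Definition test_function (R : realType) (d : nat) (f : 'rV[R]_d -> R) : Prop :=
  smooth f /\ compact (closure [set x | f x != 0]).

Definition schwartz (R : realType) (d : nat) (f : 'rV[R]_d -> R) : Prop :=
  smooth f /\ forall (n : nat) (s : seq 'I_d), exists M : R,
    forall x, (1 + enorm x) ^+ n * `|iter_pderiv s f x| <= M.

Definition fourier (R : realType) (d : nat) (f : 'rV[R]_d -> R)
    (xi : 'rV[R]_d) : R[i] :=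
  cintegral (lebesgue_rV d)
    (fun x => (cos (dotv xi x) -i* sin (dotv xi x))%C * (f x)%:C%C).

(* mu is the Fourier transform of the bounded function C in the sense of
   tempered distributions: int g dmu = int \hat g(x) C(x) dx. Real-valued test
   functions g suffice by linearity. *)
Definition is_fourier_measure (R : realType) (d : nat) (C : 'rV[R]_d -> R)
    (mu : {measure set 'rV[R]_d -> \bar R}) : Prop :=
  forall g : 'rV[R]_d -> R, schwartz g ->
    mu.-integrable setT (fun xi => (g xi)%:E) /\
    (\int[mu]_(xi in setT) g xi)%:C%C =
      cintegral (lebesgue_rV d) (fun x => fourier g x * (C x)%:C%C).

(* The joint measurability of (x, omega) |-> tau_x omega is with respect to the
   completion of the product of Lebesgue measure and P. As P is complete, the
   uncompleted product sigma-algebra would exclude basic examples such as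
   translations of the torus. *)
Record measurable_action (R : realType) (d : nat) (disp : measure_display)
    (Omega : measurableType disp) (P : probability Omega R)
    (tau : 'rV[R]_d -> Omega -> Omega) : Prop := {
  action0 : forall w, tau 0 w = w ;
  actionD : forall x y w, tau x (tau y w) = tau (x + y) w ;
  action_measurable : forall x, measurable_fun setT (tau x) ;
  action_preserving : forall x A, measurable A -> P (tau x @^-1` A) = P A ;
  action_joint : forall A, measurable A ->
    exists2 B : set ('rV[R]_d * Omega), measurable B &
    exists2 N : set ('rV[R]_d * Omega), (lebesgue_rV d \x P)%E.-negligible N &
      [set p | A (tau p.1 p.2)] = B `|` N }.

(* The stationary extension (x, omega) |-> phi(tau_{-x} omega), that is
   (T_x phi)(omega). *)
Definition stat (R : realType) (d : nat) (Omega X : Type)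
    (tau : 'rV[R]_d -> Omega -> Omega) (phi : Omega -> X) (x : 'rV[R]_d) :
    Omega -> X := fun w => phi (tau (- x) w).

(* E[V(x + y) V(y)] at y = 0; it does not depend on y by stationarity. *)
Definition covariance_function (R : realType) (d : nat) (disp : measure_display)
    (Omega : measurableType disp) (P : probability Omega R)
    (tau : 'rV[R]_d -> Omega -> Omega) (V : Omega -> R) (x : 'rV[R]_d) : R :=
  \int[P]_(w in setT) (stat tau V x w * V w).

(* g = D_j phi, with D_j the j-th component of the stationary gradient. *)
Definition stat_deriv (R : realType) (d : nat) (disp : measure_display)
    (Omega : measurableType disp) (P : probability Omega R)
    (tau : 'rV[R]_d -> Omega -> Omega) (j : 'I_d) (phi g : Omega -> R[i]) :
    Prop :=
  [/\ in_cLp P 2%:E phi, in_cLp P 2%:E g &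
      cLnorm P 2%:E (fun w =>
        (h^-1)%:C%C * (stat tau phi (h *: basis_vec R j) w - phi w) - g w)
      @[h --> 0^'] --> 0%E].

Definition is_H0 (R : realType) (d : nat) (disp : measure_display)
    (Omega : measurableType disp) (P : probability Omega R)
    (tau : 'rV[R]_d -> Omega -> Omega) (k : 'rV[R]_d)
    (phi g : Omega -> R[i]) : Prop :=
  exists D D2 : 'I_d -> Omega -> R[i],
    [/\ forall j, stat_deriv P tau j phi (D j),
        forall j, stat_deriv P tau j (D j) (D2 j) &
        g = fun w => - (\sum_(j < d) D2 j w)
                     - 2%:R * 'i%C * \sum_(j < d) (k ord0 j)%:C%C * D j w].

(* L^2_loc(R^d; L^2(Omega)). *)
Definition L2loc (R : realType) (d : nat) (disp : measure_display)
    (Omega : measurableType disp) (P : probability Omega R)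
    (G : 'rV[R]_d -> Omega -> R[i]) : Prop :=
  cmeasurable (fun p : 'rV[R]_d * Omega => G p.1 p.2) /\
  forall K : set 'rV[R]_d, compact K ->
    (\int[lebesgue_rV d]_(x in K) \int[P]_w
       ((Normc.normc (G x w)) ^+ 2)%:E < +oo)%E.

(* H^m_loc(R^d; L^2(Omega)). A weak derivative is an equality between integrals
   with values in L^2(Omega), tested here against the elements Y of L^2(Omega). *)
Definition Hloc (R : realType) (d : nat) (disp : measure_display)
    (Omega : measurableType disp) (P : probability Omega R) (m : nat)
    (U : 'rV[R]_d -> Omega -> R[i]) : Prop :=
  forall s : seq 'I_d, (size s <= m)%N ->
    exists2 G : 'rV[R]_d -> Omega -> R[i], L2loc P G &
    forall (chi : 'rV[R]_d -> R) (Y : Omega -> R[i]),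
      test_function chi -> in_cLp P 2%:E Y ->
      cintegral (lebesgue_rV d)
        (fun x => (iter_pderiv s chi x)%:C%C * inner P Y (U x)) =
      (-1) ^+ size s *
        cintegral (lebesgue_rV d) (fun x => (chi x)%:C%C * inner P Y (G x)).

Definition H2 (R : realType) (d : nat) (disp : measure_display)
    (Omega : measurableType disp) (P : probability Omega R)
    (tau : 'rV[R]_d -> Omega -> Omega) (phi : Omega -> R[i]) : Prop :=
  in_cLp P 2%:E phi /\ Hloc P 2 (stat tau phi).

(* The equation (H_{k,0} + lam V) psi = E psi for psi in L^2(Omega), as an
   equality in L^1(Omega) + H^{-2}(Omega): V psi is in L^1(Omega), and
   H_{k,0} psi is the functional phi |-> <H_{k,0} phi, psi> on H^2(Omega). Both
   act (antilinearly) on the intersection of H^2(Omega) and L^oo(Omega). *)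
Definition eigen_equation (R : realType) (d : nat) (disp : measure_display)
    (Omega : measurableType disp) (P : probability Omega R)
    (tau : 'rV[R]_d -> Omega -> Omega) (k : 'rV[R]_d) (V : Omega -> R)
    (lam E : R) (psi : Omega -> R[i]) : Prop :=
  forall phi H0phi : Omega -> R[i],
    H2 P tau phi -> in_cLp P +oo%E phi -> is_H0 P tau k phi H0phi ->
    inner P H0phi psi + lam%:C%C * inner P phi (fun w => (V w)%:C%C * psi w) =
    E%:C%C * inner P phi psi.

(* Class C^2 on a set I of reals, with values in a real vector space X with
   seminorm N; only increments inside I count, so that the derivatives are
   one-sided at an end point of I. *)

Definition derivative_on (R : realType) (X : lmodType R) (N : X -> \bar R)
    (I : set R) (f f' : R -> X) : Prop :=
  forall l, I l ->
    N ((m - l)^-1 *: (f m - f l) - f' l) @[m --> within I l^'] --> 0%E.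

Definition continuous_on (R : realType) (X : lmodType R) (N : X -> \bar R)
    (I : set R) (f : R -> X) : Prop :=
  forall l, I l -> N (f m - f l) @[m --> within I (nbhs l)] --> 0%E.

Definition class_C2_on (R : realType) (X : lmodType R) (S : set X)
    (N : X -> \bar R) (I : set R) (f : R -> X) : Prop :=
  exists f1 f2 : R -> X,
    [/\ forall l, I l -> [/\ S (f l), S (f1 l) & S (f2 l)],
        derivative_on N I f f1, derivative_on N I f1 f2 &
        continuous_on N I f2].

(* Main.v *)
(* Differentiating the eigenvalue equation at lambda = 0 gives
   <H_{k,0} phi, psi'> + <phi, V> = E' <phi, 1> for every test element phi. Take
   phi = int \hat g(z) T_z V dz with g = exp(-s m^2), where
   m(xi) = |xi + k|^2 - |k|^2 is the symbol of H_{k,0} and vanishes exactly on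
   the sphere. Then <phi, 1> = 0 since V is centered, <V, phi> = int g d\hat C,
   and the squared norm of H_{k,0} phi is a constant times int m^2 g^2 d\hat C,
   which is at most (1/s) int g d\hat C because t e^{-t} <= 1. By
   Cauchy-Schwarz int g d\hat C <= K / s with K independent of s. For
   s = eps^{-2}, g is bounded below on the shell of width eps, whose measure is
   therefore O(eps^2), too small for the assumed limit to be positive. Since phi
   must be bounded, V is replaced in phi by truncations converging to it in L^2. *)
Require Import Defs.
From HB Require Import structures.
From mathcomp Require Import all_boot all_order all_algebra.
From mathcomp Require Import complex.
From mathcomp Require Import all_classical all_reals all_analysis.
From mathcomp Require Import ring lra measurable_realfun.
Import Order.TTheory GRing.Theory Num.Theory.
Import numFieldNormedType.Exports.
Set Implicit Arguments.
Unset Strict Implicit.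
Unset Printing Implicit Defensive.

Local Open Scope classical_set_scope.
Local Open Scope ring_scope.

(** * Integration *)

(** The factor exp(-s m^2) has no explicit Fourier transform. Its decay, Taylor expansions and
    inversion formula are instead drawn from one class, [polygauss]: polynomials times this factor,
    stable under derivatives and multiplication by polynomials, and rapidly decreasing because m is
    coercive. Fubini cannot be applied to the action itself, whose joint measurability holds only up
    to null sets. Random fields are therefore built from a product-measurable version of the
    stationary extension and compared through their pairings with elements of L^2(Omega), where
    stationarity is exact. Convergence in L^2(Omega) is recovered from these pairings by duality. No
    spectral representation of the unitary group is used: the norm of H_{k,0} phi is a double
    integral of correlations, evaluated by Fourier inversion applied to the autocorrelation of the
    smoothing kernel. The order of limits matters. The constants in front of the truncation error
    depend on s, so this error tends to 0 at fixed s. Only the resulting inequality, free of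
    truncation, is used with s tied to eps. *)

Section measure_theory.
Context {dT : measure_display} {T : measurableType dT} {R : realType}.
Implicit Types mu : {measure set T -> \bar R}.

Import HBNNSimple.

(** The integral of a nonnegative function is a supremum over the simple functions below it, and
    this set grows with the function whether or not it is measurable. *)
Lemma le_integral_nomeas mu (f g : T -> \bar R) :
  (forall x, 0 <= f x)%E -> (forall x, f x <= g x)%E ->
  (\int[mu]_x f x <= \int[mu]_x g x)%E.
Proof.
move=> f0 fg; rewrite ge0_integralTE// ge0_integralTE; last first.
  by move=> x; exact: le_trans (fg x).
apply: ereal_sup_le => /= _ [h hf <-]; exists h => // x.
exact: le_trans (hf x) (fg x).
Qed.

(* No measurability is assumed: the supremum over simple functions that defines
   the integral does not see a null set. *)
Lemma ge0_ae_eq_integral_nomeas mu (f g : T -> \bar R) :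
  (forall x, 0 <= f x)%E -> (forall x, 0 <= g x)%E ->
  {ae mu, forall x, f x = g x} ->
  (\int[mu]_x f x = \int[mu]_x g x)%E.
Proof.
suff H (f1 g1 : T -> \bar R) : (forall x, 0 <= f1 x)%E ->
    (forall x, 0 <= g1 x)%E -> {ae mu, forall x, f1 x = g1 x} ->
    (\int[mu]_x f1 x <= \int[mu]_x g1 x)%E.
  move=> f0 g0 fg; apply/eqP; rewrite eq_le !H//.
  by apply: filterS fg => x ->.
move=> f0 g0 [N [mN N0 fgN]].
rewrite !ge0_integralTE//; apply: ge_ereal_sup => /= _ [h hf <-].
pose hN := mul_nnsfun h (indic_nnsfun R (measurableC mN)).
have hNE x : hN x = h x * \1_(~` N) x by [].
have hg x : ((hN x)%:E <= g1 x)%E.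
  rewrite hNE indicE; have [xN|xN] := pselect (N x).
    by rewrite memNset ?mulr0//=; exact.
  rewrite mem_set// mulr1 (le_trans (hf x))// (_ : f1 x = g1 x)//.
  by apply: contrapT => fx; apply: xN; exact: fgN.
have <- : sintegral mu hN = sintegral mu h.
  rewrite -!integralT_nnsfun; apply: ae_eq_integral => //.
  - by apply/measurable_EFinP.
  - by apply/measurable_EFinP.
  exists N; split => // x /= hx; apply: contrapT => xN; apply: hx => _.
  by rewrite mindicE mem_set// mulr1.
by apply: ereal_sup_ubound; exists hN.
Qed.

(** This is what permits integrating a correlation of the stationary field: it agrees almost
    everywhere with a measurable function of the translation, without being known to be
    measurable. *)
Lemma ae_eq_integral_nomeas mu (f g : T -> \bar R) :
  {ae mu, forall x, f x = g x} -> (\int[mu]_x f x = \int[mu]_x g x)%E.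
Proof.
move=> fg; rewrite integralE [RHS]integralE.
congr (_ - _)%E; apply: ge0_ae_eq_integral_nomeas => //;
  by apply: filterS fg => x; rewrite !(funeposE, funenegE) => ->.
Qed.

Lemma ae_eq_Rintegral mu (f g : T -> R) :
  {ae mu, forall x, f x = g x} -> \int[mu]_x f x = \int[mu]_x g x.
Proof.
move=> fg; congr fine; apply: ae_eq_integral_nomeas.
by apply: filterS fg => x ->.
Qed.

Definition rintegrable mu (f : T -> R) := mu.-integrable setT (EFin \o f).

Lemma rintegrable_le mu (f g : T -> R) : measurable_fun setT f ->
  (forall x, `|f x| <= g x) -> rintegrable mu g -> rintegrable mu f.
Proof.
move=> mf fg; apply: le_integrable => //; first exact/measurable_EFinP.
by move=> x _ /=; rewrite lee_fin (le_trans (fg x))// ler_norm.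
Qed.

Lemma rintegrable_norm mu (f : T -> R) : rintegrable mu f ->
  rintegrable mu (fun x => `|f x|).
Proof. by move=> /integrable_abse. Qed.

Lemma rintegrableZl mu (f : T -> R) (c : R) : rintegrable mu f ->
  rintegrable mu (fun x => c * f x).
Proof.
move=> h; have := integrableZl measurableT c h.
by apply: eq_integrable => // x _.
Qed.

Lemma rintegrableD mu (f g : T -> R) : rintegrable mu f -> rintegrable mu g ->
  rintegrable mu (fun x => f x + g x).
Proof.
move=> h1 h2; have := integrableD measurableT h1 h2.
by apply: eq_integrable => // x _.
Qed.

Lemma rintegrable_meas mu (f : T -> R) : rintegrable mu f ->
  measurable_fun setT f.
Proof. by move=> /measurable_int/measurable_EFinP. Qed.

Lemma rintegrable_fin mu (f : T -> R) : rintegrable mu f ->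
  (\int[mu]_x (f x)%:E)%E = (\int[mu]_x f x)%:E.
Proof. by move=> h; rewrite /Rintegral fineK// integrable_fin_num. Qed.

Lemma rintegrable_ge0 mu (f : T -> R) : measurable_fun setT f ->
  (forall x, 0 <= f x) -> (\int[mu]_x (f x)%:E < +oo)%E -> rintegrable mu f.
Proof.
move=> mf f0 h; apply/integrableP; split; first exact/measurable_EFinP.
by under eq_integral do rewrite /= ger0_norm//.
Qed.

Lemma Rintegral_le mu (f g : T -> R) : measurable_fun setT f ->
  (forall x, `|f x| <= g x) -> rintegrable mu g ->
  `|\int[mu]_x f x| <= \int[mu]_x g x.
Proof.
move=> mf fg ig; have If := rintegrable_le mf fg ig.
apply: (le_trans (le_normr_Rintegral _ _)) => //.
by apply: le_Rintegral => //; exact: rintegrable_norm.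
Qed.

Lemma measure_bigcup_null mu (I : countType) (F : I -> set T) :
  (forall i, measurable (F i)) -> (forall i, mu (F i) = 0%E) ->
  mu (\bigcup_i F i) = 0%E.
Proof.
move=> mF F0; pose G n := if unpickle n is Some i then F i else set0.
have -> : \bigcup_i F i = \bigcup_n G n.
  apply/seteqP; split => [p [i _ h]|p [n _]].
    by exists (pickle i) => //; rewrite /G pickleK.
  by rewrite /G; case: (unpickle n) => // i h; exists i.
apply: measure_negligible.
  by apply: bigcupT_measurable => n; rewrite /G; case: (unpickle n).
apply: negligible_bigcup => n; rewrite /G; case: (unpickle n) => [i|].
  by exists (F i); split; [exact: mF|exact: F0|].
exact: negligible_set0.
Qed.

End measure_theory.

(** * Fubini under a product majorant *)

Section fubini.
Context {d1 d2 : measure_display} {T1 : measurableType d1}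
  {T2 : measurableType d2} {R : realType}.
Variables (m1 : {sigma_finite_measure set T1 -> \bar R})
  (m2 : {sigma_finite_measure set T2 -> \bar R}).

Lemma measurable_Rintegral (F : T1 * T2 -> R) : measurable_fun setT F ->
  measurable_fun setT (fun x => \int[m2]_y F (x, y)).
Proof.
move=> mF; rewrite /Rintegral.
apply: (measurableT_comp (fine_measurable measurableT)) => //.
under eq_fun do rewrite integralE.
have mEF : measurable_fun setT (EFin \o F) by exact/measurable_EFinP.
apply: emeasurable_funB.
  rewrite (_ : (fun _ => _) = fubini_F m2 (EFin \o F)^\+%E).
    exact: measurable_fun_fubini_tonelli_F (measurable_funepos mEF) _.
  apply/funext => x; rewrite /fubini_F; apply: eq_integral => y _.
  by rewrite !funeposE.
rewrite (_ : (fun _ => _) = fubini_F m2 (EFin \o F)^\-%E).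
  exact: measurable_fun_fubini_tonelli_F (measurable_funeneg mEF) _.
apply/funext => x; rewrite /fubini_F; apply: eq_integral => y _.
by rewrite !funenegE.
Qed.

(** All the double integrals below have a majorant [a x * b y]. It gives at once integrability on
    the product, on every section (not just almost every one) and of the partial integrals. *)
Lemma rintegrable_prod (F : T1 * T2 -> R) (a : T1 -> R) (b : T2 -> R) :
  measurable_fun setT F ->
  (forall x y, `|F (x, y)| <= a x * b y) ->
  rintegrable m1 a -> rintegrable m2 b ->
  rintegrable (m1 \x m2)%E F.
Proof.
move=> mF Fab ia ib.
apply/(integrable12ltyP m1 m2); first exact/measurable_EFinP.
apply: (@le_lt_trans _ _ (\int[m1]_x (`|a x| * \int[m2]_y `|b y|)%:E)%E).
  apply: le_integral_nomeas => x; first exact: integral_ge0.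
  rewrite EFinM -rintegrable_fin; last exact: rintegrable_norm.
  rewrite -ge0_integralZl//=; last first.
    by apply/measurable_EFinP; exact: measurableT_comp (rintegrable_meas ib).
  apply: le_integral_nomeas => y //=; rewrite lee_fin (le_trans (Fab x y))//.
  by rewrite (le_trans (ler_norm _))// normrM.
have := rintegrableZl (\int[m2]_y `|b y|) (rintegrable_norm ia).
move=> h; under eq_integral do rewrite mulrC.
by rewrite (rintegrable_fin h) ltry.
Qed.

Lemma rintegrable_Rintegral (F : T1 * T2 -> R) (a : T1 -> R) (b : T2 -> R) :
  measurable_fun setT F ->
  (forall x y, `|F (x, y)| <= a x * b y) ->
  rintegrable m1 a -> rintegrable m2 b ->
  rintegrable m1 (fun x => \int[m2]_y F (x, y)).
Proof.
move=> mF Fab ia ib; apply: (@rintegrable_le _ _ _ _ _ (fun x => (\int[m2]_y b y) * a x)).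
- exact: measurable_Rintegral.
- move=> x; rewrite mulrC -RintegralZl//; apply: Rintegral_le => //.
    exact: (measurableT_comp mF (pair1_measurable x)).
  exact: rintegrableZl.
- exact: rintegrableZl.
Qed.

Lemma Rintegral_Fubini (F : T1 * T2 -> R) (a : T1 -> R) (b : T2 -> R) :
  measurable_fun setT F ->
  (forall x y, `|F (x, y)| <= a x * b y) ->
  rintegrable m1 a -> rintegrable m2 b ->
  \int[m1]_x \int[m2]_y F (x, y) = \int[m2]_y \int[m1]_x F (x, y).
Proof.
move=> mF Fab ia ib; have h := rintegrable_prod mF Fab ia ib.
have := Fubini h => /=.
have ix x : rintegrable m2 (fun y => F (x, y)).
  apply: (@rintegrable_le _ _ _ _ _ (fun y => a x * b y)) => //.
    exact: (measurableT_comp mF (pair1_measurable x)).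
  exact: rintegrableZl.
have iy y : rintegrable m1 (fun x => F (x, y)).
  apply: (@rintegrable_le _ _ _ _ _ (fun x => b y * a x)) => //.
    exact: (measurableT_comp mF (pair2_measurable y)).
    by move=> x; rewrite mulrC.
  exact: rintegrableZl.
under eq_integral do rewrite rintegrable_fin//.
under [in X in _ = X -> _]eq_integral do rewrite rintegrable_fin//.
by rewrite /Rintegral => ->.
Qed.

End fubini.

(** * Affine changes of variables and an integrable weight on R^n *)

Section lebesgue_rV_theory.
Context {R : realType}.

(** [|a|] times the image of Lebesgue measure under t |-> a t + b gives every half-open interval its
    length, so it is Lebesgue measure by uniqueness. A negative [a] exchanges the open and the
    closed end of the preimage, which does not affect its length. *)
Lemma ge0_integral_affine (a b : R) (f : R -> \bar R) : a != 0 ->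
  measurable_fun setT f -> (forall x, 0 <= f x)%E ->
  (\int[lebesgue_measure]_t f (a * t + b)%R =
   `|a|^-1%:E * \int[lebesgue_measure]_t f t)%E.
Proof.
move=> a0 mf f0.
pose phi : measurableTypeR R -> measurableTypeR R := fun t => a * t + b.
have mphi : measurable_fun setT phi.
  by apply: measurable_funD => //; exact: measurable_funM.
have na0 : 0 < `|a| by rewrite normr_gt0.
pose m0 : {measure set (measurableTypeR R) -> \bar R} :=
  measure_function_pushforward__canonical__measure_function_Measure
    (@lebesgue_measure R) mphi.
pose m : {measure set (measurableTypeR R) -> \bar R} := mscale (NngNum (normr_ge0 a)) m0.
have mE (A : set (measurableTypeR R)) : measurable A -> lebesgue_measure A = m A.
  apply: lebesgue_measure_unique => _ /ocitvP[->|[[x y] /= xy ->]].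
    by rewrite !measure0.
  rewrite /m /mscale /= /pushforward lebesgue_measure_itv/= lte_fin xy.
  have -> : phi @^-1` `]x, y]%classic =
      if 0 < a then `](x - b) / a, (y - b) / a]%classic
      else `[(y - b) / a, (x - b) / a[%classic.
    apply/seteqP; split => t; case: ifPn => [ap|an]; rewrite /phi /= !in_itv/=.
    - by rewrite ltr_pdivrMr// ler_pdivlMr// ltrBlDr lerBrDr mulrC.
    - have {}an : a < 0 by rewrite lt_neqAle a0 leNgt.
      by rewrite ltr_ndivlMr// ler_ndivrMr// ltrBlDr lerBrDr mulrC andbC.
    - by rewrite ltr_pdivrMr// ler_pdivlMr// ltrBlDr lerBrDr mulrC.
    - have {}an : a < 0 by rewrite lt_neqAle a0 leNgt.
      by rewrite ltr_ndivlMr// ler_ndivrMr// ltrBlDr lerBrDr mulrC andbC.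
  case: ifPn => [ap|an]; rewrite lebesgue_measure_itv/= lte_fin.
    rewrite ltr_pM2r ?invr_gt0// ltrD2r xy -!EFinD -EFinM gtr0_norm//.
    by congr EFin; field.
  have {}an : a < 0 by rewrite lt_neqAle a0 leNgt.
  rewrite ltr_nM2r ?invr_lt0// ltrD2r xy -!EFinD -EFinM ltr0_norm//.
  by congr EFin; field.
have -> : (\int[lebesgue_measure]_t f t = \int[m]_t f t)%E.
  by apply: eq_measure_integral => A mA _; exact: mE.
rewrite ge0_integral_mscale//= ge0_integral_pushforward// preimage_setT muleA.
by rewrite -EFinM mulVf ?gt_eqF// mul1e.
Qed.

Lemma ge0_integral_rVS n (f : 'rV[R]_n.+1 -> \bar R) :
  measurable_fun setT f -> (forall x, 0 <= f x)%E ->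
  (\int[lebesgue_rV n.+1]_x f x =
   \int[@lebesgue_measure R]_t \int[lebesgue_rV n]_x f (cons_rV (t, x)))%E.
Proof.
move=> mf f0; rewrite /= /lebesgue_rV_step.
rewrite (@ge0_integral_pushforward _ _ _ _ _ _ (@measurable_cons_rV R n))//.
rewrite preimage_setT fubini_tonelli1//; last by move=> x; exact: f0.
exact: measurableT_comp (@measurable_cons_rV R n).
Qed.

Lemma measurable_affine_rV n (a : R) (b : 'rV[R]_n) :
  measurable_fun setT (fun x : 'rV[R]_n => a *: x + b).
Proof.
apply: measurable_fun_rV => i; under eq_fun do rewrite !mxE.
apply: measurable_funD => //; apply: measurable_funM => //.
exact: measurable_coord_rV.
Qed.

Lemma measurable_cons_rV1 n (t : R) :
  measurable_fun setT (fun x : 'rV[R]_n => cons_rV (t : measurableTypeR R, x)).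
Proof. exact: (measurableT_comp (@measurable_cons_rV R n)). Qed.

Lemma affine_cons_rV n (a : R) (b : 'rV[R]_n.+1) (t : R) (x : 'rV[R]_n) :
  a *: cons_rV (t : measurableTypeR R, x) + b =
  cons_rV ((a * t + b ord0 ord0 : measurableTypeR R),
           a *: x + (uncons_rV b).2).
Proof.
apply/rowP => i; rewrite /cons_rV !mxE /=.
by case: unliftP => [j ->|->] /=; rewrite ?mxE.
Qed.

(** Induction along the construction of the measure: the map acts separately on the first coordinate
    and on the others, and each coordinate contributes one factor of the Jacobian. *)
Lemma ge0_integral_affine_rV n (a : R) (b : 'rV[R]_n) (f : 'rV[R]_n -> \bar R) :
  a != 0 -> measurable_fun setT f -> (forall x, 0 <= f x)%E ->
  (\int[lebesgue_rV n]_x f (a *: x + b)%R =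
   (`|a|^-1 ^+ n)%:E * \int[lebesgue_rV n]_x f x)%E.
Proof.
move=> a0; elim: n b f => [|n IHn] b f mf f0.
  rewrite expr0 mul1e; apply: eq_integral => x _.
  by congr f; apply/rowP => -[].
have mfab : measurable_fun setT (fun x : 'rV[R]_n.+1 => f (a *: x + b)).
  exact: measurableT_comp (measurable_affine_rV _ _).
pose h (s : R) := (\int[lebesgue_rV n]_x f (cons_rV (s : measurableTypeR R, x)))%E.
have mh : measurable_fun setT h.
  apply: (measurable_fun_fubini_tonelli_F (m2 := lebesgue_rV n)
    (f \o @cons_rV R n)) => [|x]; last exact: f0.
  exact: measurableT_comp (@measurable_cons_rV R n).
have h0 s : (0 <= h s)%E by exact: integral_ge0.
rewrite !ge0_integral_rVS//.
transitivity (\int[@lebesgue_measure R]_t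
    ((`|a|^-1 ^+ n)%:E * h (a * t + b ord0 ord0)%R))%E.
  apply: eq_integral => t _; rewrite /h -(IHn (uncons_rV b).2)//.
    by apply: eq_integral => x _; rewrite affine_cons_rV.
  exact: measurableT_comp (measurable_cons_rV1 _).
have mab : measurable_fun setT (fun t : R => a * t + b ord0 ord0).
  by apply: measurable_funD => //; exact: measurable_funM.
have := @ge0_integralZl _ _ R (@lebesgue_measure R) setT measurableT
  (fun t : R => h (a * t + b ord0 ord0))
  (measurableT_comp mh mab) (`|a|^-1 ^+ n)%:E (fun t _ => h0 _).
rewrite lee_fin => ->; last by rewrite exprn_ge0// invr_ge0.
by rewrite (ge0_integral_affine _ a0 mh h0) muleA -EFinM -exprSr.
Qed.

Lemma rintegrable_affine_rV n (a : R) (b : 'rV[R]_n) (f : 'rV[R]_n -> R) :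
  a != 0 -> rintegrable (lebesgue_rV n) f ->
  rintegrable (lebesgue_rV n) (fun x => f (a *: x + b)).
Proof.
move=> a0 /integrableP[/measurable_EFinP mf fi].
have mfa : measurable_fun setT (fun x : 'rV[R]_n => f (a *: x + b)).
  exact: measurableT_comp (measurable_affine_rV _ _).
apply/integrableP; split; first exact/measurable_EFinP.
rewrite (ge0_integral_affine_rV b (f := fun x => `|(f x)%:E|%E))//.
  by rewrite lte_mul_pinfty ?lee_fin ?exprn_ge0 ?invr_ge0.
by apply: measurableT_comp => //; exact/measurable_EFinP.
Qed.

Lemma Rintegral_affine_rV n (a : R) (b : 'rV[R]_n) (f : 'rV[R]_n -> R) :
  a != 0 -> rintegrable (lebesgue_rV n) f ->
  \int[lebesgue_rV n]_x f (a *: x + b) =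
  `|a|^-1 ^+ n * \int[lebesgue_rV n]_x f x.
Proof.
move=> a0 fi.
have mf : measurable_fun setT (EFin \o f).
  by apply/measurable_EFinP; exact: (rintegrable_meas fi).
apply: EFin_inj; rewrite EFinM -!rintegrable_fin//; last first.
  exact: rintegrable_affine_rV.
rewrite integralE [in RHS]integralE muleBr//; last first.
  have := integrable_funeneg measurableT fi.
  move=> /integrable_fin_num; move=> /(_ measurableT) h.
  by rewrite fin_num_adde_defl//= fin_numN.
congr (_ - _)%E.
  rewrite -(ge0_integral_affine_rV b)//; last exact: measurable_funepos.
  by apply: eq_integral => x _; rewrite !funeposE.
rewrite -(ge0_integral_affine_rV b)//; last exact: measurable_funeneg.
by apply: eq_integral => x _; rewrite !funenegE.
Qed.

Lemma rintegrable_shift_rV n (b : 'rV[R]_n) (f : 'rV[R]_n -> R) :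
  rintegrable (lebesgue_rV n) f ->
  rintegrable (lebesgue_rV n) (fun x => f (x + b)).
Proof.
move=> /(rintegrable_affine_rV b (oner_neq0 R)).
by apply: eq_integrable => // x _ /=; rewrite scale1r.
Qed.

Lemma Rintegral_shift_rV n (b : 'rV[R]_n) (f : 'rV[R]_n -> R) :
  rintegrable (lebesgue_rV n) f ->
  \int[lebesgue_rV n]_x f (x + b) = \int[lebesgue_rV n]_x f x.
Proof.
move=> /(Rintegral_affine_rV b (oner_neq0 R)).
by under eq_Rintegral do rewrite scale1r;
  rewrite normr1 invr1 expr1n mul1r.
Qed.

Lemma oneDsqr_gt0 (t : R) : 0 < oneDsqr t.
Proof. exact: lt_le_trans ltr01 (oneDsqr_ge1 t). Qed.

(** A product of Cauchy densities, up to normalisation. Its integral factorises along the recursive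
    construction of [lebesgue_rV] and, unlike a Gaussian, it changes only by a bounded factor under
    bounded translations. *)
Definition wgt n (x : 'rV[R]_n) : R := \prod_(j < n) (oneDsqr (x ord0 j))^-1.

Lemma wgt_gt0 n (x : 'rV[R]_n) : 0 < wgt x.
Proof. by apply: prodr_gt0 => j _; rewrite invr_gt0 oneDsqr_gt0. Qed.

Lemma wgt_ge0 n (x : 'rV[R]_n) : 0 <= wgt x.
Proof. exact/ltW/wgt_gt0. Qed.

Lemma wgt_le1 n (x : 'rV[R]_n) : wgt x <= 1.
Proof.
have -> : 1 = \prod_(j < n) 1 :> R by rewrite big1.
apply: ler_prod => j _; rewrite invr_ge0 ltW ?oneDsqr_gt0//=.
by rewrite invf_le1 ?oneDsqr_gt0// oneDsqr_ge1.
Qed.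

Lemma wgtN n (x : 'rV[R]_n) : wgt (- x) = wgt x.
Proof. by apply: eq_bigr => j _; rewrite mxE /oneDsqr sqrrN. Qed.

Lemma measurable_wgt n : measurable_fun setT (@wgt n).
Proof.
apply: measurable_prod => j _.
have h : measurable_fun setT (fun t : R => (oneDsqr t)^-1).
  apply: continuous_measurable_fun; exact: continuous_oneDsqrV.
exact: (measurableT_comp h (measurable_coord_rV j)).
Qed.

Lemma wgt_cons n (t : R) (x : 'rV[R]_n) :
  wgt (cons_rV (t : measurableTypeR R, x)) = (oneDsqr t)^-1 * wgt x.
Proof.
rewrite /wgt big_ord_recl; congr (_ * _).
  by rewrite /cons_rV mxE unlift_none.
by apply: eq_bigr => j _; rewrite /cons_rV mxE liftK.
Qed.

Lemma rintegrable_wgt n : rintegrable (lebesgue_rV n) (@wgt n).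
Proof.
apply: rintegrable_ge0; [exact: measurable_wgt|by move=> x; exact: wgt_ge0|].
elim: n => [|n IHn].
  rewrite /= integral_dirac//=; last by apply/measurable_EFinP; exact: measurable_wgt.
  by rewrite diracT mul1e ltry.
rewrite ge0_integral_rVS; last 2 first.
- by apply/measurable_EFinP; exact: measurable_wgt.
- by move=> x; rewrite lee_fin wgt_ge0.
have E (t : R) : (\int[lebesgue_rV n]_x (wgt (cons_rV (t : measurableTypeR R, x)))%:E
    = ((oneDsqr t)^-1)%:E * \int[lebesgue_rV n]_x (wgt x)%:E)%E.
  under eq_integral do rewrite wgt_cons EFinM.
  rewrite ge0_integralZl//=.
    by apply/measurable_EFinP; exact: measurable_wgt.
  by move=> x _; rewrite lee_fin wgt_ge0.
under eq_integral do rewrite E.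
have cV : continuous (fun t : R => (oneDsqr t)^-1) by exact: continuous_oneDsqrV.
rewrite ge0_integralZr//=; last 2 first.
- apply/measurable_EFinP; exact: continuous_measurable_fun.
- by apply: integral_ge0 => x _; rewrite lee_fin wgt_ge0.
rewrite ge0_symfun_integralT//; last by move=> t; rewrite /= /oneDsqr sqrrN.
rewrite -set_itvcy integral0y_oneDsqr.
by rewrite lte_mul_pinfty// -EFinM lee_fin mulr_ge0// divr_ge0// pi_ge0.
Qed.

(** The sigma-algebra on row vectors is generated by the coordinates and not by the open sets. The
    function is therefore exhibited as a pointwise limit of its values at lattice points of mesh
    [1 / m.+1]; each approximation depends on countably many measurable cells. *)
Lemma continuous_measurable_rV n (f : 'rV[R]_n -> R) : continuous f ->
  measurable_fun setT f.
Proof.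
move=> cf.
pose fl (m : nat) (x : 'rV[R]_n) : 'rV[int]_n :=
  \row_j Num.floor (x ord0 j * m.+1%:R).
pose up (m : nat) (q : 'rV[int]_n) : 'rV[R]_n :=
  \row_j ((q ord0 j)%:~R / m.+1%:R).
apply: (@measurable_fun_cvg _ _ _ _ (fun m x => f (up m (fl m x)))).
  move=> m _ Y mY; rewrite setTI.
  rewrite (_ : _ @^-1` _ = \bigcup_(q in [set q | Y (f (up m q))])
      \bigcap_(j in [set: 'I_n])
        ((fun x : 'rV[R]_n => Num.floor (x ord0 j * m.+1%:R)) @^-1` [set q ord0 j])).
    rewrite bigcup_mkcond; apply: countable_bigcupT_measurable => // q.
    case: ifPn => // _; apply: fin_bigcap_measurable => // j _.
    have h : measurable_fun setT (fun x : 'rV[R]_n => x ord0 j * m.+1%:R).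
      by apply: measurable_funM => //; exact: measurable_coord_rV.
    rewrite (_ : _ @^-1` _ = setT `&` (fun x : 'rV[R]_n => x ord0 j * m.+1%:R) @^-1`
      `[(q ord0 j)%:~R, (q ord0 j + 1)%:~R[); first exact: h.
    rewrite setTI; apply/seteqP; split => x /=; rewrite in_itv/=.
      by move=> <-; exact: floor_itv.
    exact: floor_def.
  apply/seteqP; split => [x /= Yx|x [q /= Yq qx]].
    by exists (fl m x) => // j _ /=; rewrite mxE.
  rewrite (_ : fl m x = q)//; apply/rowP => j; rewrite mxE; exact: qx.
move=> x _; apply: (continuous_cvg _ (cf x)).
apply/cvgrPdist_lt => e e0; near=> m.
rewrite [ltLHS]mx_normrE; apply/bigmax_ltP; split => // -[i j] _ /=; rewrite !mxE.
have m0 : 0 < m.+1%:R :> R by [].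
rewrite ord1 (_ : _ - _ = (x ord0 j * m.+1%:R - (Num.floor (x ord0 j * m.+1%:R))%:~R) / m.+1%:R).
  rewrite normrM ger0_norm ?subr_ge0 ?floor_le//.
  rewrite normfV gtr0_norm// ltr_pdivrMr//.
  apply: (@lt_trans _ _ 1); last first.
    rewrite -ltr_pdivrMr// div1r; near: m.
    exact: (near_infty_natSinv_lt (PosNum e0)).
  by rewrite ltrBlDl; have := floorD1_gt (x ord0 j * m.+1%:R); rewrite intrD.
by field.
Unshelve. all: by end_near. Qed.

End lebesgue_rV_theory.

(** * Complex-valued functions *)

Section complex_numbers.
Context {R : realType}.
Implicit Types z : R[i].

Lemma ReD z1 z2 : complex.Re (z1 + z2) = complex.Re z1 + complex.Re z2.
Proof. by case: z1 z2 => [? ?] []. Qed.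

Lemma ImD z1 z2 : complex.Im (z1 + z2) = complex.Im z1 + complex.Im z2.
Proof. by case: z1 z2 => [? ?] []. Qed.

Lemma ReM z1 z2 : complex.Re (z1 * z2) =
  complex.Re z1 * complex.Re z2 - complex.Im z1 * complex.Im z2.
Proof. by case: z1 z2 => [? ?] []. Qed.

Lemma ImM z1 z2 : complex.Im (z1 * z2) =
  complex.Re z1 * complex.Im z2 + complex.Im z1 * complex.Re z2.
Proof. by case: z1 z2 => [? ?] []. Qed.

Lemma ReZ (a : R) z : complex.Re (a%:C%C * z) = a * complex.Re z.
Proof. by rewrite ReM /= mul0r subr0. Qed.

Lemma ImZ (a : R) z : complex.Im (a%:C%C * z) = a * complex.Im z.
Proof. by rewrite ImM /= mul0r addr0. Qed.

Lemma Re_conj z : complex.Re (conjc z) = complex.Re z.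
Proof. by case: z. Qed.

Lemma Im_conj z : complex.Im (conjc z) = - complex.Im z.
Proof. by case: z. Qed.

Lemma conjcM z1 z2 : conjc (z1 * z2) = conjc z1 * conjc z2.
Proof. exact: rmorphM. Qed.

Lemma complex_eqP z1 z2 : complex.Re z1 = complex.Re z2 ->
  complex.Im z1 = complex.Im z2 -> z1 = z2.
Proof. by case: z1 z2 => [? ?] [? ?] /= -> ->. Qed.

Lemma normcEsqr z : Normc.normc z ^+ 2 = complex.Re z ^+ 2 + complex.Im z ^+ 2.
Proof. by case: z => a b /=; rewrite sqr_sqrtr// addr_ge0// sqr_ge0. Qed.

Lemma normc_ge0 z : 0 <= Normc.normc z.
Proof. by case: z => a b /=; rewrite sqrtr_ge0. Qed.

Lemma Re_le_normc z : `|complex.Re z| <= Normc.normc z.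
Proof.
rewrite -ler_sqr ?nnegrE ?normc_ge0// real_normK ?num_real// normcEsqr.
by rewrite lerDl sqr_ge0.
Qed.

Lemma Im_le_normc z : `|complex.Im z| <= Normc.normc z.
Proof.
rewrite -ler_sqr ?nnegrE ?normc_ge0// real_normK ?num_real// normcEsqr.
by rewrite lerDr sqr_ge0.
Qed.

Lemma normc_le_ReIm z : Normc.normc z <= `|complex.Re z| + `|complex.Im z|.
Proof.
rewrite -ler_sqr ?nnegrE ?normc_ge0 ?addr_ge0// normcEsqr sqrrD.
rewrite !real_normK ?num_real// addrAC lerDl.
by rewrite mulrn_wge0// mulr_ge0.
Qed.

Lemma normc_conj z : Normc.normc (conjc z) = Normc.normc z.
Proof. by case: z => a b /=; rewrite sqrrN. Qed.

Lemma normc_real (x : R) : Normc.normc (x%:C)%C = `|x|.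
Proof. by rewrite /= expr0n addr0 sqrtr_sqr. Qed.

Lemma normcM z1 z2 : Normc.normc (z1 * z2) = Normc.normc z1 * Normc.normc z2.
Proof. exact: Normc.normcM. Qed.

Lemma normcD z1 z2 : Normc.normc (z1 + z2) <= Normc.normc z1 + Normc.normc z2.
Proof. exact: le_normcD. Qed.

Lemma normcN z : Normc.normc (- z) = Normc.normc z.
Proof. exact: normcN. Qed.

Lemma mul_conjc z : conjc z * z = (Normc.normc z ^+ 2)%:C%C.
Proof.
by apply: complex_eqP; rewrite ?ReM ?ImM Re_conj Im_conj ?normcEsqr/=; ring.
Qed.

Definition cis (t : R) : R[i] := (cos t +i* sin t)%C.

Lemma cisD s t : cis (s + t) = cis s * cis t.
Proof.
by apply: complex_eqP; rewrite ?ReM ?ImM /= ?cosD ?sinD//; ring.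
Qed.

Lemma cisN t : cis (- t) = conjc (cis t).
Proof. by rewrite /cis cosN sinN. Qed.

Lemma normc_cis t : Normc.normc (cis t) = 1.
Proof. by rewrite /= cos2Dsin2 sqrtr1. Qed.

End complex_numbers.

(** * Measurability and integration of complex-valued functions *)

Section complex_integral.
Context {dT : measure_display} {T : measurableType dT} {R : realType}.
Implicit Types (mu : {measure set T -> \bar R}) (f g : T -> R[i]).

Lemma cmeasurableM f g : cmeasurable f -> cmeasurable g ->
  cmeasurable (fun x => f x * g x).
Proof.
move=> [f1 f2] [g1 g2]; split.
  under eq_fun do rewrite ReM.
  by apply: measurable_funB; exact: measurable_funM.
under eq_fun do rewrite ImM.
by apply: measurable_funD; exact: measurable_funM.
Qed.

Lemma cmeasurableD f g : cmeasurable f -> cmeasurable g ->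
  cmeasurable (fun x => f x + g x).
Proof.
move=> [f1 f2] [g1 g2]; split.
  by under eq_fun do rewrite ReD; exact: measurable_funD.
by under eq_fun do rewrite ImD; exact: measurable_funD.
Qed.

Lemma cmeasurable_conj f : cmeasurable f -> cmeasurable (fun x => conjc (f x)).
Proof.
move=> [f1 f2]; split.
  by under eq_fun do rewrite Re_conj.
by under eq_fun do rewrite Im_conj -mulN1r; exact: measurable_funM.
Qed.

Lemma cmeasurable_real (f : T -> R) : measurable_fun setT f ->
  cmeasurable (fun x => (f x)%:C%C).
Proof. by move=> mf; split => //=; exact: measurable_cst. Qed.

Lemma cmeasurable_cst (c : R[i]) : cmeasurable (fun _ : T => c).
Proof. by split; exact: measurable_cst. Qed.

Lemma cmeasurable_cis (f : T -> R) : measurable_fun setT f ->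
  cmeasurable (fun x => cis (f x)).
Proof.
move=> mf; split => /=; apply: measurableT_comp => //.
  by apply: continuous_measurable_fun; exact: continuous_cos.
by apply: continuous_measurable_fun; exact: continuous_sin.
Qed.

Lemma measurable_normc f : cmeasurable f ->
  measurable_fun setT (fun x => Normc.normc (f x)).
Proof.
move=> [f1 f2].
rewrite (_ : (fun _ => _) = (fun x => Num.sqrt (complex.Re (f x) ^+ 2 +
  complex.Im (f x) ^+ 2))); last by apply/funext => x; case: (f x).
apply: (measurableT_comp (continuous_measurable_fun (@sqrt_continuous R))).
by apply: measurable_funD; apply: measurable_funX.
Qed.

Definition cintegrable mu f :=
  rintegrable mu (fun x => complex.Re (f x)) /\
  rintegrable mu (fun x => complex.Im (f x)).

Lemma cintegrable_le mu f (g : T -> R) : cmeasurable f ->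
  (forall x, Normc.normc (f x) <= g x) -> rintegrable mu g -> cintegrable mu f.
Proof.
move=> [m1 m2] fg ig; split; apply: (rintegrable_le _ _ ig) => // x.
  exact: le_trans (Re_le_normc _) (fg x).
exact: le_trans (Im_le_normc _) (fg x).
Qed.

Lemma cintegrable_meas mu f : cintegrable mu f -> cmeasurable f.
Proof. by move=> [/rintegrable_meas ? /rintegrable_meas ?]. Qed.

(** Real and imaginary parts are estimated separately, which costs a factor 2. The factors 2 and 4
    in the later bounds on pairings come from here. *)
Lemma cintegral_le mu f (g : T -> R) : cmeasurable f ->
  (forall x, Normc.normc (f x) <= g x) -> rintegrable mu g ->
  Normc.normc (cintegral mu f) <= 2 * \int[mu]_x g x.
Proof.
move=> [m1 m2] fg ig; apply: le_trans (normc_le_ReIm _) _.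
rewrite mulr_natl mulr2n; apply: lerD => /=; apply: Rintegral_le => // x.
  exact: le_trans (Re_le_normc _) (fg x).
exact: le_trans (Im_le_normc _) (fg x).
Qed.

Lemma cintegralD mu f g : cintegrable mu f -> cintegrable mu g ->
  cintegral mu (fun x => f x + g x) = cintegral mu f + cintegral mu g.
Proof.
move=> [f1 f2] [g1 g2]; apply: complex_eqP; rewrite ?ReD ?ImD /=.
  by under eq_Rintegral do rewrite ReD; rewrite RintegralD.
by under eq_Rintegral do rewrite ImD; rewrite RintegralD.
Qed.

Lemma cintegrableD mu f g : cintegrable mu f -> cintegrable mu g ->
  cintegrable mu (fun x => f x + g x).
Proof.
move=> [f1 f2] [g1 g2]; split.
  by under eq_fun do rewrite ReD; exact: rintegrableD.
by under eq_fun do rewrite ImD; exact: rintegrableD.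
Qed.

Lemma rintegrableN mu (f : T -> R) : rintegrable mu f ->
  rintegrable mu (fun x => - f x).
Proof. by move=> /(rintegrableZl (-1)); under eq_fun do rewrite mulN1r. Qed.

Lemma cintegrableZl mu f (c : R[i]) : cintegrable mu f ->
  cintegrable mu (fun x => c * f x).
Proof.
move=> [f1 f2]; split.
  under eq_fun do rewrite ReM.
  by apply: rintegrableD; [|apply: rintegrableN]; exact: rintegrableZl.
under eq_fun do rewrite ImM.
by apply: rintegrableD; exact: rintegrableZl.
Qed.

Lemma cintegralZl mu f (c : R[i]) : cintegrable mu f ->
  cintegral mu (fun x => c * f x) = c * cintegral mu f.
Proof.
move=> [f1 f2]; apply: complex_eqP; rewrite ?ReM ?ImM /=.
  under eq_Rintegral do rewrite ReM.
  by rewrite RintegralB// ?RintegralZl//; exact: rintegrableZl.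
under eq_Rintegral do rewrite ImM.
by rewrite RintegralD// ?RintegralZl//; exact: rintegrableZl.
Qed.

Lemma cintegrable_conj mu f : cintegrable mu f ->
  cintegrable mu (fun x => conjc (f x)).
Proof.
move=> [f1 f2]; split; first by under eq_fun do rewrite Re_conj.
by under eq_fun do rewrite Im_conj; exact: rintegrableN.
Qed.

Lemma cintegral_conj mu f : cintegrable mu f ->
  cintegral mu (fun x => conjc (f x)) = conjc (cintegral mu f).
Proof.
move=> [f1 f2]; apply: complex_eqP; rewrite ?Re_conj ?Im_conj /=.
  by under eq_Rintegral do rewrite Re_conj.
under eq_Rintegral do rewrite Im_conj -mulN1r.
by rewrite RintegralZl// mulN1r.
Qed.

Lemma cintegral_real mu (f : T -> R) :
  cintegral mu (fun x => (f x)%:C%C) = (\int[mu]_x f x)%:C%C.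
Proof.
apply: complex_eqP => //=; rewrite /Rintegral /=.
by rewrite (_ : (fun=> _) = cst 0%E)// integral0.
Qed.

Lemma ae_eq_cintegral mu f g : {ae mu, forall x, f x = g x} ->
  cintegral mu f = cintegral mu g.
Proof.
move=> fg; apply: complex_eqP; apply: ae_eq_Rintegral.
  by apply: filterS fg => x ->.
by apply: filterS fg => x ->.
Qed.

Lemma eq_cintegral mu f g : f =1 g -> cintegral mu f = cintegral mu g.
Proof. by move=> /funext ->. Qed.

Lemma cintegrableB mu f g : cintegrable mu f -> cintegrable mu g ->
  cintegrable mu (fun x => f x - g x).
Proof.
move=> fi gi; have := cintegrableD fi (cintegrableZl (-1) gi).
by under eq_fun do rewrite mulN1r.
Qed.

Lemma cintegralB mu f g : cintegrable mu f -> cintegrable mu g ->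
  cintegral mu (fun x => f x - g x) = cintegral mu f - cintegral mu g.
Proof.
move=> fi gi; rewrite -mulN1r -(cintegralZl _ gi) -(cintegralD fi (cintegrableZl _ gi)).
by apply: eq_cintegral => x; rewrite mulN1r.
Qed.

End complex_integral.

Section complex_fubini.
Context {d1 d2 : measure_display} {T1 : measurableType d1}
  {T2 : measurableType d2} {R : realType}.
Variables (m1 : {sigma_finite_measure set T1 -> \bar R})
  (m2 : {sigma_finite_measure set T2 -> \bar R}).

Lemma cmeasurable_comp (f : T2 -> R[i]) (h : T1 -> T2) : cmeasurable f ->
  measurable_fun setT h -> cmeasurable (fun x => f (h x)).
Proof.
by move=> [f1 f2] mh; split;
  [exact: (measurableT_comp f1 mh) | exact: (measurableT_comp f2 mh)].
Qed.

Lemma cmeasurable_cintegral (F : T1 * T2 -> R[i]) : cmeasurable F ->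
  cmeasurable (fun x => cintegral m2 (fun y => F (x, y))).
Proof.
by move=> [F1 F2]; split; [have := measurable_Rintegral m2 F1
  | have := measurable_Rintegral m2 F2].
Qed.

Lemma cintegrable_cintegral (F : T1 * T2 -> R[i]) (a : T1 -> R) (b : T2 -> R) :
  cmeasurable F ->
  (forall x y, Normc.normc (F (x, y)) <= a x * b y) ->
  rintegrable m1 a -> rintegrable m2 b ->
  cintegrable m1 (fun x => cintegral m2 (fun y => F (x, y))).
Proof.
move=> [F1 F2] Fab ia ib; split.
  apply: (rintegrable_Rintegral F1 _ ia ib) => x y.
  exact: le_trans (Re_le_normc _) (Fab x y).
apply: (rintegrable_Rintegral F2 _ ia ib) => x y.
exact: le_trans (Im_le_normc _) (Fab x y).
Qed.

Lemma cintegral_Fubini (F : T1 * T2 -> R[i]) (a : T1 -> R) (b : T2 -> R) :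
  cmeasurable F ->
  (forall x y, Normc.normc (F (x, y)) <= a x * b y) ->
  rintegrable m1 a -> rintegrable m2 b ->
  cintegral m1 (fun x => cintegral m2 (fun y => F (x, y))) =
  cintegral m2 (fun y => cintegral m1 (fun x => F (x, y))).
Proof.
move=> [F1 F2] Fab ia ib; apply: complex_eqP => /=.
  apply: (Rintegral_Fubini F1 _ ia ib) => x y.
  exact: le_trans (Re_le_normc _) (Fab x y).
apply: (Rintegral_Fubini F2 _ ia ib) => x y.
exact: le_trans (Im_le_normc _) (Fab x y).
Qed.

End complex_fubini.

Section complex_lebesgue.
Context {R : realType} (n : nat).

Lemma cintegrable_affine_rV (a : R) (b : 'rV[R]_n) (f : 'rV[R]_n -> R[i]) :
  a != 0 -> cintegrable (lebesgue_rV n) f ->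
  cintegrable (lebesgue_rV n) (fun x => f (a *: x + b)).
Proof. by move=> a0 [f1 f2]; split; [have := rintegrable_affine_rV b a0 f1
  | have := rintegrable_affine_rV b a0 f2]. Qed.

Lemma cintegral_affine_rV (a : R) (b : 'rV[R]_n) (f : 'rV[R]_n -> R[i]) :
  a != 0 -> cintegrable (lebesgue_rV n) f ->
  cintegral (lebesgue_rV n) (fun x => f (a *: x + b)) =
  (`|a|^-1 ^+ n)%:C%C * cintegral (lebesgue_rV n) f.
Proof.
move=> a0 [f1 f2]; apply: complex_eqP; rewrite ?ReM ?ImM /= !mul0r ?subr0 ?addr0.
  exact: (Rintegral_affine_rV b a0 f1).
exact: (Rintegral_affine_rV b a0 f2).
Qed.

Lemma cintegral_shift_rV (b : 'rV[R]_n) (f : 'rV[R]_n -> R[i]) :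
  cintegrable (lebesgue_rV n) f ->
  cintegral (lebesgue_rV n) (fun x => f (x + b)) = cintegral (lebesgue_rV n) f.
Proof.
move=> [f1 f2]; apply: complex_eqP => /=.
  exact: (Rintegral_shift_rV b f1).
exact: (Rintegral_shift_rV b f2).
Qed.

End complex_lebesgue.

(** * Derivatives and functions of Gaussian type *)

Section directional_derivative.
Context {R : realType} {V : normedModType R}.
Implicit Types (f : V -> R) (x v : V).

(** A quadratic remainder takes the place of differentiation under the integral sign: for a Fourier
    transform it is obtained by integrating the pointwise Taylor bounds of cos and sin. For affine
    functions it applies with [M = 0]. *)
Lemma is_derive_bound f x v (c M : R) :
  (forall h, `|h| <= 1 -> `|f (h *: v + x) - f x - h * c| <= M * h ^+ 2) ->
  is_derive x v f c.
Proof.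
move=> H.
have H' : h^-1 *: (f (h *: v + x) - f x) @[h --> (0:R)^'] --> c.
  apply/cvgrPdist_le => e e0.
  have M0 : 0 <= `|M| by [].
  near=> h.
  have h0 : h != 0 by near: h; exact: nbhs_dnbhs_neq.
  have h1 : `|h| <= 1.
    by near: h; apply: dnbhs0_le.
  have hM : `|h| <= e / (`|M| + 1).
    by near: h; apply: dnbhs0_le; rewrite divr_gt0// ltr_wpDl.
  have nh0 : 0 < `|h| by rewrite normr_gt0.
  rewrite (_ : c - _ = - (h^-1 * (f (h *: v + x) - f x - h * c))); last first.
    by rewrite /GRing.scale /=; field.
  rewrite normrN normrM normfV ler_pdivrMl//.
  apply: le_trans (H _ h1) _; rewrite -real_normK ?num_real//.
  move: hM; rewrite ler_pdivlMr ?ltr_wpDl//.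
  have := ler_norm M; move: (`|h|) nh0 (`|M|) M0 => u u0 m m0 Mm um.
  by have := mulr_ge0 (ltW u0) (ltW u0); nra.
apply: DeriveDef; first by apply/cvg_ex; exists c.
exact: (cvg_lim (@Rhausdorff R) H').
Unshelve. all: by end_near. Qed.

Lemma is_derive_line f x v (c : R) :
  is_derive (0 : R) (1 : R) (fun t : R => f (t *: v + x)) c ->
  is_derive x v f c.
Proof.
have E : (fun h : R => h^-1 *: ((f \o shift x) (h *: v) - f x)) =
    (fun h => h^-1 *: (((fun t : R => f (t *: v + x)) \o shift 0) (h *: (1 : R)) -
      f (0 *: v + x))).
  by apply/funext => h /=; rewrite addr0 scale0r add0r [h *: 1]mulr1.
by move=> [d0 e0]; split; [rewrite /derivable E|rewrite /derive E].
Qed.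

Lemma is_derive_along f x v (t c : R) : is_derive (t *: v + x) v f c ->
  is_derive t (1 : R) (fun u : R => f (u *: v + x)) c.
Proof.
have E : (fun h : R => h^-1 *: (((fun u : R => f (u *: v + x)) \o shift t)
      (h *: (1 : R)) - f (t *: v + x))) =
    (fun h => h^-1 *: ((f \o shift (t *: v + x)) (h *: v) - f (t *: v + x))).
  by apply/funext => h /=; rewrite [h *: 1]mulr1 scalerDl addrA.
by move=> [d0 e0]; split; [rewrite /derivable E|rewrite /derive E].
Qed.

(** A derivative along [v] carries information on one line only, so the chain rule is transported
    from functions of one real variable rather than from differentials. *)
Lemma is_derive_comp (g : R -> R) f x v (c e : R) :
  is_derive x v f c -> is_derive (f x) (1 : R) g e ->
  is_derive x v (fun y => g (f y)) (e * c).
Proof.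
move=> df dg; apply: is_derive_line.
apply: (@is_derive1_comp R g (fun t => f (t *: v + x)) 0 e c).
  by rewrite scale0r add0r.
by apply: is_derive_along; rewrite scale0r add0r.
Qed.

End directional_derivative.

(** * Polynomials times a Gaussian of the symbol *)

Section gaussian_type_functions.
Context {R : realType} {d : nat}.
Implicit Types (f p q : 'rV[R]_d -> R) (x : 'rV[R]_d).

(** An inductive predicate on functions, so that derivatives, continuity and polynomial growth each
    follow by one induction without any normal form. *)
Inductive polyfun : ('rV[R]_d -> R) -> Prop :=
| polyfun_cst c : polyfun (fun=> c)
| polyfun_coord j : polyfun (fun x => x ord0 j)
| polyfunD p q : polyfun p -> polyfun q -> polyfun (fun x => p x + q x)
| polyfunM p q : polyfun p -> polyfun q -> polyfun (fun x => p x * q x).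

Lemma is_derive_coord (i j : 'I_d) x :
  is_derive x (basis_vec R j) (fun y : 'rV[R]_d => y ord0 i) (i == j)%:R.
Proof.
apply: (@is_derive_bound _ _ _ _ _ _ 0) => h _.
by rewrite mul0r !mxE eqxx /= addrK subrr normr0.
Qed.

Lemma polyfun_derive p j : polyfun p -> exists2 p', polyfun p' &
  forall x, is_derive x (basis_vec R j) p (p' x).
Proof.
elim=> [c|i|p1 p2 _ [q1 Q1 D1] _ [q2 Q2 D2]|p1 p2 P1 [q1 Q1 D1] P2 [q2 Q2 D2]].
- by exists (fun=> 0); [exact: polyfun_cst|move=> x; exact: is_derive_cst].
- exists (fun=> (i == j)%:R); first exact: polyfun_cst.
  by move=> x; exact: is_derive_coord.
- exists (fun x => q1 x + q2 x); first exact: polyfunD.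
  by move=> x; exact: is_deriveD.
- exists (fun x => p1 x * q2 x + p2 x * q1 x).
    by apply: polyfunD; exact: polyfunM.
  by move=> x; exact: is_deriveM.
Qed.

Lemma continuous_polyfun p : polyfun p -> continuous p.
Proof.
elim=> [c|i|p1 p2 _ c1 _ c2|p1 p2 _ c1 _ c2] x.
- exact: cst_continuous.
- exact: coord_continuous.
- exact: (continuousD (c1 x) (c2 x)).
- exact: (continuousM (c1 x) (c2 x)).
Qed.

Lemma polyfun_sum (I : Type) (s : seq I) (p : I -> 'rV[R]_d -> R) :
  (forall i, polyfun (p i)) -> polyfun (fun x => \sum_(i <- s) p i x).
Proof.
move=> P; elim: s => [|i s IHs].
  by under eq_fun do rewrite big_nil; exact: polyfun_cst.
by under eq_fun do rewrite big_cons; exact: polyfunD.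
Qed.

(* |xi + k|^2 - |k|^2, the Fourier multiplier of H_{k,0}. *)
Definition symb (k x : 'rV[R]_d) : R :=
  \sum_(j < d) (x ord0 j * x ord0 j + 2 * k ord0 j * x ord0 j).

Lemma polyfun_symb k : polyfun (symb k).
Proof.
apply: polyfun_sum => j; apply: polyfunD; first by apply: polyfunM; exact: polyfun_coord.
by apply: polyfunM; [exact: polyfun_cst|exact: polyfun_coord].
Qed.

(* It concentrates on the sphere [symb k = 0] as [s] tends to infinity. *)
Definition gauss (k : 'rV[R]_d) (s : R) x := expR (- (s * symb k x ^+ 2)).

(** The exponent is quartic, so derivatives of [gauss] bring out polynomials of growing degree.
    Allowing an arbitrary polynomial factor makes the class stable under every operation used below.
    Squaring doubles the parameter, as in [polygauss_sqr]. *)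
Definition polygauss k s f :=
  exists2 p, polyfun p & f = (fun x => p x * gauss k s x).

Lemma polygauss_gauss k s : polygauss k s (gauss k s).
Proof.
exists (fun=> 1); first exact: polyfun_cst.
by apply/funext => x; rewrite mul1r.
Qed.

Lemma polygaussM k s p f : polyfun p -> polygauss k s f ->
  polygauss k s (fun x => p x * f x).
Proof.
move=> pp [q qq ->]; exists (fun x => p x * q x); first exact: polyfunM.
by apply/funext => x; rewrite mulrA.
Qed.

Lemma polygaussD k s f g : polygauss k s f -> polygauss k s g ->
  polygauss k s (fun x => f x + g x).
Proof.
move=> [p pp ->] [q qq ->]; exists (fun x => p x + q x); first exact: polyfunD.
by apply/funext => x; rewrite mulrDl.
Qed.

Lemma polygauss_sqr k s f : polygauss k s f -> polygauss k (s + s) (fun x => f x ^+ 2).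
Proof.
move=> [p pp ->]; exists (fun x => p x * p x); first exact: polyfunM.
apply/funext => x; rewrite exprMn expr2 expr2 /gauss -expRD; congr (_ * expR _).
by ring.
Qed.

Lemma is_derive_gauss k s j : exists2 p, polyfun p &
  forall x, is_derive x (basis_vec R j) (gauss k s) (p x * gauss k s x).
Proof.
have [q qq dq] := polyfun_derive j
  (polyfunM (polyfun_cst (- s)) (polyfunM (polyfun_symb k) (polyfun_symb k))).
exists q => // x; rewrite mulrC.
have E y : gauss k s y = expR (- s * (symb k y * symb k y)).
  by rewrite /gauss; congr expR; ring.
rewrite (_ : gauss k s = (fun y => expR (- s * (symb k y * symb k y)))); last first.
  exact/funext.
by apply: is_derive_comp => //; exact: is_derive_expR.
Qed.

Lemma polygauss_derive k s f j : polygauss k s f -> exists2 f', polygauss k s f' &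
  forall x, is_derive x (basis_vec R j) f (f' x).
Proof.
move=> [p pp ->].
have [p' pp' dp] := polyfun_derive j pp; have [q qq dq] := is_derive_gauss k s j.
exists (fun x => p x * (q x * gauss k s x) + gauss k s x * p' x).
  exists (fun x => p x * q x + p' x); first by apply: polyfunD => //; exact: polyfunM.
  by apply/funext => x; ring.
by move=> x; exact: is_deriveM.
Qed.

Lemma continuous_gauss k s : continuous (gauss k s).
Proof.
move=> x; apply: continuous_comp; last exact: continuous_expR.
have c := continuous_polyfun
  (polyfunM (polyfun_cst (- s)) (polyfunM (polyfun_symb k) (polyfun_symb k))).
rewrite (_ : (fun y => _) = (fun y => - s * (symb k y * symb k y))); first exact: c.
by apply/funext => y; ring.
Qed.

Lemma continuous_polygauss k s f : polygauss k s f -> continuous f.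
Proof.
move=> [p pp ->] x.
have c1 : {for x, continuous p} by exact: continuous_polyfun.
have c2 : {for x, continuous (gauss k s)} by exact: continuous_gauss.
exact: (continuousM c1 c2).
Qed.

Lemma measurable_polygauss k s f : polygauss k s f -> measurable_fun setT f.
Proof. by move=> /continuous_polygauss /continuous_measurable_rV. Qed.

Lemma dotv_ge0 x : 0 <= dotv x x.
Proof. by apply: sumr_ge0 => j _; rewrite -expr2 sqr_ge0. Qed.

Lemma sqr_coord_le_dotv x j : x ord0 j ^+ 2 <= dotv x x.
Proof.
rewrite /dotv (bigD1 j)//= -expr2 lerDl.
by apply: sumr_ge0 => i _; rewrite -expr2 sqr_ge0.
Qed.

Definition onept (x : 'rV[R]_d) : R := 1 + dotv x x.

Lemma onept_ge1 x : 1 <= onept x.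
Proof. by rewrite lerDl dotv_ge0. Qed.

Lemma onept_gt0 x : 0 < onept x.
Proof. exact: lt_le_trans (onept_ge1 x). Qed.

Lemma polyfun_bound p : polyfun p -> exists N, exists2 C, 0 <= C &
  forall x, `|p x| <= C * onept x ^+ N.
Proof.
elim=> [c|i|p1 p2 _ [n1 [c1 c10 b1]] _ [n2 [c2 c20 b2]]
  |p1 p2 _ [n1 [c1 c10 b1]] _ [n2 [c2 c20 b2]]].
- by exists 0%N; exists `|c| => // x; rewrite expr0 mulr1.
- exists 1%N; exists 1 => // x; rewrite mul1r expr1 /onept.
  have := sqr_coord_le_dotv x i; have := sqr_ge0 (`|x ord0 i| - 1).
  have := sqr_ge0 (x ord0 i); rewrite -(real_normK (num_real (x ord0 i))).
  by nra.
- exists (n1 + n2)%N; exists (c1 + c2); first exact: addr_ge0.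
  move=> x; apply: le_trans (ler_normD _ _) _; rewrite mulrDl; apply: lerD.
    apply: le_trans (b1 x) _; rewrite ler_wpM2l// exprD ler_peMr ?exprn_ge0//.
      by rewrite ltW ?onept_gt0.
    by rewrite exprn_ege1// onept_ge1.
  apply: le_trans (b2 x) _; rewrite ler_wpM2l// exprD ler_peMl ?exprn_ge0//.
    by rewrite ltW ?onept_gt0.
  by rewrite exprn_ege1// onept_ge1.
- exists (n1 + n2)%N; exists (c1 * c2); first exact: mulr_ge0.
  by move=> x; rewrite normrM exprD mulrACA ler_pM.
Qed.

(** In each coordinate the difference of the two sides is [(x_j + 2 k_j)^2]. This coercivity is why
    [gauss] decays in all directions although it equals 1 on a whole sphere. *)
Lemma dotv_le_symb k x : dotv x x <= 2 * symb k x + 4 * dotv k k.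
Proof.
rewrite /dotv /symb !mulr_sumr -big_split /=; apply: ler_sum => j _.
by have := sqr_ge0 (x ord0 j + 2 * k ord0 j); nra.
Qed.

(** The exponent [s * symb ^ 2] is cut into [n.+1] equal shares, and each share absorbs one factor
    [onept x]. There is one share more than the [N + N'] factors to be absorbed, which keeps the
    divisor nonzero. *)
Lemma polygauss_decay k s f N : 0 < s -> polygauss k s f ->
  exists2 M, 0 <= M & forall x, onept x ^+ N * `|f x| <= M.
Proof.
move=> s0 [p /polyfun_bound[N' [C C0 pC]] ->].
pose n := (N + N')%N; pose t : R := s / n.+1%:R.
have t0 : 0 < t by rewrite divr_gt0.
pose A : R := 2 + 4 * dotv k k.
have A0 : 0 < A by rewrite /A ltr_wpDr// mulr_ge0// dotv_ge0.
pose B : R := 1 + t^-1.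
have B0 : 0 < B by rewrite /B addr_gt0// invr_gt0.
(* Writing m for the symbol: [1 + |x|^2 <= A (1 + m^2)] by coercivity and [2 m <= 1 + m^2]; then
   [1 + m^2 <= B (1 + t m^2)], and the last factor is at most [exp (t m^2)]. *)
have H x : onept x * expR (- (t * symb k x ^+ 2)) <= A * B.
  rewrite expRN ler_pdivrMr ?expR_gt0//.
  apply: (@le_trans _ _ (A * B * (1 + t * symb k x ^+ 2))); last first.
    by rewrite ler_wpM2l ?expR_ge1Dx//; apply: mulr_ge0; exact: ltW.
  apply: (@le_trans _ _ (A * (1 + symb k x ^+ 2))).
    have := dotv_le_symb k x; have := sqr_ge0 (symb k x - 1).
    have := dotv_ge0 k; rewrite /A /onept.
    move: (symb k x) (dotv x x) (dotv k k) => m r kk kk0 m1 h.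
    by have := mulr_ge0 kk0 (sqr_ge0 m); nra.
  rewrite -mulrA ler_wpM2l ?ltW//.
  have tv : t * t^-1 = 1 by rewrite divff// gt_eqF.
  have tv0 : 0 <= t^-1 by rewrite invr_ge0 ltW.
  rewrite /B; move: (symb k x) (t^-1) tv tv0 => m u tu u0.
  have := sqr_ge0 m; have : 0 <= t * m ^+ 2 by rewrite mulr_ge0 ?sqr_ge0 ?ltW.
  have -> : (1 + u) * (1 + t * m ^+ 2) = 1 + t * m ^+ 2 + u + (t * u) * m ^+ 2.
    by ring.
  by rewrite tu; nra.
exists (C * (A * B) ^+ n.+1); first by rewrite mulr_ge0// exprn_ge0// mulr_ge0// ltW.
move=> x; rewrite normrM [`|gauss _ _ _|]gtr0_norm ?expR_gt0//.
have -> : gauss k s x = expR (- (t * symb k x ^+ 2)) ^+ n.+1.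
  rewrite -expRM_natl /gauss; congr expR; rewrite /t; field.
  by rewrite addrC natr1 pnatr_eq0.
have o0 : 0 <= onept x by rewrite ltW// onept_gt0.
apply: (@le_trans _ _ (C * (onept x * expR (- (t * symb k x ^+ 2))) ^+ n.+1)).
  rewrite exprMn !mulrA ler_wpM2r ?exprn_ge0 ?expR_ge0//.
  apply: (@le_trans _ _ (onept x ^+ N * (C * onept x ^+ N'))).
    by rewrite ler_wpM2l// exprn_ge0.
  rewrite mulrCA -exprD ler_wpM2l// exprS ler_peMl ?exprn_ge0//.
  exact: onept_ge1.
rewrite ler_wpM2l// lerXn2r ?nnegrE ?mulr_ge0 ?expR_ge0// ltW// mulr_gt0//.
Qed.

Lemma oneptV_le_wgt x : (onept x ^+ d)^-1 <= wgt x.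
Proof.
rewrite /wgt prodfV lef_pV2 ?posrE ?exprn_gt0 ?onept_gt0//; last first.
  by apply: prodr_gt0 => j _; exact: oneDsqr_gt0.
have -> : onept x ^+ d = \prod_(j < d) onept x by rewrite prodr_const card_ord.
apply: ler_prod => j _; rewrite ltW ?oneDsqr_gt0//=.
by rewrite lerD2l sqr_coord_le_dotv.
Qed.

Lemma polygauss_wgt k s f : 0 < s -> polygauss k s f ->
  exists2 M, 0 <= M & forall x, `|f x| <= M * wgt x ^+ 2.
Proof.
move=> s0 pf; have [M M0 H] := polygauss_decay (d * 2) s0 pf.
exists M => // x; apply: (@le_trans _ _ (M * (onept x ^+ d)^-1 ^+ 2)).
  rewrite exprVn -exprM ler_pdivlMr ?exprn_gt0 ?onept_gt0//.
  by rewrite mulrC H.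
rewrite ler_wpM2l// lerXn2r ?nnegrE ?wgt_ge0 ?oneptV_le_wgt//.
by rewrite invr_ge0 exprn_ge0// ltW// onept_gt0.
Qed.

Lemma iter_pderiv_polygauss k s f t : polygauss k s f ->
  polygauss k s (iter_pderiv t f).
Proof.
move=> pf; elim: t => [//|j t IHt] /=.
have [f' pf' df] := polygauss_derive j IHt.
rewrite (_ : (fun x => _) = f')//; apply/funext => x.
by have [_ ->] := df x.
Qed.

Lemma polygauss_schwartz k s f : 0 < s -> polygauss k s f -> schwartz f.
Proof.
move=> s0 pf; split.
  move=> t; have pt := iter_pderiv_polygauss t pf; split.
    exact: continuous_polygauss pt.
  move=> j x; have [f' _ df] := polygauss_derive j pt.
  by have [] := df x.
move=> n t; have pt := iter_pderiv_polygauss t pf.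
have [M M0 H] := polygauss_decay n s0 pt.
exists (2 ^+ n * M) => x; apply: le_trans (ler_wpM2l _ (H x)); last first.
  by rewrite exprn_ge0.
rewrite mulrA -exprMn ler_wpM2r// lerXn2r ?nnegrE ?addr_ge0 ?sqrtr_ge0//.
  by rewrite mulr_ge0// ltW// onept_gt0.
have e0 : 0 <= enorm x by exact: sqrtr_ge0.
have : enorm x ^+ 2 = dotv x x by rewrite sqr_sqrtr// dotv_ge0.
rewrite /onept => <-; have := sqr_ge0 (enorm x - 1); nra.
Qed.

End gaussian_type_functions.

(** * Taylor bounds and dominated convergence *)

Section calculus.
Context {R : realType}.

Lemma mean_value (g g' : R -> R) (a b : R) :
  (forall t, is_derive t (1 : R) g (g' t)) ->
  exists2 c, `|c - a| <= `|b| & g (a + b) - g a = g' c * b.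
Proof.
move=> dg; have cg x y : {within `[x, y], continuous g}.
  apply: continuous_subspaceT => t; apply: differentiable_continuous.
  by apply/derivable1_diffP; have [] := dg t.
have [b0|b0|->] := ltgtP b 0; last first.
- by exists a; rewrite ?subrr ?normr0// addr0 subrr mulr0.
- have ab : a < a + b by rewrite ltrDl.
  have [c] := MVT ab (fun t _ => dg t) (cg _ _).
  rewrite in_itv/= => /andP[ac cb] ->; exists c; last by rewrite addrC addKr.
  by rewrite !ger0_norm ?subr_ge0 ?(ltW ac) ?(ltW b0)// lerBlDl ltW.
- have ab : a + b < a by rewrite gtrDl.
  have [c] := MVT ab (fun t _ => dg t) (cg _ _).
  rewrite in_itv/= => /andP[ac cb] E; exists c.
    rewrite !ler0_norm ?subr_le0 ?(ltW cb) ?(ltW b0)// opprB lerBlDl.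
    by rewrite -lerBlDr opprK ltW.
  by rewrite -opprB E -mulrN; congr (_ * _); rewrite opprB addrC addKr.
Qed.

(** Two applications of the mean value theorem give the constant [M] instead of the sharp [M / 2].
    The second derivative is controlled only within distance [|b|] of [a], so that a decaying bound
    remains usable. *)
Lemma taylor1_bound (g g' g'' : R -> R) (a b M : R) :
  (forall t, is_derive t (1 : R) g (g' t)) ->
  (forall t, is_derive t (1 : R) g' (g'' t)) ->
  (forall t, `|t - a| <= `|b| -> `|g'' t| <= M) ->
  `|g (a + b) - g a - b * g' a| <= M * b ^+ 2.
Proof.
move=> dg dg' gM; have [c cab ->] := mean_value a b dg.
have [e ec E] := mean_value a (c - a) dg'.
rewrite [a + _]addrC subrK in E.
have -> : g' c * b - b * g' a = (g' c - g' a) * b by ring.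
rewrite E !normrM -[b ^+ 2]real_normK ?num_real// expr2 mulrA.
rewrite ler_wpM2r// ler_pM//; apply: gM; exact: le_trans ec cab.
Qed.

Lemma cos_taylor (a b : R) : `|cos (a + b) - cos a + b * sin a| <= b ^+ 2.
Proof.
have := @taylor1_bound cos (fun t => - sin t) (fun t => - cos t) a b 1.
rewrite mul1r mulrN opprK; apply => //.
by move=> t _; rewrite normrN ler_norml cos_geN1 cos_le1.
Qed.

Lemma sin_taylor (a b : R) : `|sin (a + b) - sin a - b * cos a| <= b ^+ 2.
Proof.
have := @taylor1_bound sin cos (fun t => - sin t) a b 1.
rewrite mul1r; apply => // t _.
by rewrite normrN ler_norml sin_geN1 sin_le1.
Qed.

Lemma Rintegral_dct (dT : measure_display) (T : measurableType dT)
    (mu : {measure set T -> \bar R}) (f_ : nat -> T -> R) (f g : T -> R) :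
  (forall n, measurable_fun setT (f_ n)) ->
  (forall x, f_ n x @[n --> \oo] --> f x) ->
  (forall n x, `|f_ n x| <= g x) -> rintegrable mu g ->
  \int[mu]_x f_ n x @[n --> \oo] --> \int[mu]_x f x.
Proof.
move=> mf cf fg ig.
have fx x : `|f x| <= g x.
  apply: (ler_cvg_to (cvg_norm (cf x)) (cvg_cst (g x))).
  by apply: nearW => n.
have mff : measurable_fun setT f by apply: (measurable_fun_cvg (h := f_)).
have If := rintegrable_le mff fx ig.
have H := @dominated_cvg _ _ _ mu setT measurableT (fun n x => (f_ n x)%:E)
  (EFin \o f) (EFin \o g) _ _ _ ig _.
have {}H : (\int[mu]_x (f_ n x)%:E)%E @[n --> \oo] --> (\int[mu]_x (f x)%:E)%E.
  apply: H => //.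
  - by move=> n; exact/measurable_EFinP.
  - move=> x _; apply: cvg_EFin; last exact: cf.
    exact: filterE.
  - by move=> n x _; rewrite lee_fin; exact: fg.
rewrite rintegrable_fin// in H.
exact: (fine_cvg H).
Qed.

End calculus.

(** * Integration by parts on R^d *)

Section integration_by_parts.
Context {R : realType} {d : nat}.
Implicit Types (x : 'rV[R]_d) (j : 'I_d).

(** Only coordinate j changes. The constant 3 comes from [2 (3 (1 + (x + c)^2) - (1 + x^2)) = (2 x +
    3 c)^2 + 4 - 3 c^2], which is positive for [|c| <= 1]. *)
Lemma wgt_shift x j (c : R) : `|c| <= 1 ->
  wgt (c *: basis_vec R j + x) <= 3 * wgt x.
Proof.
move=> c1; rewrite /wgt (bigD1 j)//= [in leRHS](bigD1 j)//= mulrA.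
have E : \prod_(i < d | i != j) (oneDsqr ((c *: basis_vec R j + x) ord0 i))^-1 =
    \prod_(i < d | i != j) (oneDsqr (x ord0 i))^-1.
  apply: eq_bigr => i ij; rewrite !mxE (negbTE ij) andbF mulr0 add0r//.
rewrite E ler_wpM2r//.
  by apply: prodr_ge0 => i _; rewrite invr_ge0 ltW ?oneDsqr_gt0.
rewrite !mxE !eqxx mulr1 ler_pdivlMr ?oneDsqr_gt0// mulrC.
rewrite ler_pdivrMr ?oneDsqr_gt0// /oneDsqr.
move: c1; rewrite ler_norml => /andP[c1 c2].
by have := sqr_ge0 (2 * x ord0 j + 3 * c); nra.
Qed.

(** By translation invariance every difference quotient of [F] has integral 0. By the mean value
    theorem the quotients with step at most 1 are values of [F'] at nearby points of the line, so
    [wgt_shift] provides the majorant for dominated convergence. *)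
Lemma Rintegral_derive0 (F F' : 'rV[R]_d -> R) j (M : R) :
  measurable_fun setT F -> measurable_fun setT F' ->
  (forall x, is_derive x (basis_vec R j) F (F' x)) ->
  (forall x, `|F x| <= M * wgt x) -> (forall x, `|F' x| <= M * wgt x) ->
  \int[lebesgue_rV d]_x F' x = 0.
Proof.
move=> mF mF' dF FM FM'.
have M0 : 0 <= M.
  have := le_trans (normr_ge0 _) (FM 0); rewrite pmulr_lge0//; exact: wgt_gt0.
have iw c : rintegrable (lebesgue_rV d) (fun x => c * wgt x).
  exact/rintegrableZl/rintegrable_wgt.
have iF := rintegrable_le mF FM (iw M).
pose h (n : nat) : R := n.+1%:R^-1.
have h0 n : h n != 0 by rewrite invr_eq0 pnatr_eq0.
have h1 n : `|h n| <= 1 by rewrite ger0_norm ?invr_ge0// invf_le1// ler1n.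
pose Q n x := (h n)^-1 * (F (h n *: basis_vec R j + x) - F x).
have iS c : rintegrable (lebesgue_rV d) (fun x => F (c + x)).
  have := rintegrable_shift_rV c iF; by under eq_fun do rewrite addrC.
have mQ n : measurable_fun setT (Q n).
  apply: measurable_funM => //; apply: measurable_funB => //.
  exact: rintegrable_meas (iS _).
have cQ : \int[lebesgue_rV d]_x Q n x @[n --> \oo] --> \int[lebesgue_rV d]_x F' x.
  apply: (Rintegral_dct (g := fun x => 3 * M * wgt x)) => //.
  - move=> x; have [D <-] := dF x.
    have hc : h n @[n --> \oo] --> (0 : R)^'.
      move=> A HA; have H : \forall n \near \oo, h n != 0 -> A (h n).
        exact: (cvg_harmonic (R := R) HA).
      by apply: filterS H => n hn; exact: hn (h0 n).
    exact: (cvg_comp _ _ hc D).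
  - move=> n x.
    have [c ch E] := @mean_value R _ _ 0 (h n)
      (fun t => is_derive_along (dF (t *: basis_vec R j + x))).
    rewrite /Q; rewrite add0r scale0r add0r in E; rewrite E mulrCA mulVf// mulr1.
    apply: le_trans (FM' _) _; rewrite -mulrA mulrCA ler_wpM2l//.
    by apply: wgt_shift; rewrite subr0 in ch; exact: le_trans ch (h1 n).
have : \int[lebesgue_rV d]_x Q n x @[n --> \oo] --> (0 : R).
  rewrite (_ : (fun n => _) = (fun=> 0)); first exact: cvg_cst.
  apply/funext => n; rewrite RintegralZl//; last first.
    apply: rintegrableD; [exact: iS|exact: rintegrableN].
  rewrite RintegralB//; last exact: iS.
  rewrite -(Rintegral_shift_rV (h n *: basis_vec R j) iF).
  under [X in _ - X]eq_Rintegral do rewrite addrC.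
  by rewrite subrr mulr0.
by move=> /(cvg_unique (@Rhausdorff R) cQ).
Qed.

(** Only one factor has to decay: [th] is a trigonometric function in [fourier_deriv] and a
    reflected Fourier transform in [fourier_by_parts]. *)
Lemma Rintegral_by_parts (chi chi' th th' : 'rV[R]_d -> R) j (M M' : R) :
  measurable_fun setT chi -> measurable_fun setT chi' ->
  measurable_fun setT th -> measurable_fun setT th' ->
  (forall x, is_derive x (basis_vec R j) chi (chi' x)) ->
  (forall x, is_derive x (basis_vec R j) th (th' x)) ->
  (forall x, `|chi x| <= M * wgt x) -> (forall x, `|chi' x| <= M * wgt x) ->
  (forall x, `|th x| <= M') -> (forall x, `|th' x| <= M') ->
  \int[lebesgue_rV d]_x (chi' x * th x) =
  - \int[lebesgue_rV d]_x (chi x * th' x).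
Proof.
move=> mc mc' mt mt' dc dt cM cM' tM tM'.
have iw c : rintegrable (lebesgue_rV d) (fun x => c * wgt x).
  exact/rintegrableZl/rintegrable_wgt.
have b1 x : `|chi' x * th x| <= M' * M * wgt x.
  by rewrite normrM mulrC -mulrA ler_pM.
have b2 x : `|chi x * th' x| <= M' * M * wgt x.
  by rewrite normrM mulrC -mulrA ler_pM.
have b3 x : `|chi x * th x| <= M' * M * wgt x.
  by rewrite normrM mulrC -mulrA ler_pM.
have m1 : measurable_fun setT (fun x => chi' x * th x) by exact: measurable_funM.
have m2 : measurable_fun setT (fun x => chi x * th' x) by exact: measurable_funM.
have i1 := rintegrable_le m1 b1 (iw _).
have i2 := rintegrable_le m2 b2 (iw _).
apply/eqP; rewrite -addr_eq0 -RintegralD//; apply/eqP.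
apply: (@Rintegral_derive0 (fun x => chi x * th x) _ j (M' * M + M' * M)).
- exact: measurable_funM.
- exact: measurable_funD.
- move=> x; rewrite addrC [chi' x * _]mulrC; exact: is_deriveM.
- move=> x; rewrite mulrDl (le_trans (b3 x))// lerDl.
  exact: le_trans (normr_ge0 _) (b3 x).
- by move=> x; rewrite mulrDl (le_trans (ler_normD _ _))// lerD.
Qed.

End integration_by_parts.

(** * Fourier transform *)

Section fourier_transform.
Context {R : realType} {d : nat}.
Implicit Types (f g : 'rV[R]_d -> R) (x xi : 'rV[R]_d) (j : 'I_d).

Lemma dotvC x xi : dotv x xi = dotv xi x.
Proof. by apply: eq_bigr => j _; rewrite mulrC. Qed.

Lemma dotvDl x1 x2 xi : dotv (x1 + x2) xi = dotv x1 xi + dotv x2 xi.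
Proof. by rewrite -big_split; apply: eq_bigr => j _; rewrite mxE mulrDl. Qed.

Lemma dotvZl (c : R) x xi : dotv (c *: x) xi = c * dotv x xi.
Proof. by rewrite mulr_sumr; apply: eq_bigr => j _; rewrite mxE mulrA. Qed.

Lemma dotvZr (c : R) x xi : dotv x (c *: xi) = c * dotv x xi.
Proof. by rewrite dotvC dotvZl dotvC. Qed.

Lemma dotv_basis j xi : dotv (basis_vec R j) xi = xi ord0 j.
Proof.
rewrite /dotv (bigD1 j)//= mxE !eqxx mul1r big1 ?addr0// => i ij.
by rewrite mxE (negbTE ij) andbF mul0r.
Qed.

Lemma fourierE f xi : fourier f xi =
  cintegral (lebesgue_rV d) (fun x => conjc (cis (dotv xi x)) * (f x)%:C%C).
Proof. by []. Qed.

Definition wdom f := measurable_fun setT f /\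
  exists M, forall x, `|f x| <= M * wgt x ^+ 2.

Lemma wdom_bound f : wdom f -> exists2 M, 0 <= M & forall x, `|f x| <= M * wgt x.
Proof.
move=> [_ [M H]].
have M0 : 0 <= M.
  have := le_trans (normr_ge0 _) (H 0).
  by rewrite pmulr_lge0// exprn_gt0// wgt_gt0.
exists M => // x; apply: le_trans (H x) _.
by rewrite ler_wpM2l// expr2 ler_piMl ?wgt_ge0 ?wgt_le1.
Qed.

Lemma rintegrable_cwgt (M : R) : rintegrable (lebesgue_rV d) (fun x => M * wgt x).
Proof. exact/rintegrableZl/rintegrable_wgt. Qed.

Lemma wdom_rintegrable f : wdom f -> rintegrable (lebesgue_rV d) f.
Proof.
by move=> wf; have [M _ H] := wdom_bound wf;
  apply: (rintegrable_le wf.1 H); exact: rintegrable_cwgt.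
Qed.

Lemma measurable_dotv : measurable_fun setT
  (fun p : 'rV[R]_d * 'rV[R]_d => dotv p.1 p.2).
Proof.
apply: measurable_sum => j; apply: measurable_funM.
  exact: (measurableT_comp (measurable_coord_rV j) measurable_fst).
exact: (measurableT_comp (measurable_coord_rV j) measurable_snd).
Qed.

Lemma measurable_dotv1 xi : measurable_fun setT (dotv xi).
Proof. exact: (measurableT_comp measurable_dotv (pair1_measurable xi)). Qed.

Lemma cmeasurable_fourier_kernel f : measurable_fun setT f ->
  cmeasurable (fun p : 'rV[R]_d * 'rV[R]_d =>
    conjc (cis (dotv p.1 p.2)) * (f p.2)%:C%C).
Proof.
move=> mf; apply: cmeasurableM.
  apply: cmeasurable_conj; apply: cmeasurable_cis; exact: measurable_dotv.
apply: cmeasurable_real; exact: (measurableT_comp mf measurable_snd).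
Qed.

Lemma cmeasurable_fourier f : measurable_fun setT f -> cmeasurable (fourier f).
Proof.
move=> mf; have := cmeasurable_cintegral (lebesgue_rV d)
  (cmeasurable_fourier_kernel mf).
exact.
Qed.

Lemma normc_fourier_kernel f xi x :
  Normc.normc (conjc (cis (dotv xi x)) * (f x)%:C%C) = `|f x|.
Proof. by rewrite normcM normc_conj normc_cis mul1r normc_real. Qed.

Lemma cintegrable_fourier_kernel f xi : wdom f ->
  cintegrable (lebesgue_rV d) (fun x => conjc (cis (dotv xi x)) * (f x)%:C%C).
Proof.
move=> wf; have [M _ H] := wdom_bound wf.
apply: (cintegrable_le _ _ (rintegrable_cwgt M)) => [|x].
  apply: cmeasurableM; last by apply: cmeasurable_real; exact: wf.1.
  apply: cmeasurable_conj; apply: cmeasurable_cis; exact: measurable_dotv1.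
by rewrite normc_fourier_kernel.
Qed.

Lemma fourier_bound f : wdom f -> exists2 M, 0 <= M &
  forall xi, Normc.normc (fourier f xi) <= M.
Proof.
move=> wf; have [M _ H] := wdom_bound wf.
exists (2 * \int[lebesgue_rV d]_x (M * wgt x)).
  rewrite mulr_ge0//; apply: Rintegral_ge0 => x _.
  exact: le_trans (normr_ge0 _) (H x).
move=> xi; apply: cintegral_le (rintegrable_cwgt M) => [|x].
  exact: cintegrable_meas (cintegrable_fourier_kernel xi wf).
by rewrite normc_fourier_kernel.
Qed.

Lemma fourierD f g xi : wdom f -> wdom g ->
  fourier (fun x => f x + g x) xi = fourier f xi + fourier g xi.
Proof.
move=> wf wg; rewrite !fourierE -cintegralD; try exact: cintegrable_fourier_kernel.
by apply: eq_cintegral => x; rewrite rmorphD mulrDr.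
Qed.

Lemma fourierZ (c : R) f xi : wdom f ->
  fourier (fun x => c * f x) xi = c%:C%C * fourier f xi.
Proof.
move=> wf; rewrite !fourierE -cintegralZl; last exact: cintegrable_fourier_kernel.
by apply: eq_cintegral => x; rewrite rmorphM mulrCA.
Qed.

Lemma Re_fourier f xi : complex.Re (fourier f xi) =
  \int[lebesgue_rV d]_x (cos (dotv xi x) * f x).
Proof.
by apply: eq_Rintegral => x _; rewrite ReM /= mulr0 subr0.
Qed.

Lemma Im_fourier f xi : complex.Im (fourier f xi) =
  \int[lebesgue_rV d]_x (- sin (dotv xi x) * f x).
Proof.
by apply: eq_Rintegral => x _; rewrite ImM /= mulr0 add0r.
Qed.

Lemma rintegrable_cos f xi : wdom f ->
  rintegrable (lebesgue_rV d) (fun x => cos (dotv xi x) * f x).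
Proof.
move=> /(cintegrable_fourier_kernel xi)[h _]; move: h.
by under eq_fun do rewrite ReM /= mulr0 subr0.
Qed.

Lemma rintegrable_sin f xi : wdom f ->
  rintegrable (lebesgue_rV d) (fun x => sin (dotv xi x) * f x).
Proof.
move=> /(cintegrable_fourier_kernel xi)[_ h]; move: h.
under eq_fun do rewrite ImM /= mulr0 add0r mulNr.
by move=> /rintegrableN; under eq_fun do rewrite opprK.
Qed.

(* The derivative of [fourier f] along [e_j] is [-i fourier (x_j f)]. *)
Lemma is_derive_Re_fourier f j xi : wdom f -> wdom (fun x => x ord0 j * f x) ->
  wdom (fun x => x ord0 j ^+ 2 * f x) ->
  is_derive xi (basis_vec R j) (fun y => complex.Re (fourier f y))
    (complex.Im (fourier (fun x => x ord0 j * f x) xi)).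
Proof.
move=> w0 w1 w2.
pose M := \int[lebesgue_rV d]_x `|x ord0 j ^+ 2 * f x|.
apply: (@is_derive_bound _ _ _ _ _ _ M) => h _.
rewrite !Re_fourier Im_fourier.
have i0 := rintegrable_cos xi w0.
have i0h := rintegrable_cos (h *: basis_vec R j + xi) w0.
have i1 : rintegrable (lebesgue_rV d)
    (fun x => h * (- sin (dotv xi x) * (x ord0 j * f x))).
  apply: rintegrableZl; have := rintegrableN (rintegrable_sin xi w1).
  by under eq_fun do rewrite -mulNr.
rewrite -RintegralB// -RintegralZl//; last first.
  have := rintegrableN (rintegrable_sin xi w1).
  by under eq_fun do rewrite -mulNr.
rewrite -RintegralB//; last exact: (rintegrableD i0h (rintegrableN i0)).
rewrite /M mulrC -RintegralZl//; last first.
  exact/rintegrable_norm/wdom_rintegrable.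
apply: Rintegral_le.
- apply: rintegrable_meas.
  exact: (rintegrableD (rintegrableD i0h (rintegrableN i0)) (rintegrableN i1)).
- move=> x; rewrite dotvDl dotvZl dotv_basis [h * _ + dotv _ _]addrC.
  rewrite (_ : _ - _ = (cos (dotv xi x + h * x ord0 j) - cos (dotv xi x) +
     h * x ord0 j * sin (dotv xi x)) * f x); last by ring.
  rewrite !normrM mulrA ler_wpM2r//; apply: le_trans (cos_taylor _ _) _.
  by rewrite exprMn -expr2 real_normK ?num_real.
- exact/rintegrableZl/rintegrable_norm/wdom_rintegrable.
Qed.

Lemma is_derive_Im_fourier f j xi : wdom f -> wdom (fun x => x ord0 j * f x) ->
  wdom (fun x => x ord0 j ^+ 2 * f x) ->
  is_derive xi (basis_vec R j) (fun y => complex.Im (fourier f y))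
    (- complex.Re (fourier (fun x => x ord0 j * f x) xi)).
Proof.
move=> w0 w1 w2.
pose M := \int[lebesgue_rV d]_x `|x ord0 j ^+ 2 * f x|.
apply: (@is_derive_bound _ _ _ _ _ _ M) => h _.
rewrite !Im_fourier Re_fourier.
have iN y : rintegrable (lebesgue_rV d) (fun x => - sin (dotv y x) * f x).
  have := rintegrableN (rintegrable_sin y w0).
  by under eq_fun do rewrite -mulNr.
have i0 := iN xi; have i0h := iN (h *: basis_vec R j + xi).
have i1 : rintegrable (lebesgue_rV d)
    (fun x => h * (cos (dotv xi x) * (x ord0 j * f x))).
  exact/rintegrableZl/rintegrable_cos.
rewrite mulrN opprK -RintegralB// -RintegralZl//; last exact: rintegrable_cos.
rewrite -RintegralD//; last exact: (rintegrableD i0h (rintegrableN i0)).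
rewrite /M mulrC -RintegralZl//; last first.
  exact/rintegrable_norm/wdom_rintegrable.
apply: Rintegral_le.
- apply: rintegrable_meas.
  exact: (rintegrableD (rintegrableD i0h (rintegrableN i0)) i1).
- move=> x; rewrite dotvDl dotvZl dotv_basis [h * _ + dotv _ _]addrC.
  rewrite (_ : _ + _ = - (sin (dotv xi x + h * x ord0 j) - sin (dotv xi x) -
     h * x ord0 j * cos (dotv xi x)) * f x); last by ring.
  rewrite normrM normrN normrM mulrA ler_wpM2r//; apply: le_trans (sin_taylor _ _) _.
  by rewrite exprMn [`|_ ^+ 2|]ger0_norm ?sqr_ge0.
- exact/rintegrableZl/rintegrable_norm/wdom_rintegrable.
Qed.

Lemma is_derive_cos_dotv j xi x :
  is_derive x (basis_vec R j) (fun y => cos (dotv xi y)) (- sin (dotv xi x) * xi ord0 j).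
Proof.
apply: (@is_derive_comp _ _ cos (dotv xi)).
apply: (@is_derive_bound _ _ _ _ _ _ 0) => h _.
by rewrite dotvC dotvDl dotvZl dotv_basis (dotvC x) addrK subrr normr0 mul0r.
Qed.

Lemma is_derive_sin_dotv j xi x :
  is_derive x (basis_vec R j) (fun y => sin (dotv xi y)) (cos (dotv xi x) * xi ord0 j).
Proof.
apply: (@is_derive_comp _ _ sin (dotv xi)).
apply: (@is_derive_bound _ _ _ _ _ _ 0) => h _.
by rewrite dotvC dotvDl dotvZl dotv_basis (dotvC x) addrK subrr normr0 mul0r.
Qed.

Lemma fourier_deriv f f' j xi : wdom f -> wdom f' ->
  (forall x, is_derive x (basis_vec R j) f (f' x)) ->
  fourier f' xi = (0 +i* xi ord0 j)%C * fourier f xi.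
Proof.
move=> wf wf' df.
have [M M0 fM] := wdom_bound wf; have [M' M'0 fM'] := wdom_bound wf'.
pose N := M + M'; pose K := 1 + `|xi ord0 j|.
have fN x : `|f x| <= N * wgt x.
  by rewrite (le_trans (fM x))// ler_wpM2r ?wgt_ge0// lerDl.
have fN' x : `|f' x| <= N * wgt x.
  by rewrite (le_trans (fM' x))// ler_wpM2r ?wgt_ge0// lerDr.
have mcos : measurable_fun setT (fun x => cos (dotv xi x)).
  by have [] := cmeasurable_cis (measurable_dotv1 xi).
have msin : measurable_fun setT (fun x => sin (dotv xi x)).
  by have [] := cmeasurable_cis (measurable_dotv1 xi).
have cosK x : `|cos (dotv xi x)| <= 1 by rewrite ler_norml cos_geN1 cos_le1.
have sinK x : `|sin (dotv xi x)| <= 1 by rewrite ler_norml sin_geN1 sin_le1.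
have K1 : 1 <= K by rewrite lerDl.
have Kx y : `|y| <= 1 -> `|y * xi ord0 j| <= K.
  move=> y1; rewrite normrM (le_trans (ler_wpM2r _ y1))// mul1r.
  by rewrite lerDr.
have dmsin x : is_derive x (basis_vec R j) (fun y => - sin (dotv xi y))
    (- (cos (dotv xi x) * xi ord0 j)).
  by apply: is_deriveN; exact: is_derive_sin_dotv.
apply: complex_eqP.
  rewrite ReM Re_fourier Im_fourier; cbn [complex.Re complex.Im].
  rewrite mul0r sub0r; under eq_Rintegral do rewrite mulrC.
  rewrite (Rintegral_by_parts (chi := f) wf.1 wf'.1 mcos _ df
    (is_derive_cos_dotv j xi) fN fN' (M' := K)); last 3 first.
  - by apply: measurable_funM => //; exact: measurableT_comp.
  - by move=> x; exact: le_trans (cosK x) K1.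
  - by move=> x; apply: Kx; rewrite normrN.
  congr (- _); rewrite -RintegralZl//; last first.
    have := rintegrableN (rintegrable_sin xi wf).
    by under eq_fun do rewrite -mulNr.
  by apply: eq_Rintegral => x _; ring.
rewrite ImM Re_fourier Im_fourier; cbn [complex.Re complex.Im].
rewrite mul0r add0r; under eq_Rintegral do rewrite mulrC.
rewrite (Rintegral_by_parts (chi := f) wf.1 wf'.1 _ _ df dmsin fN fN' (M' := K)); last 4 first.
- exact: measurableT_comp.
- by apply: measurableT_comp => //; exact: measurable_funM.
- by move=> x; rewrite normrN; exact: le_trans (sinK x) K1.
- by move=> x; rewrite normrN; apply: Kx.
rewrite -[RHS]opprK -mulNr; congr (- _); rewrite -RintegralZl//; last first.
  exact: rintegrable_cos.
by apply: eq_Rintegral => x _; ring.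
Qed.

End fourier_transform.

(** * Fourier transforms of functions of Gaussian type *)

Section fourier_polygauss.
Context {R : realType} {d : nat}.
Variables (k : 'rV[R]_d) (s : R).
Hypothesis s0 : 0 < s.
Implicit Types (f : 'rV[R]_d -> R) (x z xi : 'rV[R]_d) (j : 'I_d).

Lemma polygauss_wdom f : polygauss k s f -> wdom f.
Proof.
move=> pf; split; first exact: measurable_polygauss pf.
by have [M _ H] := polygauss_wgt s0 pf; exists M.
Qed.

Lemma polygauss_coord f j : polygauss k s f ->
  polygauss k s (fun x => x ord0 j * f x).
Proof. exact/polygaussM/polyfun_coord. Qed.

Lemma polygauss_coord2 f j : polygauss k s f ->
  polygauss k s (fun x => x ord0 j ^+ 2 * f x).
Proof.
move=> pf; have := polygauss_coord j (polygauss_coord j pf).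
by under eq_fun do rewrite mulrA -expr2.
Qed.

(** The operator [1 - D_j^2] preserves the class and becomes multiplication by [1 + xi_j^2]. An
    index repeated in [t] produces a power of its factor. *)
Lemma fourier_oneDsqr f (t : seq 'I_d) : polygauss k s f ->
  exists2 f', polygauss k s f' & forall xi,
  fourier f' xi = (\prod_(j <- t) oneDsqr (xi ord0 j))%:C%C * fourier f xi.
Proof.
move=> pf; elim: t => [|j t [f1 p1 F1]].
  by exists f => // xi; rewrite big_nil mul1r.
have [f2 p2 d2] := polygauss_derive j p1; have [f3 p3 d3] := polygauss_derive j p2.
have p3' : polygauss k s (fun x => -1 * f3 x) by exact: polygaussM (polyfun_cst _) p3.
exists (fun x => f1 x + -1 * f3 x); first exact: polygaussD.
have [[w1 w2] w3] := (polygauss_wdom p1, polygauss_wdom p2, polygauss_wdom p3).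
move=> xi; rewrite fourierD//; last exact: polygauss_wdom.
rewrite fourierZ// (fourier_deriv xi w2 w3 d3) (fourier_deriv xi w1 w2 d2) F1.
rewrite big_cons rmorphM -mulrA; set P := (_%:C * fourier f xi)%C.
by apply: complex_eqP; rewrite !(ReD, ImD, ReM, ImM) /= /oneDsqr; ring.
Qed.

Lemma fourier_decay f : polygauss k s f -> exists2 M, 0 <= M &
  forall xi, Normc.normc (fourier f xi) <= M * wgt xi ^+ 2.
Proof.
(* Every coordinate is listed twice, so the product of the factors is [(wgt xi)^-2], and boundedness
   of the transform of [f'] is the claimed decay. *)
move=> pf; have [f' pf' H] := fourier_oneDsqr (index_enum 'I_d ++ index_enum 'I_d) pf.
have [M M0 HM] := fourier_bound (polygauss_wdom pf'); exists M => // xi.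
have := HM xi; rewrite H normcM normc_real big_cat /=.
have -> : \prod_(j < d) oneDsqr (xi ord0 j) = (wgt xi)^-1.
  by rewrite /wgt prodfV invrK.
rewrite ger0_norm; last by rewrite mulr_ge0// invr_ge0 wgt_ge0.
rewrite -invfM -expr2 mulrC ler_pdivrMr// exprn_gt0//; exact: wgt_gt0.
Qed.

Lemma fourier_decay1 f : polygauss k s f -> exists2 M, 0 <= M &
  forall xi, Normc.normc (fourier f xi) <= M * wgt xi.
Proof.
move=> /fourier_decay[M M0 H]; exists M => // xi; apply: le_trans (H xi) _.
by rewrite ler_wpM2l// expr2 ler_piMl ?wgt_ge0 ?wgt_le1.
Qed.

Lemma cintegrable_fourier f : polygauss k s f ->
  cintegrable (lebesgue_rV d) (fourier f).
Proof.
move=> pf; have [M _ H] := fourier_decay1 pf.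
apply: cintegrable_le H (rintegrable_cwgt M).
by apply: cmeasurable_fourier; exact: (polygauss_wdom pf).1.
Qed.

Lemma polygauss_is_derive_Re f j xi : polygauss k s f ->
  is_derive xi (basis_vec R j) (fun y => complex.Re (fourier f y))
    (complex.Im (fourier (fun x => x ord0 j * f x) xi)).
Proof.
move=> pf; apply: is_derive_Re_fourier; apply: polygauss_wdom => //.
  exact: polygauss_coord.
exact: polygauss_coord2.
Qed.

Lemma polygauss_is_derive_Im f j xi : polygauss k s f ->
  is_derive xi (basis_vec R j) (fun y => complex.Im (fourier f y))
    (- complex.Re (fourier (fun x => x ord0 j * f x) xi)).
Proof.
move=> pf; apply: is_derive_Im_fourier; apply: polygauss_wdom => //.
  exact: polygauss_coord.
exact: polygauss_coord2.
Qed.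

(** The second derivative of the transform is, up to sign, the transform of [x_j^2 f], which decays
    like [wgt]; [wgt_shift] brings the weight back to [z]. The resulting error is integrable in [z]
    with integral of order [|h|], as [stat_deriv_smoothing] requires. *)
Lemma fourier_diff_quotient f j : polygauss k s f -> exists2 C, 0 <= C &
  forall (h : R) z, h != 0 -> `|h| <= 1 ->
  Normc.normc ((h^-1)%:C%C * (fourier f (z - h *: basis_vec R j) - fourier f z)
    - 'i%C * fourier (fun x => x ord0 j * f x) z) <= C * `|h| * wgt z.
Proof.
move=> pf; have p1 := polygauss_coord j pf; have p2 := polygauss_coord j p1.
have [M M0 HM] := fourier_decay1 p2.
exists (3 * M + 3 * M); first by rewrite addr_ge0// mulr_ge0.
move=> h z h0 h1; apply: le_trans (normc_le_ReIm _) _.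
have b (t : R) : `|t - 0| <= `|- h| ->
    Normc.normc (fourier (fun x => x ord0 j * (x ord0 j * f x))
      (t *: basis_vec R j + z)) <= 3 * M * wgt z.
  rewrite subr0 normrN => th; apply: le_trans (HM _) _.
  rewrite [3 * M]mulrC -mulrA ler_wpM2l// wgt_shift//.
  exact: le_trans th h1.
have hh (u : R) : `|u| <= 3 * M * wgt z * (- h) ^+ 2 -> `|h^-1 * u| <= 3 * M * `|h| * wgt z.
  rewrite normrM normfV ler_pdivrMl ?normr_gt0// sqrrN -(real_normK (num_real h)).
  by move=> /le_trans; apply; rewrite le_eqVlt; apply/orP; left; apply/eqP; ring.
have Ez : fourier f (z - h *: basis_vec R j) = fourier f ((- h) *: basis_vec R j + z).
  by rewrite scaleNr addrC.
rewrite -mulrA mulrDl !mulrA; apply: lerD.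
  have := @taylor1_bound R (fun t => complex.Re (fourier f (t *: basis_vec R j + z)))
    (fun t => complex.Im (fourier (fun x => x ord0 j * f x) (t *: basis_vec R j + z)))
    (fun t => - complex.Re (fourier (fun x => x ord0 j * (x ord0 j * f x))
      (t *: basis_vec R j + z))) 0 (- h) (3 * M * wgt z).
  rewrite add0r scale0r add0r => H.
  rewrite (_ : complex.Re _ = h^-1 * (complex.Re (fourier f (- h *: basis_vec R j + z))
    - complex.Re (fourier f z) - - h * complex.Im (fourier (fun x => x ord0 j * f x) z))).
    apply/hh/H => t.
    + by apply: (is_derive_along (f := fun y => complex.Re (fourier f y)));
        exact: polygauss_is_derive_Re.
    + by apply: (is_derive_along (f := fun y => complex.Im (fourier
        (fun x => x ord0 j * f x) y))); exact: polygauss_is_derive_Im.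
    + by move=> /b; apply: le_trans; rewrite normrN; exact: Re_le_normc.
  rewrite Ez; case: (fourier f z) (fourier f _) (fourier _ z) => [a1 b1] [a2 b2] [a3 b3] /=.
  by field.
have := @taylor1_bound R (fun t => complex.Im (fourier f (t *: basis_vec R j + z)))
    (fun t => - complex.Re (fourier (fun x => x ord0 j * f x) (t *: basis_vec R j + z)))
    (fun t => - complex.Im (fourier (fun x => x ord0 j * (x ord0 j * f x))
      (t *: basis_vec R j + z))) 0 (- h) (3 * M * wgt z).
rewrite add0r scale0r add0r => H.
rewrite (_ : complex.Im _ = h^-1 * (complex.Im (fourier f (- h *: basis_vec R j + z))
  - complex.Im (fourier f z) - - h * - complex.Re (fourier (fun x => x ord0 j * f x) z))).
  apply/hh/H => t.
  + by apply: (is_derive_along (f := fun y => complex.Im (fourier f y)));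
      exact: polygauss_is_derive_Im.
  + by apply: is_deriveN; apply: (is_derive_along (f := fun y =>
      complex.Re (fourier (fun x => x ord0 j * f x) y)));
      exact: polygauss_is_derive_Re.
  + by move=> /b; apply: le_trans; rewrite normrN; exact: Im_le_normc.
rewrite Ez; case: (fourier f z) (fourier f _) (fourier _ z) => [a1 b1] [a2 b2] [a3 b3] /=.
by field.
Qed.

Lemma is_derive_reflect (G : 'rV[R]_d -> R) z x (v : 'rV[R]_d) (c : R) :
  is_derive (z - x) v G c -> is_derive x v (fun y => G (z - y)) (- c).
Proof.
move=> dG; apply: is_derive_line.
have E t : z - (t *: v + x) = (- t) *: v + (z - x).
  by rewrite opprD addrA addrC addrCA addrA addrC scaleNr.
rewrite (_ : (fun t => _) = (fun t => G (t *: v + (z - x))) \o (fun t : R => - t)); last first.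
  by apply/funext => t /=; rewrite E.
rewrite -mulrN1; apply: is_derive1_comp.
by apply: is_derive_along; rewrite oppr0 scale0r add0r.
Qed.

Lemma fourier_by_parts f j (chi chi' : 'rV[R]_d -> R) (N : R) z :
  polygauss k s f -> measurable_fun setT chi -> measurable_fun setT chi' ->
  (forall x, is_derive x (basis_vec R j) chi (chi' x)) ->
  (forall x, `|chi x| <= N * wgt x) -> (forall x, `|chi' x| <= N * wgt x) ->
  cintegral (lebesgue_rV d) (fun x => (chi' x)%:C%C * fourier f (z - x)) =
  - 'i%C * cintegral (lebesgue_rV d)
    (fun x => (chi x)%:C%C * fourier (fun x => x ord0 j * f x) (z - x)).
Proof.
move=> pf mc mc' dc cN cN'.
have p1 := polygauss_coord j pf.
have [M M0 HM] := fourier_bound (polygauss_wdom pf).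
have [M1 M10 HM1] := fourier_bound (polygauss_wdom p1).
have mzx : measurable_fun setT (fun x : 'rV[R]_d => z - x).
  have := measurable_affine_rV (-1) z.
  by under eq_fun do rewrite scaleN1r addrC.
have [mR mI] := cmeasurable_comp (cmeasurable_fourier (polygauss_wdom pf).1) mzx.
have [mR1 mI1] := cmeasurable_comp (cmeasurable_fourier (polygauss_wdom p1).1) mzx.
pose K := M + M1.
have bK y : Normc.normc (fourier f y) <= K by rewrite (le_trans (HM y))// lerDl.
have bK1 y : Normc.normc (fourier (fun x => x ord0 j * f x) y) <= K.
  by rewrite (le_trans (HM1 y))// lerDr.
have iw : rintegrable (lebesgue_rV d) (fun x => N * K * wgt x).
  exact: rintegrable_cwgt.
have bnd (u : R) x : `|u| <= K -> `|chi x * u| <= N * K * wgt x.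
  by move=> uK; rewrite normrM mulrAC ler_pM.
have Ri : complex.Re (- 'i%C : R[i]) = 0 by rewrite /= oppr0.
have Ii : complex.Im (- 'i%C : R[i]) = -1 by [].
apply: complex_eqP.
  rewrite ReM Ri Ii; cbn [complex.Re complex.Im cintegral].
  rewrite mul0r sub0r mulN1r opprK.
  under eq_Rintegral do rewrite ReZ.
  under [RHS]eq_Rintegral do rewrite ImZ.
  have dt x : is_derive x (basis_vec R j) (fun y => complex.Re (fourier f (z - y)))
      (- complex.Im (fourier (fun x => x ord0 j * f x) (z - x))).
    by apply: (is_derive_reflect (G := fun y => complex.Re (fourier f y)));
      exact: polygauss_is_derive_Re.
  rewrite (Rintegral_by_parts mc mc' mR _ dc dt cN cN' (M' := K)); last 3 first.
  - exact: measurableT_comp.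
  - by move=> x; exact: le_trans (Re_le_normc _) (bK _).
  - by move=> x; rewrite normrN; exact: le_trans (Im_le_normc _) (bK1 _).
  under eq_Rintegral do rewrite mulrN -mulN1r.
  rewrite RintegralZl// ?mulN1r ?opprK//.
  apply: (rintegrable_le _ _ iw); first exact: measurable_funM.
  by move=> x; apply: bnd; exact: le_trans (Im_le_normc _) (bK1 _).
rewrite ImM Ri Ii; cbn [complex.Re complex.Im cintegral].
rewrite mul0r add0r mulN1r.
under eq_Rintegral do rewrite ImZ.
under [in RHS]eq_Rintegral do rewrite ReZ.
have dt x : is_derive x (basis_vec R j) (fun y => complex.Im (fourier f (z - y)))
    (complex.Re (fourier (fun x => x ord0 j * f x) (z - x))).
  rewrite -[complex.Re _]opprK.
  apply: (is_derive_reflect (G := fun y => complex.Im (fourier f y))).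
  exact: polygauss_is_derive_Im.
rewrite (Rintegral_by_parts mc mc' mI mR1 dc dt cN cN' (M' := K))//.
- by move=> x; exact: le_trans (Im_le_normc _) (bK _).
- by move=> x; exact: le_trans (Re_le_normc _) (bK1 _).
Qed.

End fourier_polygauss.

Arguments cis {R} t : simpl never.
Arguments fourier {R d} f xi : simpl never.
Arguments cintegral {disp T R} mu f : simpl never.

(** * Limits of complex sequences *)

Section complex_convergence.
Context {R : realType}.

Definition ccvg (u : nat -> R[i]) (l : R[i]) :=
  complex.Re (u n) @[n --> \oo] --> complex.Re l /\
  complex.Im (u n) @[n --> \oo] --> complex.Im l.

Lemma ccvg_unique u l l' : ccvg u l -> ccvg u l' -> l = l'.
Proof.
move=> [a b] [a' b']; apply: complex_eqP.
  exact: (cvg_unique _ a a').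
exact: (cvg_unique _ b b').
Qed.

Lemma ccvg_cst l : ccvg (fun=> l) l.
Proof. by split; exact: cvg_cst. Qed.

Lemma ccvgM u v l m : ccvg u l -> ccvg v m -> ccvg (fun n => u n * v n) (l * m).
Proof.
move=> [a b] [a' b']; split.
  rewrite ReM; under eq_fun do rewrite ReM.
  by apply: cvgB; exact: cvgM.
rewrite ImM; under eq_fun do rewrite ImM.
by apply: cvgD; exact: cvgM.
Qed.

Lemma ccvg_real (u : nat -> R) (l : R) : u n @[n --> \oo] --> l ->
  ccvg (fun n => (u n)%:C%C) l%:C%C.
Proof. by move=> ul; split => //=; exact: cvg_cst. Qed.

Lemma cintegral_dct (dT : measure_display) (T : measurableType dT)
    (mu : {measure set T -> \bar R}) (f_ : nat -> T -> R[i]) (f : T -> R[i])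
    (g : T -> R) :
  (forall n, cmeasurable (f_ n)) ->
  (forall x, ccvg (fun n => f_ n x) (f x)) ->
  (forall n x, Normc.normc (f_ n x) <= g x) -> rintegrable mu g ->
  ccvg (fun n => cintegral mu (f_ n)) (cintegral mu f).
Proof.
move=> mf cf fg ig; split.
  apply: (Rintegral_dct _ _ _ ig) => [n|x|n x].
  - by have [] := mf n.
  - by have [] := cf x.
  - exact: le_trans (Re_le_normc _) (fg n x).
apply: (Rintegral_dct _ _ _ ig) => [n|x|n x].
- by have [] := mf n.
- by have [] := cf x.
- exact: le_trans (Im_le_normc _) (fg n x).
Qed.

End complex_convergence.

(** * Inversion and autocorrelation *)

Section fourier_inversion.
Context {R : realType} {d : nat}.
Implicit Types (k x xi : 'rV[R]_d) (f : 'rV[R]_d -> R).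

Local Notation leb := (lebesgue_rV d).

(** The transform is unnormalised, so inversion at the origin identifies this number with
    [(2 pi)^d]. What matters for the estimates is that it does not involve [s]. *)
Definition fourier_const k : R[i] := cintegral leb (fourier (gauss k 1)).

Lemma gauss0 k s : gauss k s 0 = 1.
Proof.
rewrite /gauss /symb big1 ?expr0n ?mulr0 ?oppr0 ?expR0// => j _.
by rewrite mxE !mulr0 addr0.
Qed.

Lemma gauss_ge0 k s x : 0 <= gauss k s x.
Proof. exact: expR_ge0. Qed.

Lemma gauss_le1 k s x : 0 <= s -> gauss k s x <= 1.
Proof. by move=> s0; rewrite -expR0 ler_expR oppr_le0 mulr_ge0// sqr_ge0. Qed.

Lemma cvg_scale0 (x : 'rV[R]_d) : n.+1%:R^-1 *: x @[n --> \oo] --> (0 : 'rV[R]_d).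
Proof.
rewrite -[X in _ --> X](scale0r x); apply: cvgZr_tmp; exact: cvg_harmonic.
Qed.

(* Regularise by the factor [gauss k 1 (u / n)], whose Fourier transform is an
   approximate identity; the constant is its total mass. *)
Lemma fourier_inversion k s f xi : 0 < s -> polygauss k s f ->
  cintegral leb (fun u => fourier f u * cis (dotv u xi)) =
  fourier_const k * (f xi)%:C%C.
Proof.
move=> s0 pf; pose G := gauss k 1.
have pG : polygauss k 1 G by exact: polygauss_gauss.
have wf := polygauss_wdom s0 pf; have wG := polygauss_wdom ltr01 pG.
have mG : measurable_fun setT G := wG.1.
pose A (n : nat) := cintegral leb
  (fun u => fourier f u * cis (dotv u xi) * (G (n.+1%:R^-1 *: u))%:C%C).
have cdu (y : 'rV[R]_d) : cmeasurable (fun u : 'rV[R]_d => cis (dotv u y)).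
  apply: cmeasurable_cis; under eq_fun do rewrite dotvC; exact: measurable_dotv1.
have mscal (c : R) (b : 'rV[R]_d) : measurable_fun setT (fun u : 'rV[R]_d => c *: u + b).
  exact: measurable_affine_rV.
have mscal0 (c : R) : measurable_fun setT (fun u : 'rV[R]_d => c *: u).
  by have := mscal c 0; under eq_fun do rewrite addr0.
have mGd (c : R) : measurable_fun setT (fun u : 'rV[R]_d => G (c *: u)).
  exact: measurableT_comp.
have A1 : ccvg A (cintegral leb (fun u => fourier f u * cis (dotv u xi))).
  have [M M0 HM] := fourier_decay1 s0 pf.
  apply: (cintegral_dct _ _ _ (rintegrable_cwgt M)) => [n|u|n u].
  - apply: cmeasurableM; last exact: cmeasurable_real.
    apply: cmeasurableM => //; exact: cmeasurable_fourier wf.1.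
  - rewrite -[X in ccvg _ X]mulr1; apply: ccvgM; first exact: ccvg_cst.
    apply: ccvg_real; rewrite -[X in _ --> X](gauss0 k 1).
    by apply: continuous_cvg; [exact: continuous_gauss|exact: cvg_scale0].
  - rewrite normcM normcM normc_cis mulr1 normc_real ger0_norm ?gauss_ge0//.
    apply: le_trans (HM u); rewrite ler_piMr ?normc_ge0//.
    exact: gauss_le1.
have A2 : ccvg A (fourier_const k * (f xi)%:C%C).
  pose B (n : nat) := cintegral leb
    (fun y => fourier G y * (f (n.+1%:R^-1 *: y + xi))%:C%C).
  have [M M0 HM] := fourier_decay1 ltr01 pG.
  have [N N0 HN] := wdom_bound wf.
  have fN x : `|f x| <= N.
    by rewrite (le_trans (HN x))// ler_piMr// wgt_le1.
  have -> : A = B.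
    apply/funext => n; rewrite /A /B; set dl : R := n.+1%:R^-1.
    have dl0 : 0 < dl by rewrite invr_gt0.
    have dln0 : dl != 0 by rewrite gt_eqF.
    pose F (p : 'rV[R]_d * 'rV[R]_d) : R[i] :=
      conjc (cis (dotv p.1 p.2)) * (f p.2)%:C%C *
      (cis (dotv p.1 xi) * (G (dl *: p.1))%:C%C).
    have FE u y : F (u, y) = conjc (cis (dotv u y)) * (f y)%:C%C *
      (cis (dotv u xi) * (G (dl *: u))%:C%C) by [].
    have mF : cmeasurable F.
      apply: cmeasurableM; first exact: cmeasurable_fourier_kernel wf.1.
      apply: (cmeasurable_comp (f := fun u => cis (dotv u xi) * (G (dl *: u))%:C%C));
        last exact: measurable_fst.
      by apply: cmeasurableM => //; exact: cmeasurable_real.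
    have iG : rintegrable leb (fun u => G (dl *: u)).
      have := rintegrable_affine_rV 0 dln0 (wdom_rintegrable wG).
      by under eq_fun do rewrite addr0.
    have FB u y : Normc.normc (F (u, y)) <= G (dl *: u) * `|f y|.
      rewrite FE !normcM !normc_conj !normc_cis !mul1r !normc_real mulrC.
      by rewrite ger0_norm// gauss_ge0.
    transitivity (cintegral leb (fun u => cintegral leb (fun y => F (u, y)))).
      apply: eq_cintegral => u; rewrite -mulrA mulrC fourierE -cintegralZl.
        by apply: eq_cintegral => y; rewrite mulrC.
      exact: cintegrable_fourier_kernel.
    rewrite (cintegral_Fubini mF FB iG); last exact/rintegrable_norm/wdom_rintegrable.
    pose Psi (y : 'rV[R]_d) := fourier G y * (f (dl *: y + xi))%:C%C.
    have iPsi : cintegrable leb Psi.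
      apply: (cintegrable_le _ _ (rintegrable_cwgt (M * N))) => [|y].
        apply: cmeasurableM; first exact: cmeasurable_fourier.
        by apply: cmeasurable_real; apply: measurableT_comp => //; exact: wf.1.
      by rewrite normcM normc_real mulrAC ler_pM ?normc_ge0.
    (* For fixed [y] the integral over [u] is the transform of [G] at [(y - xi) / dl], with Jacobian
       [dl^-d]. Substituting [dl * y + xi] for [y] afterwards yields the inverse Jacobian. *)
    transitivity (cintegral leb (fun y => (`|dl|^-1 ^+ d)%:C%C *
        Psi (dl^-1 *: y + - (dl^-1 *: xi)))).
      apply: eq_cintegral => y; rewrite /Psi scalerDr scalerN !scalerA divff// !scale1r subrK.
      rewrite mulrA [RHS]mulrC fourierE; set y' := _ - _.
      rewrite -(cintegral_affine_rV 0)//; last exact: cintegrable_fourier_kernel.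
      rewrite -cintegralZl; last first.
        have h := cintegrable_fourier_kernel y' wG.
        by have := cintegrable_affine_rV 0 dln0 h.
      apply: eq_cintegral => u; rewrite FE addr0.
      have -> : cis (dotv y' (dl *: u)) = cis (dotv u y) * conjc (cis (dotv u xi)).
        rewrite -cisN -cisD; congr cis; rewrite dotvZr /y' -scalerBr dotvZl mulrA.
        by rewrite divff// mul1r dotvDl -scaleN1r dotvZl mulN1r !(dotvC u).
      by rewrite conjcM conjcK; ring.
    rewrite cintegralZl; last first.
      by apply: cintegrable_affine_rV => //; rewrite invr_eq0.
    rewrite cintegral_affine_rV ?invr_eq0// mulrA -rmorphM -exprMn.
    have dlV0 : 0 < dl^-1 by rewrite invr_gt0.
    have -> : `|dl|^-1 / `|dl^-1| = 1.
      by rewrite [X in _ / X]normfV divff// invr_eq0 normr_eq0.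
    by rewrite expr1n rmorph1 mul1r.
  rewrite /fourier_const mulrC -cintegralZl; last exact: (@cintegrable_fourier _ _ k 1).
  under eq_cintegral do rewrite mulrC.
  apply: (cintegral_dct _ _ _ (rintegrable_cwgt (M * N))) => [n|y|n y].
  - apply: cmeasurableM; first exact: cmeasurable_fourier.
    by apply: cmeasurable_real; apply: measurableT_comp => //; exact: wf.1.
  - apply: ccvgM; first exact: ccvg_cst.
    apply: ccvg_real; apply: continuous_cvg; first by apply: (continuous_polygauss pf).
    rewrite -[X in _ --> X]add0r; apply: cvgD; [exact: cvg_scale0|exact: cvg_cst].
  - by rewrite normcM normc_real mulrAC ler_pM ?normc_ge0.
exact: ccvg_unique A1 A2.
Qed.

(** A Parseval identity: the conjugated factor is expanded as an integral over [y], and the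
    remaining integral over [x] is the inversion formula for [f] at [y]. It produces the [f ^+ 2] of
    [sqn_smoothing]. *)
Lemma fourier_autocorrelation k s f z : 0 < s -> polygauss k s f ->
  cintegral leb (fun x => fourier f x * conjc (fourier f (x + z))) =
  fourier_const k * conjc (fourier (fun x => f x ^+ 2) z).
Proof.
move=> s0 pf; have wf := polygauss_wdom s0 pf.
have [M M0 HM] := fourier_decay1 s0 pf.
have w2 : wdom (fun x => f x ^+ 2).
  by apply: (@polygauss_wdom _ _ k (s + s)); [exact: addr_gt0|exact: polygauss_sqr].
pose F (p : 'rV[R]_d * 'rV[R]_d) : R[i] :=
  fourier f p.1 * (cis (dotv p.1 p.2) * (cis (dotv z p.2) * (f p.2)%:C%C)).
have FE x y : F (x, y) =
  fourier f x * (cis (dotv x y) * (cis (dotv z y) * (f y)%:C%C)) by [].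
have m1 : cmeasurable (fun y => cis (dotv z y) * (f y)%:C%C).
  apply: cmeasurableM; last by apply: cmeasurable_real; exact: wf.1.
  apply: cmeasurable_cis; exact: measurable_dotv1.
have mF : cmeasurable F.
  apply: cmeasurableM.
    apply: (cmeasurable_comp (f := fourier f)); first exact: cmeasurable_fourier wf.1.
    exact: measurable_fst.
  apply: cmeasurableM; first by apply: cmeasurable_cis; exact: measurable_dotv.
  by apply: (cmeasurable_comp m1); exact: measurable_snd.
have FB x y : Normc.normc (F (x, y)) <= (M * wgt x) * `|f y|.
  by rewrite FE !normcM !normc_cis !mul1r normc_real ler_wpM2r.
transitivity (cintegral leb (fun x => cintegral leb (fun y => F (x, y)))).
  apply: eq_cintegral => x; under [RHS]eq_cintegral do rewrite FE.
  rewrite [fourier f (x + z)]fourierE -cintegral_conj; last first.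
    exact: cintegrable_fourier_kernel.
  rewrite -cintegralZl; last exact/cintegrable_conj/cintegrable_fourier_kernel.
  apply: eq_cintegral => y; rewrite conjcM conjcK conjc_real dotvDl cisD.
  by ring.
rewrite (cintegral_Fubini mF FB (rintegrable_cwgt M)); last first.
  exact/rintegrable_norm/wdom_rintegrable.
rewrite [fourier _ z]fourierE -cintegral_conj; last exact: cintegrable_fourier_kernel.
rewrite -cintegralZl; last exact/cintegrable_conj/cintegrable_fourier_kernel.
apply: eq_cintegral => y; under eq_cintegral do rewrite FE.
transitivity ((cis (dotv z y) * (f y)%:C%C) *
    cintegral leb (fun x => fourier f x * cis (dotv x y))).
  rewrite -cintegralZl; first by apply: eq_cintegral => x; ring.
  apply: (cintegrable_le _ _ (rintegrable_cwgt M)) => [|x].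
    apply: cmeasurableM; first exact: cmeasurable_fourier wf.1.
    by apply: cmeasurable_cis; under eq_fun do rewrite dotvC; exact: measurable_dotv1.
  by rewrite normcM normc_cis mulr1.
rewrite (fourier_inversion y s0 pf) conjcM conjcK conjc_real expr2 rmorphM /=.
by ring.
Qed.

End fourier_inversion.

(** * The space L^2(Omega) and stationary fields *)

Section L2_space.
Context {disp : measure_display} {Omega : measurableType disp} {R : realType}.
Variable P : probability Omega R.
Implicit Types f g : Omega -> R[i].

Definition sqn f : R := \int[P]_w (Normc.normc (f w) ^+ 2).

Lemma sqn_ge0 f : 0 <= sqn f.
Proof. by apply: Rintegral_ge0 => w _; rewrite sqr_ge0. Qed.

Lemma rintegrable_cst (c : R) : rintegrable P (fun=> c).
Proof.
apply: (@rintegrable_le _ _ _ _ _ (fun=> `|c|)) => //.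
apply: rintegrable_ge0 => //.
by rewrite integral_cst//= probability_setT mule1 ltry.
Qed.

Lemma cLnorm2_sqr f : cmeasurable f ->
  (cLnorm P 2%:E f `^ 2 = \int[P]_w (Normc.normc (f w) ^+ 2)%:E)%E.
Proof.
move=> mf; rewrite /cLnorm poweR_Lnorm//; apply: eq_integral => w _.
by rewrite /= ger0_norm ?normc_ge0// powR_mulrn// normc_ge0.
Qed.

Lemma in_cLp2P f : in_cLp P 2%:E f <->
  cmeasurable f /\ rintegrable P (fun w => Normc.normc (f w) ^+ 2).
Proof.
split=> [[mf]|[mf]].
  move=> fi; split=> //; apply: rintegrable_ge0 => [|w|].
  - by apply: measurable_funX; exact: measurable_normc.
  - exact: sqr_ge0.
  - by rewrite -cLnorm2_sqr// poweR_lty.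
move=> /rintegrable_fin fi; split=> //; rewrite ltNge leye_eq; apply/negP => /eqP.
move=> E; have := cLnorm2_sqr mf.
by rewrite E fi poweRyr.
Qed.

Lemma cLnorm2E f : in_cLp P 2%:E f -> cLnorm P 2%:E f = (Num.sqrt (sqn f))%:E.
Proof.
move=> /[dup] L2f /in_cLp2P[mf fi].
have := cLnorm2_sqr mf; rewrite (rintegrable_fin fi).
have [_] := L2f; have : (0 <= cLnorm P 2%:E f)%E by exact: Lnorm_ge0.
case: (cLnorm P 2%:E f) => [r| |]//; rewrite lee_fin => r0 _.
rewrite poweR_EFin powR_mulrn// => -[E].
by rewrite /sqn -E sqrtr_sqr ger0_norm.
Qed.

Lemma L2_meas f : in_cLp P 2%:E f -> cmeasurable f.
Proof. by case. Qed.

Lemma L2_sqr f : in_cLp P 2%:E f -> rintegrable P (fun w => Normc.normc (f w) ^+ 2).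
Proof. by move=> /in_cLp2P[]. Qed.

Lemma L2_le f (a : Omega -> R) : cmeasurable f ->
  (forall w, Normc.normc (f w) ^+ 2 <= a w) -> rintegrable P a -> in_cLp P 2%:E f.
Proof.
move=> mf fa ia; apply/in_cLp2P; split=> //.
apply: (rintegrable_le _ _ ia) => [|w].
  by apply: measurable_funX; exact: measurable_normc.
by rewrite ger0_norm ?sqr_ge0.
Qed.

Lemma L2_bounded f (M : R) : cmeasurable f -> (forall w, Normc.normc (f w) <= M) ->
  in_cLp P 2%:E f.
Proof.
move=> mf fM; apply: (L2_le mf _ (rintegrable_cst (M ^+ 2))) => w.
by rewrite lerXn2r ?nnegrE ?normc_ge0// (le_trans _ (fM w))// normc_ge0.
Qed.

Lemma Loo_bounded f (M : R) : cmeasurable f -> (forall w, Normc.normc (f w) <= M) ->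
  in_cLp P +oo%E f.
Proof.
move=> mf fM; split=> //; rewrite /cLnorm unlock /= probability_setT lte01.
apply: (@le_lt_trans _ _ M%:E); last exact: ltry.
apply: (@ess_sup_inf.ess_sup_ler _ _ _ P (fun w => `|Normc.normc (f w)|) M%:E) => w.
by rewrite lee_fin ger0_norm ?normc_ge0.
Qed.

Lemma L2D f g : in_cLp P 2%:E f -> in_cLp P 2%:E g -> in_cLp P 2%:E (fun w => f w + g w).
Proof.
move=> /in_cLp2P[mf fi] /in_cLp2P[mg gi].
apply: (L2_le _ _ (rintegrableD (rintegrableZl 2 fi) (rintegrableZl 2 gi))).
  exact: cmeasurableD.
move=> w; have := normcD (f w) (g w); have := normc_ge0 (f w + g w).
have := sqr_ge0 (Normc.normc (f w) - Normc.normc (g w)).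
move: (Normc.normc (f w)) (Normc.normc (g w)) (Normc.normc (f w + g w)) => a b c.
by nra.
Qed.

Lemma L2Z (c : R[i]) f : in_cLp P 2%:E f -> in_cLp P 2%:E (fun w => c * f w).
Proof.
move=> /in_cLp2P[mf fi].
apply: (L2_le _ _ (rintegrableZl (Normc.normc c ^+ 2) fi)).
  by apply: cmeasurableM => //; exact: cmeasurable_cst.
by move=> w; rewrite normcM exprMn.
Qed.

Lemma L2N f : in_cLp P 2%:E f -> in_cLp P 2%:E (fun w => - f w).
Proof. by move=> /(L2Z (-1)); under eq_fun do rewrite mulN1r. Qed.

Lemma L2B f g : in_cLp P 2%:E f -> in_cLp P 2%:E g -> in_cLp P 2%:E (fun w => f w - g w).
Proof. by move=> Lf /L2N; exact: L2D. Qed.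

Lemma L2_prod f g : in_cLp P 2%:E f -> in_cLp P 2%:E g ->
  rintegrable P (fun w => Normc.normc (f w) * Normc.normc (g w)).
Proof.
move=> /in_cLp2P[mf fi] /in_cLp2P[mg gi].
apply: (rintegrable_le _ _ (rintegrableD fi gi)).
  by apply: measurable_funM; exact: measurable_normc.
move=> w; rewrite ger0_norm ?mulr_ge0 ?normc_ge0//.
have := sqr_ge0 (Normc.normc (f w) - Normc.normc (g w)).
have := sqr_ge0 (Normc.normc (f w) + Normc.normc (g w)).
by nra.
Qed.

Lemma L2_integrable f : in_cLp P 2%:E f -> rintegrable P (fun w => Normc.normc (f w)).
Proof.
move=> Lf; have L1 : in_cLp P 2%:E (fun _ : Omega => 1 : R[i]).
  apply: (@L2_bounded _ 1); [exact: cmeasurable_cst|move=> w].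
  by rewrite Normc.normc1.
by have := L2_prod Lf L1; under eq_fun do rewrite Normc.normc1 mulr1.
Qed.

Lemma cintegrable_inner f g : in_cLp P 2%:E f -> in_cLp P 2%:E g ->
  cintegrable P (fun w => conjc (f w) * g w).
Proof.
move=> Lf Lg; apply: (cintegrable_le _ _ (L2_prod Lf Lg)).
  by apply: cmeasurableM; [exact/cmeasurable_conj/(L2_meas Lf)|exact: L2_meas Lg].
by move=> w; rewrite normcM normc_conj.
Qed.

(** Cauchy-Schwarz by the discriminant: the square of [t |f| - |g|] is nonnegative for every real
    [t], and the integrated inequality is used at the optimal [t = I / sqn f]. *)
Lemma Rintegral_prod_sqr f g : in_cLp P 2%:E f -> in_cLp P 2%:E g ->
  (\int[P]_w (Normc.normc (f w) * Normc.normc (g w))) ^+ 2 <= sqn f * sqn g.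
Proof.
move=> Lf Lg; set I := Rintegral _ _ _.
have I0 : 0 <= I by apply: Rintegral_ge0 => w _; rewrite mulr_ge0 ?normc_ge0.
have H (t : R) : 2 * t * I <= t ^+ 2 * sqn f + sqn g.
  rewrite /I /sqn -!RintegralZl//; try exact: L2_prod; try exact: L2_sqr.
  rewrite -RintegralD//; try exact/rintegrableZl/L2_sqr; try exact: L2_sqr.
  apply: le_Rintegral => //; first exact/rintegrableZl/L2_prod.
    by apply: rintegrableD; [exact/rintegrableZl/L2_sqr|exact: L2_sqr].
  move=> w _; have := sqr_ge0 (t * Normc.normc (f w) - Normc.normc (g w)).
  by nra.
have A0 := sqn_ge0 f; have B0 := sqn_ge0 g.
have [Af|Af] := eqVneq (sqn f) 0.
  have [->|In0] := eqVneq I 0; first by rewrite expr0n mulr_ge0.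
  (* In the degenerate case the inequality is linear in [t], and this [t] would give
     [sqn g + 1 <= sqn g]. *)
  have := H ((sqn g + 1) / (2 * I)); rewrite Af mulr0 add0r.
  by rewrite (_ : 2 * _ * I = sqn g + 1); [lra|field].
have Ap : 0 < sqn f by rewrite lt_neqAle eq_sym Af.
have := H (I / sqn f).
rewrite (_ : 2 * _ * I = I ^+ 2 / sqn f + I ^+ 2 / sqn f); last by field.
rewrite (_ : (_ / _) ^+ 2 * _ = I ^+ 2 / sqn f); last by field.
by rewrite lerD2l ler_pdivrMr// mulrC.
Qed.

Lemma normc_inner f g : in_cLp P 2%:E f -> in_cLp P 2%:E g ->
  Normc.normc (inner P f g) ^+ 2 <= 4 * (sqn f * sqn g).
Proof.
move=> Lf Lg; apply: (@le_trans _ _ ((2 * \int[P]_w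
    (Normc.normc (f w) * Normc.normc (g w))) ^+ 2)).
  rewrite lerXn2r ?nnegrE ?normc_ge0//.
    rewrite mulr_ge0//; apply: Rintegral_ge0 => w _.
    by rewrite mulr_ge0 ?normc_ge0.
  apply: cintegral_le (L2_prod Lf Lg) => [|w].
    exact: cintegrable_meas (cintegrable_inner Lf Lg).
  by rewrite normcM normc_conj.
rewrite exprMn (_ : 2 ^+ 2 = 4)//; last by ring.
by rewrite ler_wpM2l// Rintegral_prod_sqr.
Qed.

Lemma inner_conj f g : in_cLp P 2%:E f -> in_cLp P 2%:E g ->
  inner P g f = conjc (inner P f g).
Proof.
move=> Lf Lg; rewrite /inner -cintegral_conj; last exact: cintegrable_inner.
by apply: eq_cintegral => w; rewrite conjcM conjcK mulrC.
Qed.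

Lemma innerDr f g1 g2 : in_cLp P 2%:E f -> in_cLp P 2%:E g1 -> in_cLp P 2%:E g2 ->
  inner P f (fun w => g1 w + g2 w) = inner P f g1 + inner P f g2.
Proof.
move=> Lf L1 L2; rewrite /inner -cintegralD; try exact: cintegrable_inner.
by apply: eq_cintegral => w; rewrite mulrDr.
Qed.

Lemma innerZr (c : R[i]) f g : in_cLp P 2%:E f -> in_cLp P 2%:E g ->
  inner P f (fun w => c * g w) = c * inner P f g.
Proof.
move=> Lf L1; rewrite /inner -cintegralZl; last exact: cintegrable_inner.
by apply: eq_cintegral => w; rewrite mulrCA.
Qed.

Lemma innerBr f g1 g2 : in_cLp P 2%:E f -> in_cLp P 2%:E g1 -> in_cLp P 2%:E g2 ->
  inner P f (fun w => g1 w - g2 w) = inner P f g1 - inner P f g2.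
Proof.
move=> Lf L1 L2; rewrite -mulN1r -innerZr// -innerDr//; last exact: L2Z.
by apply: eq_cintegral => w; rewrite mulN1r.
Qed.

Lemma inner_sqn f : inner P f f = (sqn f)%:C%C.
Proof.
rewrite /inner /sqn -cintegral_real; apply: eq_cintegral => w.
exact: mul_conjc.
Qed.

Lemma Rintegral_normc_sqr f : in_cLp P 2%:E f ->
  (\int[P]_w Normc.normc (f w)) ^+ 2 <= sqn f.
Proof.
move=> Lf; have L1 : in_cLp P 2%:E (fun _ : Omega => 1 : R[i]).
  apply: (@L2_bounded _ 1); first exact: cmeasurable_cst.
  by move=> w; rewrite Normc.normc1.
have := Rintegral_prod_sqr Lf L1; under eq_Rintegral do rewrite Normc.normc1 mulr1.
suff -> : sqn (fun _ : Omega => 1 : R[i]) = 1 by rewrite mulr1.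
rewrite /sqn; under eq_Rintegral do rewrite Normc.normc1 expr1n.
by rewrite /Rintegral integral_cst//= probability_setT mule1.
Qed.

(** Testing with [g = f] gives [n^2 <= b I], where [n] and [I] are the L^2 and L^1 norms of [f], and
    [I <= n] because P has mass 1. The L^1 norm of the test element is what [cintegral_corr_bound]
    delivers. *)
Lemma cLnorm2_dual f b : in_cLp P 2%:E f -> 0 <= b ->
  (forall g, in_cLp P 2%:E g ->
    Normc.normc (inner P g f) <= b * \int[P]_w Normc.normc (g w)) ->
  (cLnorm P 2%:E f <= b%:E)%E.
Proof.
move=> Lf b0 /(_ f Lf); rewrite cLnorm2E// lee_fin inner_sqn normc_real ger0_norm ?sqn_ge0//.
have := Rintegral_normc_sqr Lf; set I := Rintegral _ _ _; set n := Num.sqrt _ => h1 h2.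
have n0 : 0 <= n by exact: sqrtr_ge0.
have nE : sqn f = n ^+ 2 by rewrite sqr_sqrtr// sqn_ge0.
have In : I <= n.
  rewrite -(@ler_pXn2r _ 2)// ?nnegrE//; first by rewrite -nE.
  by apply: Rintegral_ge0 => w _; exact: normc_ge0.
have nn : n ^+ 2 <= b * n by rewrite -nE (le_trans h2)// ler_wpM2l.
have [n_gt0|] := ltP 0 n; last by move=> /le_trans; apply.
by move: nn; rewrite expr2 ler_pM2r.
Qed.

End L2_space.

(** * Integrals under measure-preserving maps *)

Section measure_preserving.
Context {disp : measure_display} {Omega : measurableType disp} {R : realType}.
Variable P : probability Omega R.
Variable T : Omega -> Omega.
Hypothesis mT : measurable_fun setT T.
Hypothesis PT : forall A, measurable A -> P (T @^-1` A) = P A.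

Lemma ge0_integral_preserving (f : Omega -> \bar R) : measurable_fun setT f ->
  (forall w, 0 <= f w)%E -> (\int[P]_w f (T w) = \int[P]_w f w)%E.
Proof.
move=> mf f0; have := @ge0_integral_pushforward _ _ _ _ _ _ mT P setT f measurableT mf
  (fun w _ => f0 w).
rewrite preimage_setT => <-.
by apply: eq_measure_integral => A mA _; exact: PT.
Qed.

Lemma rintegrable_preserving (f : Omega -> R) : rintegrable P f ->
  rintegrable P (fun w => f (T w)).
Proof.
move=> /integrableP[/measurable_EFinP mf fi].
apply/integrableP; split; first by apply/measurable_EFinP; exact: measurableT_comp.
rewrite (ge0_integral_preserving (f := fun w => `|(f w)%:E|%E))//.
by apply: measurableT_comp => //; exact/measurable_EFinP.
Qed.

Lemma Rintegral_preserving (f : Omega -> R) : measurable_fun setT f ->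
  \int[P]_w f (T w) = \int[P]_w f w.
Proof.
move=> mf; have mf' : measurable_fun setT (EFin \o f) by exact/measurable_EFinP.
rewrite /Rintegral integralE [in RHS]integralE; congr (fine (_ - _)%E).
  rewrite -(ge0_integral_preserving (f := (EFin \o f)^\+%E))//; last first.
    exact: measurable_funepos mf'.
  by apply: eq_integral => w _; rewrite !funeposE.
rewrite -(ge0_integral_preserving (f := (EFin \o f)^\-%E))//; last first.
  exact: measurable_funeneg mf'.
by apply: eq_integral => w _; rewrite !funenegE.
Qed.

Lemma cintegral_preserving (f : Omega -> R[i]) : cmeasurable f ->
  cintegral P (fun w => f (T w)) = cintegral P f.
Proof.
move=> [m1 m2]; apply: complex_eqP.
  exact: (Rintegral_preserving m1).
exact: (Rintegral_preserving m2).
Qed.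

Lemma L2_preserving (f : Omega -> R[i]) : in_cLp P 2%:E f ->
  in_cLp P 2%:E (fun w => f (T w)) /\ sqn P (fun w => f (T w)) = sqn P f.
Proof.
move=> /in_cLp2P[mf fi]; split.
  apply/in_cLp2P; split; first exact: cmeasurable_comp mf mT.
  exact: rintegrable_preserving fi.
by apply: (Rintegral_preserving (f := fun w => Normc.normc (f w) ^+ 2)); exact: rintegrable_meas fi.
Qed.

End measure_preserving.

(** * Product-measurable versions of stationary fields *)

Section stationary_version.
Context {R : realType} {d : nat} {disp : measure_display}
  {Omega : measurableType disp}.
Variables (P : probability Omega R) (tau : 'rV[R]_d -> Omega -> Omega).
Hypothesis tauP : measurable_action P tau.

Local Notation leb := (lebesgue_rV d).

(** Each superlevel set of a stationary field is measurable off its own null set. With rational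
    levels there are countably many exceptional sets, whose union is still null. *)
Lemma measurable_countable_rays {dT} {T : measurableType dT} (D : set T) (f : T -> R) :
  measurable D -> (forall q : rat, measurable (D `&` [set x | ratr q < f x])) ->
  measurable_fun D f.
Proof.
move=> mD H; apply: (measurability _ (RGenOInfty.measurableE R)) => /= _ [_ [a ->] <-].
rewrite (_ : _ `&` _ = \bigcup_(q in [set q : rat | a < ratr q])
    (D `&` [set x | ratr q < f x])); last first.
  apply/seteqP; split => [x [Dx]|x [q /= aq [Dx qf]]]; rewrite /= in_itv/= andbT.
    move=> /rat_in_itvoo[q]; rewrite in_itv/= => /andP[aq qf].
    by exists q.
  by split=> //; exact: lt_trans aq qf.
rewrite bigcup_mkcond; apply: countable_bigcupT_measurable => // q.
by case: ifPn.
Qed.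

Lemma null_sections (N : set ('rV[R]_d * Omega)) : measurable N ->
  (leb \x P)%E N = 0 -> {ae leb, forall x, P (xsection N x) = 0}.
Proof.
move=> mN; rewrite /product_measure1 => N0.
have mx : measurable_fun setT (fun x => P (xsection N x)).
  exact: measurable_fun_xsection.
have := (ae_eq_integral_abs leb measurableT mx).1.
rewrite (_ : (\int[_]_x _)%E = 0%E); last first.
  rewrite -N0; apply: eq_integral => x _; rewrite gee0_abs//.
by move=> /(_ erefl); apply: filterS => x; exact.
Qed.

(** Off one measurable null set N of the product, all rational superlevel sets coincide with
    measurable ones, so the field restricted there is measurable; it is set to 0 on N, which
    respects any bound. By Tonelli almost every section of N is null. *)
Lemma stationary_version (Y : Omega -> R) : measurable_fun setT Y ->
  exists Z : 'rV[R]_d * Omega -> R,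
    [/\ measurable_fun setT Z,
        forall M, 0 <= M -> (forall w, `|Y w| <= M) -> forall p, `|Z p| <= M &
        {ae leb, forall x, {ae P, forall w, Z (x, w) = stat tau Y x w}}].
Proof.
move=> mY.
have /choice[B HB] (q : rat) : exists BN : set ('rV[R]_d * Omega) * set ('rV[R]_d * Omega),
    [/\ measurable BN.1, measurable BN.2, (leb \x P)%E BN.2 = 0 &
      [set p | ratr q < Y (tau p.1 p.2)] `&` ~` BN.2 = BN.1 `&` ~` BN.2].
  have mq : measurable (Y @^-1` `]ratr q, +oo[).
    by rewrite -[X in measurable X]setTI; exact: mY.
  have [B mB [N [N' [mN' N'0 NN']] E]] := action_joint tauP mq.
  exists (B, N'); split=> //=; apply/seteqP; split => p [h Np]; split => //.
    have : (B `|` N) p by rewrite -E /= in_itv/= andbT.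
    by move=> [//|/NN'].
  have : [set p | (Y @^-1` `]ratr q, +oo[) (tau p.1 p.2)] p by rewrite E; left.
  by rewrite /= in_itv/= andbT.
pose N1 := \bigcup_q (B q).2.
have mN1 : measurable N1.
  by apply: countable_bigcupT_measurable => // q; have [] := HB q.
have N10 : (leb \x P)%E N1 = 0.
  by apply: measure_bigcup_null => q; have [] := HB q.
(* [action_joint] concerns tau_x while the stationary extension uses tau_{-x}. Reflection in x
   preserves Lebesgue measure, hence null sets of the product. *)
pose refl (p : 'rV[R]_d * Omega) := (- p.1, p.2).
have mrefl : measurable_fun setT refl.
  apply: measurable_fun_pair; last exact: measurable_snd.
  have := measurable_affine_rV (-1) (0 : 'rV[R]_d).
  under eq_fun do rewrite scaleN1r addr0.
  by move=> h; apply: (measurableT_comp h); exact: measurable_fst.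
pose N := refl @^-1` N1.
have mN : measurable N by rewrite -[N]setTI; exact: mrefl.
have N0 : (leb \x P)%E N = 0.
  have mx : measurable_fun setT (fun x => P (xsection N1 x)).
    exact: measurable_fun_xsection.
  have := ge0_integral_affine_rV (0 : 'rV[R]_d) (a := -1) _ mx.
  rewrite oppr_eq0 oner_eq0 => /(_ isT (fun x => measure_ge0 _ _)).
  move: N10; rewrite /product_measure1 => ->; rewrite mule0 => <-.
  apply: eq_integral => x _; congr (P _); apply/seteqP; split => w /=;
    by rewrite /xsection /= !inE scaleN1r addr0.
pose g (p : 'rV[R]_d * Omega) := Y (tau (- p.1) p.2).
have mg : measurable_fun (~` N) g.
  apply: measurable_countable_rays; first exact: measurableC.
  move=> q; have [mB _ _ E] := HB q.
  rewrite (_ : _ `&` _ = (~` N) `&` refl @^-1` (B q).1).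
    apply: measurableI; first exact: measurableC.
    by rewrite -[X in measurable X]setTI; exact: mrefl.
  apply/seteqP; split => p [Np h]; split => //=.
    have : ((B q).1 `&` ~` (B q).2) (refl p) by rewrite -E; split=> // h2; apply: Np; exists q.
    by case.
  have : ([set p | ratr q < Y (tau p.1 p.2)] `&` ~` (B q).2) (refl p).
    by rewrite E; split=> // h2; apply: Np; exists q.
  by case.
exists (g \_ (~` N)); split.
- by apply/(measurable_restrictT _ _).1 => //; exact: measurableC.
- move=> M M0 YM p; rewrite /patch; case: ifPn => _; first exact: YM.
  by rewrite normr0.
- have := null_sections mN N0; apply: filterS => x Nx.
  exists (xsection N x); split => //; first exact: measurable_xsection.
  move=> w /= h; rewrite /xsection /= inE; apply: contrapT => Nw; apply: h.
  by rewrite /patch mem_set.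
Qed.

End stationary_version.

(** * Weighted bounds for test functions *)

Section test_functions.
Context {R : realType} {d : nat}.
Implicit Types (x z : 'rV[R]_d) (g chi : 'rV[R]_d -> R).

(** A Peetre inequality: [1 + (a + b)^2 <= 2 (1 + a^2) (1 + b^2)] in each coordinate. It converts a
    majorant depending on a difference of the variables into a product majorant. *)
Lemma wgt_mul x z : wgt x * wgt z <= 2 ^+ d * wgt (x + z).
Proof.
rewrite /wgt -big_split/= -[d in 2 ^+ d]card_ord -prodr_const -big_split/=.
apply: ler_prod => j _; rewrite !mxE.
rewrite mulr_ge0 ?invr_ge0 ?(ltW (oneDsqr_gt0 _))//=.
rewrite -invfM ler_pdivlMr ?oneDsqr_gt0// ler_pdivrMl ?mulr_gt0 ?oneDsqr_gt0//.
rewrite /oneDsqr; have := sqr_ge0 (x ord0 j - z ord0 j); have := sqr_ge0 (x ord0 j * z ord0 j).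
nra.
Qed.

(** [g] divided by [wgt ^+ 2] is continuous, the reciprocal of the weight being a polynomial, and is
    therefore bounded on [K]. *)
Lemma compact_wgt_bound (K : set 'rV[R]_d) g : compact K -> continuous g ->
  exists2 N, 0 <= N & forall x, K x -> `|g x| <= N * wgt x ^+ 2.
Proof.
move=> cK cg.
pose p x : R := \prod_(j < d) oneDsqr (x ord0 j).
have pw x : p x * wgt x = 1.
  rewrite /p /wgt -big_split/= big1// => j _.
  by rewrite divff// gt_eqF// oneDsqr_gt0.
have pp : polyfun p.
  rewrite /p; elim: (index_enum _) => [|j t IHt].
    by under eq_fun do rewrite big_nil; exact: polyfun_cst.
  under eq_fun do rewrite big_cons; apply: polyfunM => //.
  apply: polyfunD; first exact: polyfun_cst.
  by apply: polyfunM; exact: polyfun_coord.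
pose h x := g x * p x ^+ 2.
have ch : continuous h.
  move=> x; apply: (@continuousM _ _ g (fun y => p y ^+ 2) x (cg x)).
  by apply: (continuous_polyfun (polyfunM pp pp)).
have [M [_ HM]] := compact_bounded (continuous_compact (continuous_subspaceT ch) cK).
exists (`|M| + 1); first by rewrite addr_ge0.
move=> x Kx; have := HM (`|M| + 1) _ (h x); rewrite ltr_pwDr ?ler_norm//.
move=> /(_ isT) /(_ (ex_intro2 _ _ x Kx erefl)) hx.
rewrite (_ : g x = h x * wgt x ^+ 2); last first.
  by rewrite /h -mulrA -exprMn pw expr1n mulr1.
by rewrite normrM [X in _ * X]ger0_norm ?sqr_ge0// ler_wpM2r ?sqr_ge0.
Qed.

Lemma test_function_bound chi (t : seq 'I_d) : test_function chi ->
  exists2 N, 0 <= N & forall x, `|iter_pderiv t chi x| <= N * wgt x ^+ 2.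
Proof.
move=> [sm cp]; set S := closure _ in cp.
(* The complement of the closed set [S] is open, so vanishing there passes to derivatives. *)
have zero x : ~ S x -> iter_pderiv t chi x = 0.
  elim: t x => [|j t IHt] x nS /=.
    by apply/eqP; apply: contrapT => /negP h; apply: nS; exact: subset_closure.
  rewrite (@near_eq_derive _ _ _ (iter_pderiv t chi) (fun=> 0)) ?derive_cst//.
  have oS : open (~` S) by rewrite openC; exact: closed_closure.
  have := open_nbhs_nbhs (conj oS nS).
  by apply: filterS => y; exact: IHt.
have [N N0 HN] := compact_wgt_bound cp (sm t).1.
exists N => // x; have [/HN//|/zero ->] := pselect (S x).
by rewrite normr0 mulr_ge0 ?sqr_ge0.
Qed.

Lemma test_function_meas chi (t : seq 'I_d) : test_function chi ->
  measurable_fun setT (iter_pderiv t chi).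
Proof. by move=> [sm _]; apply: continuous_measurable_rV; exact: (sm t).1. Qed.

Lemma test_function_is_derive chi (t : seq 'I_d) j x : test_function chi ->
  is_derive x (basis_vec R j) (iter_pderiv t chi) (iter_pderiv (j :: t) chi x).
Proof. by move=> [sm _]; apply/derivableP; exact: (sm t).2. Qed.

Lemma le_sqr_wgt (N c : R) x : 0 <= N -> c <= N * wgt x ^+ 2 -> c <= N * wgt x.
Proof.
move=> N0 /le_trans; apply; rewrite ler_wpM2l// expr2 ler_piMr ?wgt_ge0//.
exact: wgt_le1.
Qed.

End test_functions.

(** * Translation invariance of the inner product *)

Section stationary_inner.
Context {R : realType} {d : nat} {disp : measure_display}
  {Omega : measurableType disp}.
Variables (P : probability Omega R) (tau : 'rV[R]_d -> Omega -> Omega).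
Hypothesis tauP : measurable_action P tau.
Implicit Types (A B : Omega -> R[i]) (x y : 'rV[R]_d).

Lemma L2_stat A x : in_cLp P 2%:E A ->
  in_cLp P 2%:E (stat tau A x) /\ sqn P (stat tau A x) = sqn P A.
Proof.
exact: (L2_preserving (action_measurable tauP (- x)) (action_preserving tauP (- x))).
Qed.

Lemma inner_stat A B x : in_cLp P 2%:E A -> in_cLp P 2%:E B ->
  inner P A (stat tau B x) = inner P (stat tau A (- x)) B.
Proof.
move=> LA LB; have [LA' _] := L2_stat (- x) LA.
rewrite /inner.
rewrite -[RHS](cintegral_preserving (action_measurable tauP (- x))
  (action_preserving tauP (- x)) (cintegrable_meas (cintegrable_inner LA' LB))).
by apply: eq_cintegral => w; rewrite /stat opprK (actionD tauP) addrN (action0 tauP).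
Qed.

Lemma inner_stat2 A B x y : in_cLp P 2%:E A -> in_cLp P 2%:E B ->
  inner P (stat tau A x) (stat tau B y) = inner P A (stat tau B (y - x)).
Proof.
move=> LA LB; have [LB' _] := L2_stat (y - x) LB.
rewrite -[x in stat tau A x]opprK -inner_stat//; last by have [] := L2_stat y LB.
congr inner; apply/funext => w; rewrite /stat (actionD tauP).
by congr (B (tau _ w)); rewrite opprK opprB addrC.
Qed.

End stationary_inner.

(** * Smoothed stationary fields *)

Section smoothing.
Context {R : realType} {d : nat} {disp : measure_display}
  {Omega : measurableType disp}.
Variables (P : probability Omega R) (tau : 'rV[R]_d -> Omega -> Omega).
Hypothesis tauP : measurable_action P tau.
Variables (Y : Omega -> R) (K : R).
Hypotheses (mY : measurable_fun setT Y) (K0 : 0 <= K) (YK : forall w, `|Y w| <= K).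
Variable Z : 'rV[R]_d * Omega -> R.
Hypotheses (mZ : measurable_fun setT Z) (ZK : forall p, `|Z p| <= K).
Hypothesis Zae : {ae lebesgue_rV d, forall x,
  {ae P, forall w, Z (x, w) = stat tau Y x w}}.
Variables (k : 'rV[R]_d) (s : R).
Hypothesis s0 : 0 < s.
Implicit Types (f : 'rV[R]_d -> R) (x z : 'rV[R]_d) (A : Omega -> R[i]).

Local Notation leb := (lebesgue_rV d).
Local Notation Yc := (fun w => (Y w)%:C%C).

(* By [action_joint], tau is measurable only with respect to the completed
   product, hence the measurable version Z of the stationary extension of Y. *)
Definition corr A z : R[i] := inner P A (stat tau Yc z).
Definition corrZ A z : R[i] := inner P A (fun w => (Z (z, w))%:C%C).
(* The translate by x of int \hat f(z) T_z Y dz. *)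
Definition smoothing f x (w : Omega) : R[i] :=
  cintegral leb (fun z => fourier f (z - x) * (Z (z, w))%:C%C).

Lemma L2_Yc : in_cLp P 2%:E Yc.
Proof.
apply: (@L2_bounded _ _ _ _ _ K); first exact: cmeasurable_real.
by move=> w; rewrite normc_real.
Qed.

Lemma corr_ae A : {ae leb, forall z, corr A z = corrZ A z}.
Proof.
apply: filterS Zae => z h; apply: ae_eq_cintegral.
by apply: filterS h => w ->.
Qed.

Lemma cmeasurable_Z : cmeasurable (fun p => (Z p)%:C%C).
Proof. exact: cmeasurable_real. Qed.

Lemma cmeasurable_corrZ A : in_cLp P 2%:E A -> cmeasurable (corrZ A).
Proof.
move=> LA; apply: (cmeasurable_cintegral P
  (F := fun p : 'rV[R]_d * Omega => conjc (A p.2) * (Z p)%:C%C)).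
apply: cmeasurableM; last exact: cmeasurable_Z.
apply: cmeasurable_conj; apply: (cmeasurable_comp (L2_meas LA)).
exact: measurable_snd.
Qed.

Lemma corrZ_bound A z : in_cLp P 2%:E A ->
  Normc.normc (corrZ A z) <= 2 * (K * \int[P]_w Normc.normc (A w)).
Proof.
move=> LA; rewrite -RintegralZl//; last exact: L2_integrable.
apply: cintegral_le (rintegrableZl K (L2_integrable LA)) => [|w].
  apply: cmeasurableM; first exact/cmeasurable_conj/(L2_meas LA).
  apply: cmeasurable_real; exact: (measurableT_comp mZ (pair1_measurable z)).
by rewrite normcM normc_conj normc_real mulrC ler_wpM2r ?normc_ge0.
Qed.

Lemma cintegral_corr A (kap : 'rV[R]_d -> R[i]) :
  cintegral leb (fun z => kap z * corr A z) =
  cintegral leb (fun z => kap z * corrZ A z).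
Proof.
by apply: ae_eq_cintegral; apply: filterS (corr_ae A) => z ->.
Qed.

Lemma cintegral_corr_bound A (kap : 'rV[R]_d -> R[i]) (b : 'rV[R]_d -> R) :
  in_cLp P 2%:E A -> cmeasurable kap ->
  (forall z, Normc.normc (kap z) <= b z) -> rintegrable leb b ->
  Normc.normc (cintegral leb (fun z => kap z * corr A z)) <=
  4 * (K * (\int[leb]_z b z) * \int[P]_w Normc.normc (A w)).
Proof.
move=> LA mk kb ib; rewrite cintegral_corr.
set a := \int[P]_w _.
have := cintegral_le (mu := leb) (f := fun z => kap z * corrZ A z)
  (g := fun z => (2 * (K * a)) * b z) _ _ (rintegrableZl _ ib).
rewrite RintegralZl//.
rewrite (_ : 4 * _ = 2 * (2 * (K * a) * \int[leb]_z b z)); last by ring.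
apply => [|z]; first by apply: cmeasurableM => //; exact: cmeasurable_corrZ.
rewrite normcM mulrC; apply: ler_pM; rewrite ?normc_ge0//.
exact: corrZ_bound.
Qed.

Lemma ae_shift_rV (Q : 'rV[R]_d -> Prop) x :
  {ae leb, forall z, Q z} -> {ae leb, forall z, Q (z + x)}.
Proof.
move=> [N [mN N0 NQ]]; pose N' := (fun z : 'rV[R]_d => 1 *: z + x) @^-1` N.
exists N'; split.
- by rewrite -[N']setTI; exact: measurable_affine_rV.
- have mN' : measurable N' by rewrite -[N']setTI; exact: measurable_affine_rV.
  have := @ge0_integral_affine_rV R d 1 x (fun z => (\1_N z)%:E) (oner_neq0 R).
  have h1 : measurable_fun setT (fun z => (\1_N z : R)%:E).
    by apply/measurable_EFinP; exact: measurable_indic.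
  have h2 z : (0 <= (\1_N z : R)%:E)%E by rewrite lee_fin.
  move=> /(_ h1 h2) E; rewrite -[N' in LHS]setIT.
  rewrite -(integral_indic leb measurableT mN'); apply: etrans E _.
  have I0 : (\int[leb]_z (\1_N z)%:E = 0)%E.
    by apply: etrans (integral_indic leb measurableT mN) _; rewrite setIT; exact: N0.
  by rewrite [X in (_ * X)%E](_ : _ = 0%E) ?mule0//; exact: I0.
- by move=> z /= h; apply: NQ => /=; rewrite scale1r.
Qed.

Lemma measurable_sub_rV {dT} {T : measurableType dT} (u v : T -> 'rV[R]_d) :
  measurable_fun setT u -> measurable_fun setT v ->
  measurable_fun setT (fun t => u t - v t).
Proof.
move=> mu mv; apply: measurable_fun_rV => i; under eq_fun do rewrite !mxE.
by apply: measurable_funB; apply: (measurableT_comp (measurable_coord_rV i)).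
Qed.

Lemma rintegrable_wgt_shift (M : R) x :
  rintegrable leb (fun z => M * wgt (z - x)).
Proof. exact: (rintegrable_shift_rV (- x) (rintegrable_cwgt M)). Qed.

Lemma cmeasurable_smoothing f : polygauss k s f ->
  cmeasurable (fun p : 'rV[R]_d * Omega => smoothing f p.1 p.2).
Proof.
move=> pf.
apply: (cmeasurable_cintegral leb
  (F := fun q : ('rV[R]_d * Omega) * 'rV[R]_d =>
    fourier f (q.2 - q.1.1) * (Z (q.2, q.1.2))%:C%C)).
have m1 : measurable_fun setT (fun q : ('rV[R]_d * Omega) * 'rV[R]_d => q.1.1).
  exact: (measurableT_comp measurable_fst measurable_fst).
have m2 : measurable_fun setT (fun q : ('rV[R]_d * Omega) * 'rV[R]_d => q.1.2).
  exact: (measurableT_comp measurable_snd measurable_fst).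
have m3 : measurable_fun setT (fun q : ('rV[R]_d * Omega) * 'rV[R]_d => q.2).
  exact: measurable_snd.
apply: cmeasurableM.
  apply: (cmeasurable_comp (cmeasurable_fourier (polygauss_wdom s0 pf).1)).
  exact: measurable_sub_rV.
apply: cmeasurable_real; apply: (measurableT_comp mZ).
exact: measurable_fun_pair.
Qed.

Lemma cmeasurable_smoothing1 f x : polygauss k s f -> cmeasurable (smoothing f x).
Proof.
move=> /cmeasurable_smoothing h.
exact: (cmeasurable_comp h (pair1_measurable x)).
Qed.

Lemma smoothing_kernel f x w (M : R) : polygauss k s f ->
  (forall xi, Normc.normc (fourier f xi) <= M * wgt xi) ->
  cmeasurable (fun z => fourier f (z - x) * (Z (z, w))%:C%C) /\
  forall z, Normc.normc (fourier f (z - x) * (Z (z, w))%:C%C) <= K * M * wgt (z - x).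
Proof.
move=> pf HM; split.
  apply: cmeasurableM.
    apply: (cmeasurable_comp (cmeasurable_fourier (polygauss_wdom s0 pf).1)).
    exact: measurable_sub_rV.
  by apply: cmeasurable_real; exact: (measurableT_comp mZ (pair2_measurable w)).
move=> z; rewrite normcM normc_real mulrC -mulrA.
by apply: ler_pM; rewrite ?normc_ge0.
Qed.

Lemma smoothing_bound f : polygauss k s f -> exists2 M, 0 <= M &
  forall x w, Normc.normc (smoothing f x w) <= M.
Proof.
move=> pf; have [M M0 HM] := fourier_decay1 s0 pf.
exists (2 * \int[leb]_z (K * M * wgt z)).
  by rewrite mulr_ge0//; apply: Rintegral_ge0 => z _; rewrite !mulr_ge0 ?wgt_ge0.
move=> x w; have [m1 b1] := smoothing_kernel x w pf HM.
rewrite -(Rintegral_shift_rV (- x) (rintegrable_cwgt _)).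
exact: cintegral_le b1 (rintegrable_wgt_shift _ _).
Qed.

Lemma L2_smoothing f x : polygauss k s f -> in_cLp P 2%:E (smoothing f x).
Proof.
move=> pf; have [M _ H] := smoothing_bound pf.
exact: L2_bounded (cmeasurable_smoothing1 x pf) (H x).
Qed.

(** Fubini is legitimate because [Z] is measurable on the product. The result is then expressed by
    [corr], which depends on the action alone and not on the chosen version. *)
Lemma inner_smoothing f x A : polygauss k s f -> in_cLp P 2%:E A ->
  inner P A (smoothing f x) =
  cintegral leb (fun z => fourier f (z - x) * corr A z).
Proof.
move=> pf LA; have [M M0 HM] := fourier_decay1 s0 pf.
rewrite cintegral_corr.
pose F (p : Omega * 'rV[R]_d) : R[i] :=
  conjc (A p.1) * (fourier f (p.2 - x) * (Z (p.2, p.1))%:C%C).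
have FE w z : F (w, z) = conjc (A w) * (fourier f (z - x) * (Z (z, w))%:C%C) by [].
have mF : cmeasurable F.
  apply: cmeasurableM.
    apply: cmeasurable_conj; apply: (cmeasurable_comp (L2_meas LA)).
    exact: measurable_fst.
  apply: cmeasurableM.
    apply: (cmeasurable_comp (cmeasurable_fourier (polygauss_wdom s0 pf).1)).
    by apply: measurable_sub_rV => //; exact: measurable_snd.
  apply: cmeasurable_real; apply: (measurableT_comp mZ).
  by apply: measurable_fun_pair; [exact: measurable_snd|exact: measurable_fst].
have FB w z : Normc.normc (F (w, z)) <= Normc.normc (A w) * (K * M * wgt (z - x)).
  rewrite FE normcM normc_conj ler_wpM2l ?normc_ge0//.
  by have [_] := smoothing_kernel x w pf HM.
transitivity (cintegral P (fun w => cintegral leb (fun z => F (w, z)))).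
  apply: eq_cintegral => w; have [m1 b1] := smoothing_kernel x w pf HM.
  by rewrite /smoothing -cintegralZl; [|exact: (cintegrable_le m1 b1 (rintegrable_wgt_shift _ _))].
rewrite (cintegral_Fubini mF FB (L2_integrable LA) (rintegrable_wgt_shift _ _)).
apply: eq_cintegral => z; rewrite /corrZ /inner -cintegralZl.
  by apply: eq_cintegral => w; rewrite FE; ring.
apply: (cintegrable_le _ _ (rintegrableZl K (L2_integrable LA))) => [|w].
  apply: cmeasurableM; first exact/cmeasurable_conj/(L2_meas LA).
  apply: cmeasurable_real; exact: (measurableT_comp mZ (pair1_measurable z)).
by rewrite normcM normc_conj normc_real mulrC ler_wpM2r ?normc_ge0.
Qed.

Lemma corr_stat A x z : in_cLp P 2%:E A ->
  corr (stat tau A (- x)) z = corr A (z + x).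
Proof.
move=> LA; rewrite /corr (inner_stat2 tauP (- x) z LA L2_Yc).
by rewrite opprK.
Qed.

Lemma cintegrable_fourier_corrZ f x A : polygauss k s f -> in_cLp P 2%:E A ->
  cintegrable leb (fun z => fourier f (z - x) * corrZ A z).
Proof.
move=> pf LA; have [M M0 HM] := fourier_decay1 s0 pf.
set a := 2 * (K * \int[P]_w Normc.normc (A w)).
apply: (cintegrable_le _ _ (rintegrable_wgt_shift (a * M) x)) => [|z].
  apply: cmeasurableM; last exact: cmeasurable_corrZ.
  apply: (cmeasurable_comp (cmeasurable_fourier (polygauss_wdom s0 pf).1)).
  exact: measurable_sub_rV.
rewrite normcM mulrC -mulrA; apply: ler_pM; rewrite ?normc_ge0//.
exact: corrZ_bound.
Qed.

(** [stat tau (smoothing f 0) x] and [smoothing f x] are built from values of [Z] at different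
    points, and [Z] is stationary only almost everywhere. They have the same pairings because [corr]
    transforms exactly under translations, by [corr_stat]. *)
Lemma inner_stat_smoothing f x A : polygauss k s f -> in_cLp P 2%:E A ->
  inner P A (stat tau (smoothing f 0) x) =
  cintegral leb (fun z => fourier f (z - x) * corr A z).
Proof.
move=> pf LA; rewrite (inner_stat tauP)//; last exact: L2_smoothing.
have [LA' _] := L2_stat tauP (- x) LA.
rewrite (inner_smoothing 0 pf LA') cintegral_corr.
transitivity (cintegral leb (fun z => fourier f (z + x - x) * corrZ A (z + x))).
  rewrite -cintegral_corr; apply: ae_eq_cintegral.
  apply: filterS (ae_shift_rV x (corr_ae A)) => z <-.
  by rewrite (corr_stat x z LA) addrK subr0.
rewrite (cintegral_shift_rV x (f := fun z => fourier f (z - x) * corrZ A z)).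
  by rewrite -cintegral_corr.
exact: cintegrable_fourier_corrZ.
Qed.

Lemma smoothingZ f x w (c : R) : polygauss k s f ->
  smoothing (fun xi => c * f xi) x w = c%:C%C * smoothing f x w.
Proof.
move=> pf; have [M M0 HM] := fourier_decay1 s0 pf.
have [m1 b1] := smoothing_kernel x w pf HM.
rewrite /smoothing -cintegralZl; last exact: (cintegrable_le m1 b1 (rintegrable_wgt_shift _ _)).
by apply: eq_cintegral => z; rewrite (fourierZ c _ (polygauss_wdom s0 pf)) mulrA.
Qed.

Lemma smoothingD f g x w : polygauss k s f -> polygauss k s g ->
  smoothing (fun xi => f xi + g xi) x w = smoothing f x w + smoothing g x w.
Proof.
move=> pf pg; have [M M0 HM] := fourier_decay1 s0 pf.
have [m1 b1] := smoothing_kernel x w pf HM.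
have [N N0 HN] := fourier_decay1 s0 pg.
have [m2 b2] := smoothing_kernel x w pg HN.
rewrite /smoothing -cintegralD; first last.
- exact: (cintegrable_le m2 b2 (rintegrable_wgt_shift _ _)).
- exact: (cintegrable_le m1 b1 (rintegrable_wgt_shift _ _)).
apply: eq_cintegral => z.
by rewrite (fourierD _ (polygauss_wdom s0 pf) (polygauss_wdom s0 pg)) mulrDl.
Qed.

Lemma smoothing_sum (I : Type) (t : seq I) (f : I -> 'rV[R]_d -> R) x w :
  (forall i, polygauss k s (f i)) ->
  smoothing (fun xi => \sum_(i <- t) f i xi) x w = \sum_(i <- t) smoothing (f i) x w.
Proof.
move=> pf; elim: t => [|i t IHt].
  rewrite big_nil; have p0 := polygauss_gauss k s.
  have := smoothingZ x w 0 p0; rewrite mul0r => <-.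
  by congr (smoothing _ x w); apply/funext => xi; rewrite big_nil mul0r.
have pt : polygauss k s (fun xi => \sum_(i <- t) f i xi).
  elim: t {IHt} => [|i' t IHt].
    exists (fun=> 0); first exact: polyfun_cst.
    by apply/funext => xi; rewrite big_nil mul0r.
  have := polygaussD (pf i') IHt; congr (polygauss k s _).
  by apply/funext => xi; rewrite big_cons.
rewrite big_cons -IHt -(smoothingD x w (pf i) pt).
by congr (smoothing _ x w); apply/funext => xi; rewrite big_cons.
Qed.

Lemma inner_diff_quotient f (a b : R[i]) v g A : polygauss k s f -> polygauss k s g ->
  in_cLp P 2%:E A ->
  inner P A (fun w => a * (stat tau (smoothing f 0) v w - smoothing f 0 w) -
    b * smoothing g 0 w) =
  cintegral leb (fun z => (a * (fourier f (z - v) - fourier f z) - b * fourier g z) *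
    corr A z).
Proof.
move=> pf pg LA; have LF := L2_smoothing 0 pf; have LG := L2_smoothing 0 pg.
have [LFh _] := L2_stat tauP v LF.
have L1 := L2B LFh LF; have L2 := L2Z a L1; have L3 := L2Z b LG.
rewrite (innerBr LA L2 L3) (innerZr _ LA L1) (innerBr LA LFh LF) (innerZr _ LA LG).
have i1 := cintegrable_fourier_corrZ v pf LA.
have i2 := cintegrable_fourier_corrZ 0 pf LA.
have i3 := cintegrable_fourier_corrZ 0 pg LA.
have E1 := inner_stat_smoothing v pf LA; rewrite cintegral_corr in E1.
have E2 := inner_smoothing 0 pf LA; rewrite cintegral_corr in E2.
have E3 := inner_smoothing 0 pg LA; rewrite cintegral_corr in E3.
have i12 := cintegrableB i1 i2; have i12' := cintegrableZl a i12.
have i3' := cintegrableZl b i3.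
have E12 := cintegralB i1 i2; have E12' := cintegralZl a i12.
have E3' := cintegralZl b i3.
have E := etrans (cintegralB i12' i3') (congr2 (fun x y : R[i] => x - y)
  (etrans E12' (congr1 (fun x : R[i] => a * x) E12)) E3').
apply: (etrans (congr2 (fun x y : R[i] => x - y) (congr1 (fun x : R[i] => a * x)
  (congr2 (fun x y : R[i] => x - y) E1 E2)) (congr1 (fun x : R[i] => b * x) E3))).
apply: (etrans (esym E)); rewrite cintegral_corr.
apply: eq_cintegral => z; rewrite subr0.
move: (fourier f _) (fourier f z) (fourier g z) (corrZ A z) => u1 u2 u3 u4.
ring.
Qed.

(** Paired with [A], the error of the difference quotient is the integral of [corr A] against a
    kernel of size [|h| * wgt], hence at most [N * |h|] times the L^1 norm of [A]; [cLnorm2_dual]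
    turns this into a bound on its L^2 norm. The scalar [c] allows the lemma to be applied to its
    own output for second derivatives. *)
Lemma stat_deriv_smoothing f (c : R[i]) j : polygauss k s f ->
  stat_deriv P tau j (fun w => c * smoothing f 0 w)
    (fun w => c * 'i%C * smoothing (fun xi => xi ord0 j * f xi) 0 w).
Proof.
move=> pf; have pf' := polygauss_coord j pf.
have LF := L2_smoothing 0 pf; have LF' := L2_smoothing 0 pf'.
split; [exact: L2Z|exact: L2Z|].
have [C' C0 HC] := fourier_diff_quotient s0 j pf; pose C : R := C'.
pose W := \int[leb]_z (wgt z : R).
have W0 : 0 <= W by apply: Rintegral_ge0 => z _; exact: wgt_ge0.
pose N : R := Normc.normc c * (4 * (K * (C * W))).
have N0 : 0 <= N by rewrite !mulr_ge0// normc_ge0.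
pose X (h : R) (w : Omega) : R[i] :=
  (h^-1)%:C%C * (stat tau (fun w => c * smoothing f 0 w) (h *: basis_vec R j) w -
      c * smoothing f 0 w) - c * 'i%C * smoothing (fun xi => xi ord0 j * f xi) 0 w.
have H (h : R) : h != 0 -> `|h| <= 1 -> (cLnorm P 2%:E (X h) <= (N * `|h|)%:E)%E.
  move=> h0 h1; set v := h *: basis_vec R j.
  have [LFh _] := L2_stat tauP v LF.
  have E : X h = (fun w => c * ((h^-1)%:C%C *
    (stat tau (smoothing f 0) v w - smoothing f 0 w) -
    'i%C * smoothing (fun xi => xi ord0 j * f xi) 0 w)).
    apply/funext => w; rewrite /X /stat -/v.
    have key (a u1 u2 u3 : R[i]) :
      a * (c * u1 - c * u2) - c * 'i%C * u3 = c * (a * (u1 - u2) - 'i%C * u3) by ring.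
    exact: key.
  have L4 := L2B (L2Z (h^-1)%:C%C (L2B LFh LF)) (L2Z 'i%C LF').
  rewrite E; apply: cLnorm2_dual; [exact: L2Z|exact: mulr_ge0|] => A LA.
  rewrite (innerZr _ LA L4) (inner_diff_quotient _ _ _ pf pf' LA).
  pose kap z := (h^-1)%:C%C * (fourier f (z - v) - fourier f z)
    - 'i%C * fourier (fun x => x ord0 j * f x) z.
  rewrite -/kap.
  have mF := cmeasurable_fourier (polygauss_wdom s0 pf).1.
  have mF' := cmeasurable_fourier (polygauss_wdom s0 pf').1.
  have mkap : cmeasurable kap.
    have Ek : kap = (fun z => (h^-1)%:C%C * (fourier f (z - v) + (-1) * fourier f z)
      + (- 'i%C) * fourier (fun x => x ord0 j * f x) z).
      by apply/funext => z; rewrite /kap mulN1r mulNr.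
    rewrite Ek; apply: cmeasurableD; apply: cmeasurableM => //; try exact: cmeasurable_cst.
    apply: cmeasurableD.
      by apply: (cmeasurable_comp mF); exact: measurable_sub_rV.
    by apply: cmeasurableM => //; exact: cmeasurable_cst.
  have kapb z : Normc.normc (kap z) <= C * `|h| * wgt z by exact: (HC h z h0 h1).
  have := cintegral_corr_bound LA mkap kapb (rintegrable_cwgt _).
  rewrite RintegralZl//; last first.
    by have := rintegrable_cwgt (R := R) (d := d) 1; under eq_fun do rewrite mul1r.
  rewrite normcM -/W => hb.
  have := ler_wpM2l (normc_ge0 c) hb; move=> /le_trans; apply.
  by rewrite /N le_eqVlt; apply/orP; left; apply/eqP; ring.
change (cLnorm P 2%:E (X h) @[h --> 0^'] --> 0%E).
apply: (@squeeze_cvge _ _ _ _ (fun=> 0%E) _ (fun h : R => (N * `|h|)%:E)).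
- near=> h; rewrite Lnorm_ge0/=; apply: H; first by near: h; exact: nbhs_dnbhs_neq.
  by near: h; apply: dnbhs0_le.
- exact: cvg_cst.
- apply: cvg_EFin; first exact: nearW.
  rewrite -[X in _ --> X](mulr0 N); apply: cvgM; first exact: cvg_cst.
  rewrite -[X in _ --> X](@normr0 _ R); apply: cvg_norm; exact: nbhs_dnbhs.
Unshelve. all: end_near.
Qed.
(** Each D_j acts on [f] as multiplication by i times [xi_j]. The two factors i in each term of the
    operator combine to -1 and give the nonnegative sign of [xi_j^2] and the factor [2 k_j xi_j] of
    the symbol. *)
Lemma is_H0_smoothing f : polygauss k s f ->
  is_H0 P tau k (smoothing f 0) (smoothing (fun xi => symb k xi * f xi) 0).
Proof.
move=> pf; have pf1 j := polygauss_coord j pf; have pf2 j := polygauss_coord j (pf1 j).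
exists (fun j w => 1 * 'i%C * smoothing (fun xi => xi ord0 j * f xi) 0 w).
exists (fun j w => 1 * 'i%C * 'i%C *
  smoothing (fun xi => xi ord0 j * (xi ord0 j * f xi)) 0 w); split.
- move=> j; have := stat_deriv_smoothing 1 j pf; congr (stat_deriv P tau j _ _).
  by apply/funext => w; rewrite mul1r.
- by move=> j; exact: stat_deriv_smoothing.
apply/funext => w.
pose G (j : 'I_d) (xi : 'rV[R]_d) : R :=
  xi ord0 j * (xi ord0 j * f xi) + (2 * k ord0 j) * (xi ord0 j * f xi).
have pG2 j : polygauss k s (fun xi => (2 * k ord0 j) * (xi ord0 j * f xi)).
  by apply: polygaussM (pf1 j); exact: polyfun_cst.
have pG j : polygauss k s (G j) by exact: polygaussD.
rewrite (_ : (fun xi => symb k xi * f xi) = (fun xi => \sum_(j < d) G j xi)); last first.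
  apply/funext => xi; rewrite /symb mulr_suml; apply: eq_bigr => j _.
  by rewrite /G mulrDl !mulrA.
rewrite (smoothing_sum _ _ _ pG) mulr_sumr -sumrN -sumrB; apply: eq_bigr => j _.
rewrite (smoothingD 0 w (pf2 j) (pG2 j)) (smoothingZ 0 w _ (pf1 j)).
move: (smoothing _ 0 w) (smoothing _ 0 w) => u1 u2.
have ii : 'i%C * 'i%C = -1 :> R[i] by rewrite -expr2 sqr_i.
rewrite mul1r ii mulN1r opprK; congr (_ + _).
rewrite (_ : (2 * k ord0 j)%:C%C = 2%:R * (k ord0 j)%:C%C); last first.
  by rewrite rmorphM/= rmorph_nat.
have E (i2 kj : R[i]) : - (2%:R * i2 * (kj * (i2 * u1))) = - (i2 * i2) * (2%:R * kj * u1) by ring.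
by rewrite E ii opprK mul1r.
Qed.

(** The head index is multiplied innermost, matching [integral_by_parts], which removes the head
    derivative and passes the new factor to the remaining ones. *)
Fixpoint coord_mul (t : seq 'I_d) f : 'rV[R]_d -> R :=
  match t with
  | [::] => f
  | j :: t' => coord_mul t' (fun xi => xi ord0 j * f xi)
  end.

Lemma polygauss_coord_mul t f : polygauss k s f -> polygauss k s (coord_mul t f).
Proof. by elim: t f => //= j t IHt f pf; apply: IHt; exact: polygauss_coord. Qed.

Lemma L2loc_smoothing f (c : R[i]) : polygauss k s f ->
  L2loc P (fun x w => c * smoothing f x w).
Proof.
move=> pf; split.
  by apply: cmeasurableM; [exact: cmeasurable_cst|exact: cmeasurable_smoothing].
move=> K' cK'; have [M M0 HM] := smoothing_bound pf.
(* Applied to the constant 1, the bound [1 <= N * wgt x] on the compact set stands for the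
   finiteness of its volume. *)
have [N N0 HN] := compact_wgt_bound cK' (g := fun=> 1 : R) (fun x => cvg_cst _).
pose B := Normc.normc c * M; have B0 : 0 <= B by rewrite mulr_ge0// normc_ge0.
rewrite integral_mkcond; apply: (@le_lt_trans _ _ (\int[leb]_x (B ^+ 2 * N * wgt x)%:E)%E).
  apply: le_integral_nomeas => [x|x]; rewrite /patch; case: ifPn => //.
  - by move=> _; apply: integral_ge0 => w _; rewrite lee_fin sqr_ge0.
  - rewrite inE => Kx; apply: (@le_trans _ _ (\int[P]_w (B ^+ 2)%:E)%E).
      apply: le_integral_nomeas => w; rewrite lee_fin ?sqr_ge0//.
      rewrite lerXn2r ?nnegrE ?normc_ge0// normcM.
      by apply: ler_wpM2l; [exact: normc_ge0|exact: HM].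
    rewrite integral_cst//= probability_setT mule1 lee_fin -mulrA ler_peMr ?sqr_ge0//.
    by have := le_sqr_wgt N0 (HN x Kx); rewrite normr1.
  - by move=> _; change ((0 : R)%:E <= (B ^+ 2 * N * wgt x)%:E)%E;
      rewrite lee_fin; apply: mulr_ge0 (wgt_ge0 _); exact: mulr_ge0 (sqr_ge0 _) N0.
rewrite (rintegrable_fin (rintegrable_cwgt _)); exact: ltry.
Qed.

Lemma corrZ_bounded A : in_cLp P 2%:E A -> exists2 a : R, 0 <= a &
  forall z, Normc.normc (corrZ A z) <= a.
Proof.
move=> LA; have h z := corrZ_bound z LA.
by exists (2 * (K * \int[P]_w Normc.normc (A w))) => //; exact: (le_trans (normc_ge0 _) (h 0)).
Qed.

(** [corrZ] is merely measurable and cannot be differentiated. After exchanging the integrals, [x]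
    enters only through the test function and the smooth kernel, so one integrates by parts in [x]
    for each fixed [z] and exchanges back. *)
Lemma integral_by_parts f j t (chi : 'rV[R]_d -> R) A : polygauss k s f ->
  test_function chi -> in_cLp P 2%:E A ->
  cintegral leb (fun x => (iter_pderiv (j :: t) chi x)%:C%C *
    cintegral leb (fun z => fourier f (z - x) * corrZ A z)) =
  - 'i%C * cintegral leb (fun x => (iter_pderiv t chi x)%:C%C *
    cintegral leb (fun z => fourier (fun xi => xi ord0 j * f xi) (z - x) * corrZ A z)).
Proof.
move=> pf tc LA.
have swap g t' : polygauss k s g ->
    cintegral leb (fun x => (iter_pderiv t' chi x)%:C%C *
      cintegral leb (fun z => fourier g (z - x) * corrZ A z)) =
    cintegral leb (fun z => corrZ A z *
      cintegral leb (fun x => (iter_pderiv t' chi x)%:C%C * fourier g (z - x))) /\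
    cintegrable leb (fun z => corrZ A z *
      cintegral leb (fun x => (iter_pderiv t' chi x)%:C%C * fourier g (z - x))).
  move=> pg.
  have [N N0 HN] := test_function_bound t' tc.
  have [M M0 HM] := fourier_decay1 s0 pg.
  have mt := test_function_meas t' tc.
  have [a a0 aA] := corrZ_bounded LA.
  pose F (p : 'rV[R]_d * 'rV[R]_d) : R[i] :=
    (iter_pderiv t' chi p.1)%:C%C * (fourier g (p.2 - p.1) * corrZ A p.2).
  have mF : cmeasurable F.
    apply: cmeasurableM.
      by apply: cmeasurable_real; apply: (measurableT_comp mt); exact: measurable_fst.
    apply: cmeasurableM.
      apply: (cmeasurable_comp (cmeasurable_fourier (polygauss_wdom s0 pg).1)).
      by apply: measurable_sub_rV.
    by apply: (cmeasurable_comp (cmeasurable_corrZ LA)); exact: measurable_snd.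
  pose c := N * M * 2 ^+ d * a.
  have FB x z : Normc.normc (F (x, z)) <= (c * wgt x) * wgt z.
    rewrite /F !normcM normc_real.
    (* One of the two powers of [wgt x] is spent on turning [wgt (z - x)] into [wgt z] by [wgt_mul];
       the other keeps the majorant integrable in [x]. *)
    apply: (@le_trans _ _ ((N * wgt x ^+ 2) * ((M * wgt (z - x)) * a))).
      apply: ler_pM => //; first by rewrite mulr_ge0 ?normc_ge0.
      by apply: ler_pM => //; exact: normc_ge0.
    have wm := wgt_mul x (z - x); rewrite (addrC x) subrK in wm.
    have -> : N * wgt x ^+ 2 * (M * wgt (z - x) * a) =
      N * M * a * wgt x * (wgt x * wgt (z - x)) by ring.
    have -> : c * wgt x * wgt z = N * M * a * wgt x * (2 ^+ d * wgt z) by rewrite /c; ring.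
    by apply: ler_wpM2l => //; rewrite !mulr_ge0 ?wgt_ge0.
  have iw := @rintegrable_wgt R d.
  have ix x : cintegrable leb (fun z => fourier g (z - x) * corrZ A z).
    exact: cintegrable_fourier_corrZ.
  have iz z : cintegrable leb (fun x => (iter_pderiv t' chi x)%:C%C * fourier g (z - x)).
    apply: (cintegrable_le _ _ (rintegrable_cwgt (N * M))) => [|x].
      apply: cmeasurableM; first exact: cmeasurable_real.
      apply: (cmeasurable_comp (cmeasurable_fourier (polygauss_wdom s0 pg).1)).
      exact: measurable_sub_rV.
    rewrite normcM normc_real mulrAC; apply: ler_pM => //; rewrite ?normc_ge0//.
      exact: le_sqr_wgt.
    by apply: (le_trans (HM _)); rewrite ler_piMr// wgt_le1.
  have E1 z : corrZ A z *
      cintegral leb (fun x => (iter_pderiv t' chi x)%:C%C * fourier g (z - x)) =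
    cintegral leb (fun x => F (x, z)).
    rewrite -(cintegralZl _ (iz z)); apply: eq_cintegral => x.
    by rewrite [LHS]mulrC -mulrA.
  split.
    transitivity (cintegral leb (fun x => cintegral leb (fun z => F (x, z)))).
      by apply: eq_cintegral => x; rewrite -cintegralZl.
    rewrite (cintegral_Fubini mF FB (rintegrable_cwgt c) iw).
    by apply: eq_cintegral => z; rewrite E1.
  rewrite (_ : (fun z => _) = (fun z => cintegral leb (fun x => F (x, z)))); last first.
    by apply/funext => z; rewrite E1.
  apply: (cintegrable_cintegral (F := fun p => F (p.2, p.1)) _ _ iw (rintegrable_cwgt c)).
    apply: (cmeasurable_comp mF).
    by apply: measurable_fun_pair; [exact: measurable_snd|exact: measurable_fst].
  by move=> z x; rewrite mulrC; exact: FB.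
have pf' := polygauss_coord j pf.
have [E1 _] := swap f (j :: t) pf; have [E2 i2] := swap _ t pf'.
apply: (etrans E1); apply/esym.
apply: (etrans (congr1 (fun u : R[i] => - 'i%C * u) E2)); apply/esym.
rewrite -(cintegralZl _ i2).
apply: eq_cintegral => z; rewrite [RHS]mulrCA; congr (_ * _) => {swap E1 E2 i2}.
have [N N0 HN] := test_function_bound t tc.
have [N' N'0 HN'] := test_function_bound (j :: t) tc.
apply: (@fourier_by_parts _ _ k s s0 f j _ _ (N + N') z pf).
- exact: test_function_meas.
- exact: test_function_meas.
- by move=> x; exact: test_function_is_derive.
- move=> x; apply: (le_trans (le_sqr_wgt N0 (HN x))).
  by apply: ler_wpM2r; rewrite ?wgt_ge0// lerDl.
- move=> x; apply: (le_trans (le_sqr_wgt N'0 (HN' x))).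
  by apply: ler_wpM2r; rewrite ?wgt_ge0// lerDr.
Qed.

Lemma weak_deriv_smoothing f t (chi : 'rV[R]_d -> R) A : polygauss k s f ->
  test_function chi -> in_cLp P 2%:E A ->
  cintegral leb (fun x => (iter_pderiv t chi x)%:C%C *
    inner P A (stat tau (smoothing f 0) x)) =
  (-1) ^+ size t * cintegral leb (fun x => (chi x)%:C%C *
    inner P A (fun w => 'i%C ^+ size t * smoothing (coord_mul t f) x w)).
Proof.
move=> pf tc LA.
transitivity (cintegral leb (fun x => (iter_pderiv t chi x)%:C%C *
    cintegral leb (fun z => fourier f (z - x) * corrZ A z))).
  apply: eq_cintegral => x; rewrite -cintegral_corr; congr (_ * _).
  exact: inner_stat_smoothing.
transitivity ((- 'i%C) ^+ size t * cintegral leb (fun x => (chi x)%:C%C *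
    cintegral leb (fun z => fourier (coord_mul t f) (z - x) * corrZ A z))).
  elim: t f pf => [|j t IHt] f pf; first by rewrite expr0 mul1r.
  apply: (etrans (integral_by_parts j t pf tc LA)).
  have E := IHt _ (polygauss_coord j pf).
  apply: (etrans (congr1 (fun u : R[i] => - 'i%C * u) E)).
  by rewrite mulrA -exprS.
have pt := polygauss_coord_mul t pf.
rewrite -[- 'i%C]mulN1r exprMn -mulrA; congr (_ * _).
have [N N0 HN] := test_function_bound [::] tc.
have [M M0 HM] := fourier_decay1 s0 pt.
rewrite -cintegralZl.
  apply: eq_cintegral => x; rewrite mulrCA; congr (_ * _).
  by rewrite (innerZr _ LA (L2_smoothing x pt)) (inner_smoothing x pt LA) cintegral_corr.
have [a a0 aA] := corrZ_bounded LA.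
pose W := \int[leb]_z (wgt z : R).
have m1 : cmeasurable (fun x => cintegral leb
    (fun z => fourier (coord_mul t f) (z - x) * corrZ A z)).
  apply: (cmeasurable_cintegral leb (F := fun p : 'rV[R]_d * 'rV[R]_d =>
    fourier (coord_mul t f) (p.2 - p.1) * corrZ A p.2)).
  apply: cmeasurableM.
    apply: (cmeasurable_comp (cmeasurable_fourier (polygauss_wdom s0 pt).1)).
    by apply: measurable_sub_rV.
  by apply: (cmeasurable_comp (cmeasurable_corrZ LA)); exact: measurable_snd.
apply: (cintegrable_le _ _ (rintegrable_cwgt (N * (2 * (a * M * W))))) => [|x].
  apply: cmeasurableM => //; apply: cmeasurable_real; exact: (test_function_meas [::]).
rewrite normcM normc_real mulrAC; apply: ler_pM => //; rewrite ?normc_ge0//.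
  exact: (le_sqr_wgt N0 (HN x)).
have iw := @rintegrable_wgt R d.
rewrite /W -(Rintegral_shift_rV (- x) iw) -RintegralZl//; last exact: rintegrable_shift_rV.
apply: cintegral_le => [|z|].
- exact: (cintegrable_meas (cintegrable_fourier_corrZ x pt LA)).
- by rewrite normcM mulrC -mulrA; apply: ler_pM; rewrite ?normc_ge0.
- exact: rintegrable_wgt_shift.
Qed.

Lemma H2_smoothing f : polygauss k s f -> H2 P tau (smoothing f 0).
Proof.
move=> pf; split; first exact: L2_smoothing.
move=> t _; exists (fun x w => 'i%C ^+ size t * smoothing (coord_mul t f) x w).
  by apply: L2loc_smoothing; exact: polygauss_coord_mul.
by move=> chi A tc LA; exact: weak_deriv_smoothing.
Qed.

(** The substitute for the spectral isometry. By stationarity the squared norm is a double integral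
    of [fourier f z] and the conjugates of [fourier f (z + y)] and of the correlation of [Y] at [y];
    integrating in [z] first leaves the transform of [f ^+ 2] against that correlation. *)
Lemma sqn_smoothing f : polygauss k s f ->
  (sqn P (smoothing f 0))%:C%C = fourier_const k *
    conjc (cintegral leb (fun y => fourier (fun xi => f xi ^+ 2) y * corr Yc y)).
Proof.
move=> pf; have LS := L2_smoothing 0 pf; have LY := L2_Yc.
have [M M0 HM] := fourier_decay s0 pf.
have [M' M'0 HM'] := fourier_decay1 s0 pf.
have [a a0 aY] := corrZ_bounded LY.
have mf := cmeasurable_fourier (polygauss_wdom s0 pf).1.
have mc := cmeasurable_corrZ LY.
have E z : corr (smoothing f 0) z =
    conjc (cintegral leb (fun y => fourier f (z + y) * corrZ Yc y)).
  have [LYz _] := L2_stat tauP z LY.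
  apply: (etrans (inner_conj LYz LS)); congr conjc.
  apply: (etrans (inner_smoothing 0 pf LYz)).
  have i1 := cintegrable_fourier_corrZ (- z) pf LY.
  apply: (etrans _ (etrans (cintegral_shift_rV (- z) i1) _)).
    apply: ae_eq_cintegral; apply: filterS (ae_shift_rV (- z) (corr_ae Yc)) => y <-.
    have := corr_stat (- z) y LY; rewrite opprK => ->.
    by rewrite subr0 subrK.
  by apply: eq_cintegral => y; rewrite opprK addrC.
rewrite -inner_sqn (inner_smoothing 0 pf LS).
pose F (p : 'rV[R]_d * 'rV[R]_d) : R[i] :=
  fourier f p.1 * (conjc (fourier f (p.1 + p.2)) * conjc (corrZ Yc p.2)).
have mF : cmeasurable F.
  apply: cmeasurableM.
    by apply: (cmeasurable_comp mf); exact: measurable_fst.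
  apply: cmeasurableM; apply: cmeasurable_conj.
    apply: (cmeasurable_comp mf); apply: measurable_fun_rV => i.
    under eq_fun do rewrite mxE; apply: measurable_funD.
      exact: (measurableT_comp (measurable_coord_rV i) measurable_fst).
    exact: (measurableT_comp (measurable_coord_rV i) measurable_snd).
  by apply: (cmeasurable_comp mc); exact: measurable_snd.
have FB z y : Normc.normc (F (z, y)) <= (M * M' * 2 ^+ d * a * wgt z) * wgt y.
  rewrite /F !normcM !normc_conj.
  have wm := wgt_mul (- z) (z + y); rewrite wgtN addKr in wm.
  apply: (@le_trans _ _ ((M * wgt z ^+ 2) * ((M' * wgt (z + y)) * a))).
    apply: ler_pM => //; rewrite ?normc_ge0 ?mulr_ge0 ?normc_ge0//.
    by apply: ler_pM => //; rewrite normc_ge0.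
  have -> : M * wgt z ^+ 2 * (M' * wgt (z + y) * a) =
    M * M' * a * wgt z * (wgt z * wgt (z + y)) by ring.
  have -> : M * M' * 2 ^+ d * a * wgt z * wgt y =
    M * M' * a * wgt z * (2 ^+ d * wgt y) by ring.
  by apply: ler_wpM2l wm; rewrite !mulr_ge0 ?wgt_ge0.
have iw := @rintegrable_wgt R d.
transitivity (cintegral leb (fun z => cintegral leb (fun y => F (z, y)))).
  apply: eq_cintegral => z; rewrite E subr0.
  have i2 := cintegrable_fourier_corrZ (- z) pf LY.
  have i3 : cintegrable leb (fun y => fourier f (z + y) * corrZ Yc y).
    by move: i2; congr (cintegrable leb _); apply/funext => y; rewrite opprK addrC.
  rewrite -(cintegral_conj i3) -(cintegralZl _ (cintegrable_conj i3)).
  by apply: eq_cintegral => y; rewrite conjcM.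
rewrite (cintegral_Fubini mF FB (rintegrable_cwgt _) iw) cintegral_corr.
have pf2 := polygauss_sqr pf; have ss0 : 0 < s + s by exact: addr_gt0.
have [N N0 HN] := fourier_decay1 ss0 pf2.
have m2 := cmeasurable_fourier (polygauss_wdom ss0 pf2).1.
have i4 : cintegrable leb (fun y => fourier (fun xi => f xi ^+ 2) y * corrZ Yc y).
  apply: (cintegrable_le _ _ (rintegrable_cwgt (N * a))) => [|y].
    exact: cmeasurableM.
  by rewrite normcM mulrAC; apply: ler_pM; rewrite ?normc_ge0.
rewrite -(cintegral_conj i4) -(cintegralZl _ (cintegrable_conj i4)).
apply: eq_cintegral => y; rewrite conjcM mulrA -(fourier_autocorrelation y s0 pf).
rewrite mulrC -cintegralZl.
  by apply: eq_cintegral => z; rewrite /F mulrA mulrC.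
apply: (cintegrable_le _ _ (rintegrable_cwgt (M' * M'))) => [|z].
  apply: cmeasurableM => //; apply: cmeasurable_conj; apply: (cmeasurable_comp mf).
  apply: measurable_fun_rV => i; under eq_fun do rewrite mxE.
  by apply: measurable_funD => //; exact: measurable_coord_rV.
rewrite normcM normc_conj mulrAC; apply: ler_pM; rewrite ?normc_ge0//.
by apply: (le_trans (HM' _)); rewrite ler_piMr// wgt_le1.
Qed.

End smoothing.

(** * First-order expansion and the shell estimate *)

Section limits.
Context {disp : measure_display} {Omega : measurableType disp} {R : realType}.

(** The majorant is replaced by its maximum with the modulus of [f], which alters it on a null set
    only and makes the bound hold everywhere. *)
Lemma cintegral_le_ae (mu : {measure set Omega -> \bar R}) (f : Omega -> R[i])
    (g : Omega -> R) : cmeasurable f -> {ae mu, forall x, Normc.normc (f x) <= g x} ->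
  rintegrable mu g -> Normc.normc (cintegral mu f) <= 2 * \int[mu]_x g x.
Proof.
move=> mf fg ig; pose g' x := Num.max (g x) (Normc.normc (f x)).
have mg' : measurable_fun setT g'.
  by apply: measurable_maxr; [exact: rintegrable_meas ig|exact: measurable_normc].
have gg' : {ae mu, forall x, g x = g' x}.
  by apply: filterS fg => x h; rewrite /g' max_l.
have ig' : rintegrable mu g'.
  have [_ gi] := integrableP _ _ _ ig.
  apply/integrableP; split; first exact/measurable_EFinP.
  have E : {ae mu, forall x, `|(EFin \o g) x|%E = `|(EFin \o g') x|%E}.
    by apply: filterS gg' => x /= ->.
  by rewrite -(ae_eq_integral_nomeas E).
rewrite (ae_eq_Rintegral gg'); apply: cintegral_le => // x.
by rewrite /g' le_max lexx orbT.
Qed.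

Variable P : probability Omega R.
Implicit Types f g : Omega -> R[i].

Lemma normc_inner_sqrt f g : in_cLp P 2%:E f -> in_cLp P 2%:E g ->
  Normc.normc (inner P f g) <= 2 * (Num.sqrt (sqn P f) * Num.sqrt (sqn P g)).
Proof.
move=> Lf Lg; have h := normc_inner Lf Lg.
rewrite -(@ler_pXn2r _ 2)// ?nnegrE ?normc_ge0 ?mulr_ge0 ?sqrtr_ge0//.
rewrite (_ : (2 * _) ^+ 2 = 4 * (Num.sqrt (sqn P f) ^+ 2 * Num.sqrt (sqn P g) ^+ 2)).
  by rewrite (sqr_sqrtr (sqn_ge0 P f)) (sqr_sqrtr (sqn_ge0 P g)).
by ring.
Qed.

Lemma ccvg_normc (u : nat -> R[i]) (l : R[i]) (r : nat -> R) :
  (forall n, Normc.normc (u n - l) <= r n) -> r n @[n --> \oo] --> 0 -> ccvg u l.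
Proof.
move=> ur r0.
have h (v : nat -> R) (a : R) : (forall n, `|v n - a| <= r n) -> v n @[n --> \oo] --> a.
  move=> va; apply/subr_cvg0/norm_cvg0P.
  apply: (@squeeze_cvgr _ _ _ _ (fun=> 0) r) r0; last exact: cvg_cst.
  by near=> n; rewrite normr_ge0 va.
split; apply: h => n; apply: le_trans (ur n).
- case: (u n) (l) => a b [c e]; exact: (Re_le_normc ((a - c) +i* (b - e))%C).
- case: (u n) (l) => a b [c e]; exact: (Im_le_normc ((a - c) +i* (b - e))%C).
Unshelve. all: end_near.
Qed.

Lemma ccvgD (u v : nat -> R[i]) (l m : R[i]) :
  ccvg u l -> ccvg v m -> ccvg (fun n => u n + v n) (l + m).
Proof.
move=> [u1 u2] [v1 v2]; split.
- by rewrite ReD; under eq_fun do rewrite ReD; exact: cvgD.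
- by rewrite ImD; under eq_fun do rewrite ImD; exact: cvgD.
Qed.

Lemma ccvg_inner f g (q : nat -> Omega -> R[i]) : in_cLp P 2%:E f ->
  in_cLp P 2%:E g -> (forall n, in_cLp P 2%:E (q n)) ->
  cLnorm P 2%:E (fun w => q n w - g w) @[n --> \oo] --> 0%E ->
  ccvg (fun n => inner P f (q n)) (inner P f g).
Proof.
move=> Lf Lg Lq qg; have Ld n := L2B (Lq n) Lg.
apply: (@ccvg_normc _ _ (fun n => 2 * (Num.sqrt (sqn P f) *
    Num.sqrt (sqn P (fun w => q n w - g w))))) => [n|].
  by rewrite -(innerBr Lf (Lq n) Lg); exact: normc_inner_sqrt.
have qg' : Num.sqrt (sqn P (fun w => q n w - g w)) @[n --> \oo] --> (0 : R).
  apply: (@fine_cvg _ _ _ _ (fun n => (Num.sqrt (sqn P (fun w => q n w - g w)))%:E)).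
  by move: qg; under eq_fun do rewrite (cLnorm2E (Ld _)).
rewrite -[X in _ --> X](mulr0 2); apply: cvgM; first exact: cvg_cst.
rewrite -[X in _ --> X](mulr0 (Num.sqrt (sqn P f))).
by apply: cvgM qg'; exact: cvg_cst.
Qed.

End limits.

Lemma Lfun2_cLp (disp : measure_display) (Omega : measurableType disp) (R : realType)
    (P : probability Omega R) (V : Omega -> R) : V \in Lfun P 2%:E ->
  measurable_fun setT V /\ in_cLp P 2%:E (fun w => (V w)%:C%C).
Proof.
move=> VL.
have mV : measurable_fun setT V by have := sub_Lfun_mfun VL; rewrite inE.
split=> //; split; first exact: cmeasurable_real.
have := sub_Lfun_finLfun VL; rewrite inE /= /finite_norm -Lnorm_abse.
by congr (_ < _)%E; congr Lnorm; apply/funext => w; rewrite normc_real.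
Qed.

Lemma scale_Rcomplex (R : realType) (a : R) (z : R[i]) :
  a *: (z : Rcomplex R) = a%:C%C * z.
Proof. by case: z => x y; apply: complex_eqP; rewrite ?ReZ ?ImZ. Qed.

(** * Differentiation of the eigenvalue equation at 0 *)

Section first_order.
Context {R : realType} {d : nat} {disp : measure_display}
  {Omega : measurableType disp}.
Variables (P : probability Omega R) (tau : 'rV[R]_d -> Omega -> Omega).
Variables (k : 'rV[R]_d) (V : Omega -> R) (delta : R).
Hypothesis delta_gt0 : 0 < delta.
Local Notation I := `[0, delta[%classic.
Local Notation Vc := (fun w => (V w)%:C%C).

(** The denominator starts at 2 so that the first step already lies strictly below the excluded end
    point [delta]. *)
Definition small_step (n : nat) : R := delta / n.+2%:R.

Lemma small_step_gt0 n : 0 < small_step n.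
Proof. by rewrite divr_gt0. Qed.

Lemma small_step_in n : I (small_step n).
Proof.
rewrite /= in_itv/= (ltW (small_step_gt0 n))/= ltr_pdivrMr// ltr_pMr//.
by rewrite ltr1n.
Qed.

Lemma cvg_small_step : small_step n @[n --> \oo] --> (0 : R).
Proof.
rewrite -[X in _ --> X](mulr0 delta); apply: cvgM; first exact: cvg_cst.
by have := @cvg_harmonic R; rewrite -(cvg_shiftS (@harmonic R)).
Qed.

Lemma small_step_within : small_step n @[n --> \oo] --> within I (0 : R)^'.
Proof.
move=> A /= [e e0 eA].
have /cvgrPdist_lt /(_ _ e0) h := cvg_small_step.
apply: filterS h => n hn; apply: (eA (small_step n) hn).
  by rewrite gt_eqF// small_step_gt0.
exact: small_step_in.
Qed.

Lemma derivative_on_small_step (X : lmodType R) (N : X -> \bar R) (f f' : R -> X) :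
  derivative_on N I f f' ->
  N ((small_step n)^-1 *: (f (small_step n) - f 0) - f' 0) @[n --> \oo] --> 0%E.
Proof.
have I0 : I 0 by rewrite /= in_itv/= lexx.
move=> /(_ _ I0) h; have := cvg_comp _ _ small_step_within h.
by under eq_fun do rewrite subr0.
Qed.

(** The equation at [lambda] minus the equation at 0 is divided by [lambda] along a sequence of
    steps. Every pairing then converges, because the difference quotients of the branch converge in
    L^2(Omega) and are paired with fixed elements of L^2(Omega). *)
Lemma first_order (E : R -> R) (psi : R -> Omega -> R[i]) :
  V \in Lfun P 2%:E ->
  class_C2_on (X := R^o) setT (fun x : R => `|x|%:E) I E ->
  class_C2_on (X := Omega -> Rcomplex R) (in_cLp P 2%:E) (cLnorm P 2%:E) I psi ->
  (forall lam, lam \in `[0, delta[ ->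
    eigen_equation P tau k V lam (E lam) (psi lam)) ->
  E 0 = 0 -> {ae P, forall w, psi 0 w = 1} ->
  exists (E' : R) (psi' : Omega -> R[i]), in_cLp P 2%:E psi' /\
    forall (phi H0phi : Omega -> R[i]) (M : R), H2 P tau phi ->
      cmeasurable phi -> (forall w, Normc.normc (phi w) <= M) ->
      in_cLp P 2%:E H0phi -> is_H0 P tau k phi H0phi ->
      inner P H0phi psi' + inner P phi Vc = E'%:C%C * inner P phi (fun=> 1).
Proof.
move=> VL [E1 [E2 [_ dE _ _]]] [psi1 [psi2 [Sp dp _ _]]] eig E0 psi0.
have [mV LV] := Lfun2_cLp VL.
exists (E1 0), (psi1 0).
have I0 : I 0 by rewrite /= in_itv/= lexx.
have Lp n : in_cLp P 2%:E (psi (small_step n)) by have [] := Sp _ (small_step_in n).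
have [Lp0 Lp1 _] := Sp _ I0.
split=> // phi H0phi M H2phi mphi phiM LH isH.
have Lphi : in_cLp P 2%:E phi := L2_bounded P mphi phiM.
pose q n (w : Omega) : R[i] := ((small_step n)^-1)%:C%C * (psi (small_step n) w - psi 0 w).
have Lq n : in_cLp P 2%:E (q n) := L2Z _ (L2B (Lp n) Lp0).
have psiE n : psi (small_step n) = (fun w => psi 0 w + (small_step n)%:C%C * q n w).
  apply/funext => w; rewrite /q mulrA -rmorphM divff ?gt_eqF ?small_step_gt0//.
  by rewrite rmorph1 mul1r addrC subrK.
have qcvg : cLnorm P 2%:E (fun w => q n w - psi1 0 w) @[n --> \oo] --> 0%E.
  rewrite (_ : (fun n => _) = (fun n => cLnorm P 2%:E ((small_step n)^-1 *:
    (psi (small_step n) - psi 0 : Omega -> Rcomplex R) - psi1 0))).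
    exact: derivative_on_small_step dp.
  apply/funext => n; congr (cLnorm P 2%:E _); apply/funext => w.
  by rewrite /q -scale_Rcomplex.
pose r n : R := (small_step n)^-1 * (E (small_step n)).
have rcvg : r n @[n --> \oo] --> E1 0.
  have /fine_cvg/norm_cvg0P/subr_cvg0 := derivative_on_small_step dE.
  rewrite (_ : r = fun n => (small_step n)^-1 *: (E (small_step n) - E 0 : R^o))//.
  by apply/funext => n; rewrite E0 subr0.
(* [V] times an element of L^2(Omega) is only in L^1(Omega), so the real factor [V] is moved to the
   side of [phi]. This is where the boundedness of [phi] is used: it puts [B] in L^2(Omega). *)
pose B w := (V w)%:C%C * phi w.
have LB : in_cLp P 2%:E B.
  apply: (L2_le _ _ (rintegrableZl (M ^+ 2) (L2_sqr LV))) => [|w].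
    by apply: cmeasurableM => //; exact: cmeasurable_real.
  rewrite normcM exprMn mulrC ler_wpM2r ?sqr_ge0// lerXn2r ?nnegrE ?normc_ge0//.
  exact: (le_trans (normc_ge0 _) (phiM w)).
have phiV (f : Omega -> R[i]) : inner P phi (fun w => (V w)%:C%C * f w) = inner P B f.
  apply: eq_cintegral => w; rewrite /B conjcM (_ : conjc (V w)%:C%C = (V w)%:C%C).
    by rewrite mulrCA mulrA.
  by apply: complex_eqP => //=; rewrite oppr0.
have eq0 : inner P H0phi (psi 0) = 0.
  have := eig 0 _ phi H0phi H2phi (Loo_bounded P mphi phiM) isH.
  rewrite E0 mul0r mul0r addr0; apply; by rewrite in_itv/= lexx.
(* The branch is written as [psi 0] plus the step times [q n]. The order-zero term vanishes by
   [eq0], and one factor of the step cancels. *)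
have eqn n : inner P H0phi (q n) + inner P B (psi 0) + (small_step n)%:C%C * inner P B (q n) =
    (r n)%:C%C * (inner P phi (psi 0) + (small_step n)%:C%C * inner P phi (q n)).
  have := eig (small_step n) (small_step_in n) phi H0phi H2phi (Loo_bounded P mphi phiM) isH.
  have LQ := L2Z (small_step n)%:C%C (Lq n).
  rewrite phiV psiE (innerDr LH Lp0 LQ) (innerDr LB Lp0 LQ) (innerDr Lphi Lp0 LQ).
  rewrite (innerZr _ LH (Lq n)) (innerZr _ LB (Lq n)) (innerZr _ Lphi (Lq n)) eq0 add0r.
  move=> E3; have m0 : (small_step n)%:C%C != 0 :> R[i].
    by rewrite (_ : 0 = (0 : R)%:C%C)// (inj_eq (@complexI _)) gt_eqF ?small_step_gt0.
  apply: (mulfI m0); rewrite mulrA -rmorphM /r mulrA divff ?gt_eqF ?small_step_gt0//.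
  by rewrite mul1r -E3; ring.
have c1 := ccvg_inner LH Lp1 Lq qcvg.
have c2 := ccvg_inner LB Lp1 Lq qcvg.
have c3 := ccvg_inner Lphi Lp1 Lq qcvg.
have c4 := ccvg_real cvg_small_step; have c5 := ccvg_real rcvg.
have cl := ccvgD (ccvgD c1 (ccvg_cst (inner P B (psi 0)))) (ccvgM c4 c2).
have cr := ccvgM c5 (ccvgD (ccvg_cst (inner P phi (psi 0))) (ccvgM c4 c3)).
have cr' : ccvg (fun n => inner P H0phi (q n) + inner P B (psi 0) +
    (small_step n)%:C%C * inner P B (q n))
    ((E1 0)%:C%C * (inner P phi (psi 0) + (0 : R)%:C%C * inner P phi (psi1 0))).
  by under eq_fun do rewrite eqn.
have psi0i (f : Omega -> R[i]) : inner P f (psi 0) = inner P f (fun=> 1).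
  by apply: ae_eq_cintegral; apply: filterS psi0 => w ->.
have := ccvg_unique cl cr'; rewrite !mul0r !addr0 !psi0i -phiV => <-; congr (_ + _).
by apply: eq_cintegral => w; rewrite mulr1.
Qed.

End first_order.

(** * The covariance function and truncation of V *)

Section covariance.
Context {R : realType} {d : nat} {disp : measure_display}
  {Omega : measurableType disp}.
Variables (P : probability Omega R) (tau : 'rV[R]_d -> Omega -> Omega).
Hypothesis tauP : measurable_action P tau.
Variable V : Omega -> R.
Local Notation leb := (lebesgue_rV d).
Local Notation Vc := (fun w => (V w)%:C%C).
Hypotheses (mV : measurable_fun setT V) (LV : in_cLp P 2%:E Vc).

Lemma covarianceE z :
  inner P Vc (stat tau Vc z) = (covariance_function P tau V z)%:C%C.
Proof.
rewrite /covariance_function -cintegral_real; apply: eq_cintegral => w.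
rewrite (_ : conjc (V w)%:C%C = (V w)%:C%C); last first.
  by apply: complex_eqP => //=; rewrite oppr0.
by rewrite rmorphM mulrC.
Qed.

Lemma normc_inner_stat (A B : Omega -> R[i]) z : in_cLp P 2%:E A -> in_cLp P 2%:E B ->
  Normc.normc (inner P A (stat tau B z)) <=
  2 * (Num.sqrt (sqn P A) * Num.sqrt (sqn P B)).
Proof.
by move=> LA LB; have [LB' <-] := L2_stat tauP z LB; exact: normc_inner_sqrt.
Qed.

(** [V] may be unbounded, so the integral of its measurable version is controlled only for almost
    every [z]. Clamping it at the Cauchy-Schwarz bound [b] makes the bound hold everywhere without
    changing the almost-everywhere class. *)
Lemma covariance_version : exists (C : 'rV[R]_d -> R) (b : R), [/\ measurable_fun setT C,
  forall z : 'rV[R]_d, `|C z| <= b &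
  {ae leb, forall z, covariance_function P tau V z = C z}].
Proof.
have [Z [mZ _ Zae]] := stationary_version tauP mV.
pose C0 z := \int[P]_w (Z (z, w) * V w).
pose b : R := 2 * (Num.sqrt (sqn P Vc) * Num.sqrt (sqn P Vc)).
have b0 : 0 <= b by rewrite !mulr_ge0 ?sqrtr_ge0.
have mC0 : measurable_fun setT C0.
  apply: (measurable_Rintegral P (F := fun p : 'rV[R]_d * Omega => Z p * V p.2)).
  by apply: measurable_funM => //; apply: (measurableT_comp mV); exact: measurable_snd.
exists (fun z => Num.max (- b) (Num.min b (C0 z))), b; split.
- apply: measurable_maxr; first exact: measurable_cst.
  by apply: measurable_minr => //; exact: measurable_cst.
- move=> z; rewrite ler_norml le_max lexx /= ge_max ge_min lexx /= andbT.
  by rewrite (le_trans _ b0)// oppr_le0.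
- apply: filterS Zae => z h; have CE : C0 z = covariance_function P tau V z.
    by apply: ae_eq_Rintegral; apply: filterS h => w ->.
  have := normc_inner_stat z LV LV; rewrite covarianceE normc_real -/b ler_norml.
  by rewrite CE => /andP[h1 h2]; rewrite min_r// max_r.
Qed.

(** Clamping at level n moves each value toward 0, so [|Y - V| <= |V|] and dominated convergence
    applies with majorant [|V|^2]. The bound [|Y| <= |V|] keeps the norm of [Y] bounded
    independently of [e]. *)
Lemma truncation (e : R) : 0 < e -> exists (Y : Omega -> R) (K : R),
  [/\ measurable_fun setT Y, 0 <= K, forall w, `|Y w| <= K, forall w, `|Y w| <= `|V w| &
    sqn P (fun w => (Y w)%:C%C - (V w)%:C%C) <= e].
Proof.
move=> e0.
pose Y n w := Num.max (- n%:R) (Num.min n%:R (V w)) : R.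
have mY n : measurable_fun setT (Y n).
  apply: measurable_maxr; first exact: measurable_cst.
  by apply: measurable_minr => //; exact: measurable_cst.
have YV n w : `|Y n w - V w| <= `|V w| /\ `|Y n w| <= `|V w|.
  have n0 : 0 <= n%:R :> R by [].
  rewrite /Y; move: (n%:R) n0 => r r0.
  case: (ltP r (V w)) => h1; last (case: (ltP (- r) (V w)) => h2).
  - have V0 : 0 <= V w by lra.
    rewrite (ger0_norm V0) max_r ?(le_trans _ r0) ?oppr_le0// !ler_norml; lra.
  - by rewrite subrr normr0.
  - have V0 : V w <= 0 by lra.
    rewrite (ler0_norm V0) !ler_norml; lra.
have Ycvg w : Y n w @[n --> \oo] --> V w.
  apply: (@cvg_trans _ ((fun _ : nat => V w) @ \oo)); last exact: cvg_cst.
  apply: near_eq_cvg; near=> n.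
  have h : `|V w| <= n%:R by near: n; exact: nbhs_infty_ger.
  by move: h; rewrite ler_norml /Y => /andP[h1 h2]; rewrite min_r// max_r.
have iV := L2_sqr LV.
have : sqn P (fun w => (Y n w)%:C%C - (V w)%:C%C) @[n --> \oo] --> (0 : R).
  have -> : 0 = \int[P]_w (0 : R) by rewrite Rintegral_cst ?mul0r.
  apply: (Rintegral_dct (mu := P) (g := fun w => Normc.normc (V w)%:C%C ^+ 2)) => //.
  - move=> n; under eq_fun do rewrite -rmorphB normc_real real_normK ?num_real//.
    by apply: measurable_funX; exact: measurable_funB.
  - move=> w; under eq_fun do rewrite -rmorphB normc_real real_normK ?num_real//.
    have : (Y n w - V w) ^+ 2 @[n --> \oo] --> (V w - V w) ^+ 2.
      by apply: cvgM; apply: cvgB => //; exact: cvg_cst.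
    by rewrite subrr expr0n.
  - move=> n w; rewrite -rmorphB !normc_real normrX normr_id.
    by rewrite lerXn2r ?nnegrE//; exact: (YV n w).1.
move=> /cvgrPdist_le /(_ _ e0) [n _ /(_ n (leqnn n))]; rewrite sub0r normrN => h.
exists (Y n), n%:R; split => //.
- move=> w; rewrite /Y ler_norml le_max lexx /= ge_max ge_min lexx /= andbT.
  by rewrite (@le_trans _ _ 0)// oppr_le0.
- by move=> w; exact: (YV n w).2.
- exact: le_trans (ler_norm _) h.
Unshelve. all: end_near.
Qed.

End covariance.

(** * The mass of the spectral measure near the sphere *)

Section main_estimate.
Context {R : realType} {d : nat} {disp : measure_display}
  {Omega : measurableType disp}.
Variables (P : probability Omega R) (tau : 'rV[R]_d -> Omega -> Omega).
Hypothesis tauP : measurable_action P tau.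
Variables (k : 'rV[R]_d) (V : Omega -> R).
Local Notation leb := (lebesgue_rV d).
Local Notation Vc := (fun w => (V w)%:C%C).
Local Notation W := (\int[leb]_z (wgt z : R)).

(** The transfer from the truncation [Y] to [V] under the integral. The limit function [C] needs a
    measurable representative [C'] in order to be integrated, while the closeness of the
    correlations is known for [C] itself. *)
Lemma corr_integral_close (Y : Omega -> R) (K : R) (A : Omega -> R[i])
    (C C' : 'rV[R]_d -> R) (b N eps : R) (kap : 'rV[R]_d -> R[i]) :
  measurable_fun setT Y -> 0 <= K -> (forall w, `|Y w| <= K) ->
  in_cLp P 2%:E A -> measurable_fun setT C' -> (forall z, `|C' z| <= b) ->
  {ae leb, forall z, C z = C' z} ->
  (forall z, Normc.normc (corr P tau Y A z - (C z)%:C%C) <= eps) ->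
  cmeasurable kap -> 0 <= N -> (forall z, Normc.normc (kap z) <= N * wgt z) ->
  Normc.normc (cintegral leb (fun z => kap z * corr P tau Y A z) -
    cintegral leb (fun z => kap z * (C z)%:C%C)) <= 2 * (N * eps * W).
Proof.
move=> mY K0 YK LA mC' C'b CC' ce mkap N0 kapN.
have [Z [mZ ZK Zae]] := stationary_version tauP mY.
have {}ZK := ZK K K0 YK.
have mcZ := cmeasurable_corrZ mZ LA.
have [a a0 aA] := corrZ_bounded mZ ZK LA.
rewrite (cintegral_corr Zae A kap).
have -> : cintegral leb (fun z => kap z * (C z)%:C%C) =
    cintegral leb (fun z => kap z * (C' z)%:C%C).
  by apply: ae_eq_cintegral; apply: filterS CC' => z ->.
have mC'c := cmeasurable_real mC'.
have i1 : cintegrable leb (fun z => kap z * corrZ P Z A z).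
  apply: (cintegrable_le _ _ (rintegrable_cwgt (N * a))) => [|z].
    exact: cmeasurableM.
  by rewrite normcM mulrAC; apply: ler_pM; rewrite ?normc_ge0.
have i2 : cintegrable leb (fun z => kap z * (C' z)%:C%C).
  apply: (cintegrable_le _ _ (rintegrable_cwgt (N * b))) => [|z].
    exact: cmeasurableM.
  by rewrite normcM normc_real mulrAC; apply: ler_pM; rewrite ?normc_ge0.
rewrite -(cintegralB i1 i2) -RintegralZl//; last exact: rintegrable_wgt.
apply: cintegral_le_ae (rintegrable_cwgt _).
  exact: (cintegrable_meas (cintegrableB i1 i2)).
move: (corr_ae Zae A) CC'; apply: filterS2 => z h1 h2.
rewrite -mulrBr normcM mulrAC -h1 -h2; apply: ler_pM; rewrite ?normc_ge0//.
Qed.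

Variables (psi' : Omega -> R[i]) (E' : R).
Hypothesis Lpsi' : in_cLp P 2%:E psi'.
Hypotheses (mV : measurable_fun setT V) (LV : in_cLp P 2%:E Vc).
Hypothesis V_centered : \int[P]_w V w = 0.
Hypothesis first_orderE : forall (phi H0phi : Omega -> R[i]) (M : R), H2 P tau phi ->
  cmeasurable phi -> (forall w, Normc.normc (phi w) <= M) ->
  in_cLp P 2%:E H0phi -> is_H0 P tau k phi H0phi ->
  inner P H0phi psi' + inner P phi Vc = E'%:C%C * inner P phi (fun=> 1).
Variable Chat : {measure set 'rV[R]_d -> \bar R}.
Hypothesis Chat_fourier : is_fourier_measure (covariance_function P tau V) Chat.

(** This is the passage to the limit in the truncation. The witness [u] may change with [e], so no
    limit of the smoothed fields has to be constructed. *)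
Lemma sqr_le_limit (x A c1 c2 : R) : 0 <= x -> 0 <= A -> 0 <= c1 -> 0 <= c2 ->
  (forall e, 0 < e -> exists2 u, x <= u + c1 * e & u ^+ 2 <= A + c2 * e) ->
  x ^+ 2 <= A.
Proof.
move=> x0 A0 c10 c20 H; apply/ler_addgt0Pr => e e0.
(* Squaring [x - c1 t <= u] loses at most [2 x c1 t], and the bound on [u ^+ 2] adds [c2 t]. The
   final 1 makes [c] positive, so that [t = e / c] is defined with [c t = e]. *)
pose c := c2 + 2 * x * c1 + 1.
have c0 : 0 < c by rewrite ltr_wpDl// addr_ge0// !mulr_ge0.
have [u xu u2] := H _ (divr_gt0 e0 c0); set t := e / c in xu u2.
have t0 : 0 < t by exact: divr_gt0.
have te : c * t = e by rewrite /t mulrC divfK// gt_eqF.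
have c1t : 0 <= c1 * t by rewrite mulr_ge0// ltW.
have c2t : 0 <= c2 * t by rewrite mulr_ge0// ltW.
rewrite -te; have [h|h] := lerP x (c1 * t).
  rewrite /c; have := ler_wpM2l x0 h; nra.
have h2 : (x - c1 * t) ^+ 2 <= u ^+ 2 by rewrite lerXn2r ?nnegrE; lra.
rewrite /c; nra.
Qed.

Lemma L2_one : in_cLp P 2%:E (fun _ : Omega => 1 : R[i]).
Proof.
apply: (@L2_bounded _ _ _ _ _ 1); first exact: cmeasurable_cst.
by move=> w; rewrite Normc.normc1.
Qed.

(** Translations are isometries of L^2(Omega), so replacing [V] by [Y] costs a multiple of [e]
    uniformly in [z]. Paired with the constant 1, the correlation of [V] itself vanishes because [V]
    is centered. *)
Lemma corr_close (Y : Omega -> R) (K e : R) : measurable_fun setT Y ->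
  (forall w, `|Y w| <= K) -> (forall w, `|Y w| <= `|V w|) -> 0 <= e ->
  sqn P (fun w => (Y w)%:C%C - (V w)%:C%C) <= e ^+ 2 ->
  [/\ forall z, Normc.normc (corr P tau Y (fun=> 1) z) <= 2 * e,
    forall z, Normc.normc (corr P tau Y Vc z - (covariance_function P tau V z)%:C%C) <=
      2 * Num.sqrt (sqn P Vc) * e &
    forall z, Normc.normc (corr P tau Y (fun w => (Y w)%:C%C) z -
      (covariance_function P tau V z)%:C%C) <= 4 * Num.sqrt (sqn P Vc) * e].
Proof.
move=> mY YK YV e0 Ye; set v := Num.sqrt (sqn P Vc).
have v0 : 0 <= v by exact: sqrtr_ge0.
have LY := L2_Yc P mY YK; have LD := L2B LY LV; have L1 := L2_one.
have De : Num.sqrt (sqn P (fun w => (Y w)%:C%C - (V w)%:C%C)) <= e.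
  by have := ler_wsqrtr Ye; rewrite sqrtr_sqr ger0_norm.
have Yv : Num.sqrt (sqn P (fun w => (Y w)%:C%C)) <= v.
  apply: ler_wsqrtr; apply: (le_trans (ler_norm _)); apply: Rintegral_le.
  - exact: rintegrable_meas (L2_sqr LY).
  - by move=> w; rewrite !normc_real ger0_norm ?sqr_ge0// lerXn2r ?nnegrE.
  - exact: L2_sqr.
have sq1 : sqn P (fun _ : Omega => 1 : R[i]) = 1.
  rewrite /sqn; under eq_Rintegral do rewrite Normc.normc1 expr1n.
  by rewrite /Rintegral integral_cst//= probability_setT mule1.
have statB z A : in_cLp P 2%:E A -> inner P A (stat tau (fun w => (Y w)%:C%C) z) =
    inner P A (stat tau Vc z) + inner P A (stat tau (fun w => (Y w)%:C%C - (V w)%:C%C) z).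
  move=> LA; rewrite -(innerDr LA (L2_stat tauP z LV).1 (L2_stat tauP z LD).1).
  by apply: eq_cintegral => w; rewrite /stat [in RHS]addrC subrK.
have c2 z : Normc.normc (corr P tau Y Vc z - (covariance_function P tau V z)%:C%C) <=
    2 * v * e.
  rewrite /corr (statB z _ LV) covarianceE addrAC subrr add0r.
  apply: (le_trans (normc_inner_stat tauP z LV LD)); rewrite -mulrA ler_wpM2l//.
  by rewrite ler_wpM2l.
split=> // z.
  rewrite /corr (statB z _ L1).
  have -> : inner P (fun=> 1) (stat tau Vc z) = 0.
    rewrite (inner_stat tauP z L1 LV).
    rewrite (_ : inner _ _ _ = cintegral P Vc).
      by rewrite cintegral_real V_centered.
    by apply: eq_cintegral => w; rewrite /stat (_ : conjc 1 = 1) ?mul1r ?conjc1.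
  rewrite add0r; apply: (le_trans (normc_inner_stat tauP z L1 LD)).
  by rewrite sq1 sqrtr1 mul1r ler_wpM2l.
have LYz := (L2_stat tauP z LY).1.
(* Here both arguments are truncated. They are exchanged for [V] one at a time, so the constant is
   twice that of the mixed correlation. *)
have -> : corr P tau Y (fun w => (Y w)%:C%C) z - (covariance_function P tau V z)%:C%C =
    (corr P tau Y Vc z - (covariance_function P tau V z)%:C%C) +
    conjc (inner P (stat tau (fun w => (Y w)%:C%C) z)
      (fun w => (Y w)%:C%C - (V w)%:C%C)).
  rewrite addrAC; congr (_ - _).
  rewrite /corr (inner_conj LYz LV) (inner_conj LYz LY) -rmorphD; congr conjc.
  rewrite -(innerDr LYz LV LD); apply: eq_cintegral => w.
  by rewrite [in RHS]addrC subrK.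
apply: (le_trans (normcD _ _)); rewrite normc_conj.
have h := normc_inner_sqrt LYz LD.
rewrite (L2_stat tauP z LY).2 in h.
have h' := ler_pM (sqrtr_ge0 _) (sqrtr_ge0 _) Yv De.
by have := c2 z; lra.
Qed.

Lemma main_bound s : 0 < s ->
  (\int[Chat]_xi gauss k s xi) ^+ 2 <=
  4 * sqn P psi' * Normc.normc (fourier_const k) *
    \int[Chat]_xi (symb k xi * gauss k s xi) ^+ 2.
Proof.
move=> s0; set x := \int[Chat]_xi gauss k s xi.
pose f xi := symb k xi * gauss k s xi.
set I2 := \int[Chat]_xi _.
have pg := polygauss_gauss k s; have pf : polygauss k s f.
  by apply: polygaussM => //; exact: polyfun_symb.
have pf2 := polygauss_sqr pf; have ss0 : 0 < s + s by exact: addr_gt0.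
have [_ xE] := Chat_fourier (polygauss_schwartz s0 pg).
have [_ IE] := Chat_fourier (polygauss_schwartz ss0 pf2).
rewrite -/x in xE; rewrite -[X in X%:C%C]/I2 in IE.
have x0 : 0 <= x by apply: Rintegral_ge0 => xi _; exact: gauss_ge0.
have I20 : 0 <= I2 by apply: Rintegral_ge0 => xi _; exact: sqr_ge0.
have [C' [b [mC' C'b CC']]] := covariance_version tauP mV LV.
have [M M0 HM] := fourier_decay1 s0 pg.
have [N N0 HN] := fourier_decay1 ss0 pf2.
have mFg := cmeasurable_fourier (polygauss_wdom s0 pg).1.
have mFf2 := cmeasurable_fourier (polygauss_wdom ss0 pf2).1.
have W0 : 0 <= W by apply: Rintegral_ge0 => z _; exact: wgt_ge0.
have v0 : 0 <= Num.sqrt (sqn P Vc) by exact: sqrtr_ge0.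
have fc0 := normc_ge0 (fourier_const k).
have b0 := sqn_ge0 P psi'.
have A0 : 0 <= 4 * sqn P psi' * Normc.normc (fourier_const k) * I2.
  by rewrite !mulr_ge0.
(* The error linear in [e]: the first term is the cost [d2] of replacing the pairing of phi with V
   by [x], the second is [|E'|] times the bound [d1] on the pairing of phi with 1. The constant of
   [c20] is the error in the squared norm of H_{k,0} phi, times [4 * sqn P psi']. [M] and [N] depend
   on [s], which is fixed here. *)
have c10 : 0 <= 4 * M * Num.sqrt (sqn P Vc) * W + `|E'| * (4 * M * W).
  by rewrite addr_ge0 ?mulr_ge0.
have c20 : 0 <= 4 * sqn P psi' * (Normc.normc (fourier_const k) *
    (8 * N * Num.sqrt (sqn P Vc) * W)) by rewrite !mulr_ge0.
apply: (sqr_le_limit x0 A0 c10 c20) => e e0.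
have e20 : 0 < e ^+ 2 by rewrite exprn_gt0.
have [Y [K [mY K0 YK YV Ye]]] := truncation mV LV e20.
have LY := L2_Yc P mY YK.
have [Z [mZ ZK Zae]] := stationary_version tauP mY.
have {}ZK := ZK K K0 YK.
have [c1 c2 c3] := corr_close mY YK YV (ltW e0) Ye.
have LS := L2_smoothing P K0 mZ ZK s0 0 pf.
have Lphi := L2_smoothing P K0 mZ ZK s0 0 pg.
have [B B0 HB] := smoothing_bound K0 mZ ZK s0 pg.
have FO := first_orderE (H2_smoothing tauP mY K0 YK mZ ZK Zae s0 pg)
  (cmeasurable_smoothing1 mZ s0 0 pg) (HB 0) LS
  (is_H0_smoothing tauP mY K0 YK mZ ZK Zae s0 pg).
set phi := smoothing Z (gauss k s) 0 in Lphi FO.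
set Hphi := smoothing Z _ 0 in FO.
have d1 : Normc.normc (inner P phi (fun=> 1)) <= 2 * (M * (2 * e) * W).
  rewrite (inner_conj L2_one Lphi) normc_conj.
  rewrite (inner_smoothing mZ ZK Zae s0 0 pg L2_one).
  have Eq : cintegral leb (fun z => fourier (gauss k s) z * ((fun=> 0 : R) z)%:C%C) = 0.
    rewrite (_ : (fun z => _) = (fun z => (0 : R)%:C%C)); last first.
      by apply/funext => z; rewrite mulr0.
    by rewrite cintegral_real Rintegral_cst ?mul0r.
  have := corr_integral_close (C := fun=> 0) (C' := fun=> 0) (b := 0) (eps := 2 * e)
    mY K0 YK L2_one _ _ _ _ mFg M0 HM.
  rewrite Eq subr0 (_ : (fun z => fourier (gauss k s) (z - 0) * _) =
    (fun z => fourier (gauss k s) z * corr P tau Y (fun=> 1) z)); last first.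
    by apply/funext => z; rewrite subr0.
  apply=> //; first by move=> z; rewrite normr0.
    exact: aeW.
  by move=> z; rewrite subr0.
have d2 : Normc.normc (x%:C%C - inner P phi Vc) <=
    2 * (M * (2 * Num.sqrt (sqn P Vc) * e) * W).
  rewrite (inner_conj LV Lphi) (_ : x%:C%C = conjc x%:C%C); last first.
    by apply: complex_eqP => //=; rewrite oppr0.
  rewrite -rmorphB normc_conj -normcN opprB.
  rewrite (inner_smoothing mZ ZK Zae s0 0 pg LV) xE.
  have := corr_integral_close mY K0 YK LV mC' C'b CC' c2 mFg M0 HM.
  rewrite (_ : (fun z => fourier (gauss k s) (z - 0) * _) =
    (fun z => fourier (gauss k s) z * corr P tau Y Vc z))//.
  by apply/funext => z; rewrite subr0.
have d3 : sqn P Hphi <= Normc.normc (fourier_const k) *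
    (I2 + 2 * (N * (4 * Num.sqrt (sqn P Vc) * e) * W)).
  have SE := sqn_smoothing tauP mY K0 YK mZ ZK Zae s0 pf.
  rewrite -[leLHS]ger0_norm ?sqn_ge0// -normc_real SE normcM normc_conj ler_wpM2l//.
  have := corr_integral_close mY K0 YK LY mC' C'b CC' c3 mFf2 N0 HN.
  rewrite -IE => h; rewrite -[X in Normc.normc X](subrK (I2%:C%C)).
  apply: (le_trans (normcD _ _)); rewrite addrC normc_real ger0_norm//.
  by rewrite lerD2l.
(* The first-order equation bounds [x] by this pairing plus the linear errors, and Cauchy-Schwarz
   bounds its square by [4 * (sqn P Hphi * sqn P psi')]. *)
exists (Normc.normc (inner P Hphi psi')).
  have d5 := normcD (x%:C%C - inner P phi Vc) (inner P phi Vc).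
  rewrite subrK normc_real ger0_norm// in d5.
  have FO' : inner P phi Vc = E'%:C%C * inner P phi (fun=> 1) - inner P Hphi psi'.
    by rewrite -FO [in RHS]addrC addKr.
  have d4 : Normc.normc (inner P phi Vc) <=
      `|E'| * (2 * (M * (2 * e) * W)) + Normc.normc (inner P Hphi psi').
    have d6 := normcD (E'%:C%C * inner P phi (fun=> 1)) (- inner P Hphi psi').
    rewrite normcN normcM normc_real -FO' in d6.
    by have := ler_wpM2l (normr_ge0 E') d1; lra.
  by move: d2 d4 d5; lra.
apply: (le_trans (normc_inner LS Lpsi')).
have := ler_wpM2r b0 d3; lra.
Qed.

Lemma gauss_integral_bound s : 0 < s ->
  \int[Chat]_xi gauss k s xi <=
  4 * sqn P psi' * Normc.normc (fourier_const k) / s.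
Proof.
move=> s0; have := main_bound s0; set A := 4 * _ * _; set x := \int[Chat]_xi _.
have A0 : 0 <= A by rewrite !mulr_ge0 ?normc_ge0 ?sqn_ge0.
have pg := polygauss_gauss k s.
have pf := polygaussM (polyfun_symb k) pg.
have [ig _] := Chat_fourier (polygauss_schwartz s0 pg).
have h : \int[Chat]_xi (symb k xi * gauss k s xi) ^+ 2 <= s^-1 * x.
  rewrite /x -RintegralZl//; apply: (le_trans (ler_norm _)).
  apply: Rintegral_le (rintegrableZl s^-1 ig).
    by apply: measurable_funX; exact: measurable_polygauss pf.
  move=> xi; rewrite ger0_norm ?sqr_ge0//.
  rewrite exprMn expr2 [gauss _ _ _ ^+ 2]expr2 mulrA ler_wpM2r ?gauss_ge0//.
  rewrite -expr2 -[leRHS]mulr1 ler_pdivlMl// mulrA /gauss expRN ler_pdivrMr ?expR_gt0// mul1r.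
  by apply: (le_trans _ (expR_ge1Dx _)); rewrite lerDr.
move=> h2; have h3 : x ^+ 2 <= A * (s^-1 * x) by apply: (le_trans h2); rewrite ler_wpM2l.
have [x0|] := ltP 0 x; last by move/le_trans; apply; rewrite divr_ge0// ltW.
by rewrite -(ler_pM2r x0) -expr2 -mulrA.
Qed.

Lemma measurable_eball (c : 'rV[R]_d) (r : R) : measurable (eball c r).
Proof.
have cn : continuous (fun x : 'rV[R]_d => dotv (x - c) (x - c)).
  apply: continuous_polyfun; apply: polyfun_sum => j.
  suff h : polyfun (fun x : 'rV[R]_d => x ord0 j + - c ord0 j).
    by have := polyfunM h h; congr polyfun; apply/funext => x; rewrite !mxE.
  by apply: polyfunD; [exact: polyfun_coord|exact: polyfun_cst].
have mn : measurable_fun setT (fun x : 'rV[R]_d => enorm (x - c)).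
  apply: (measurableT_comp (f := @Num.sqrt R)); last exact: continuous_measurable_rV.
  exact: (continuous_measurable_fun (@sqrt_continuous R)).
have -> : eball c r = setT `&` (fun x : 'rV[R]_d => enorm (x - c)) @^-1` `]-oo, r[.
  by apply/seteqP; split=> x /=; rewrite in_itv/=; [|case].
exact: mn.
Qed.

Lemma symb_enorm xi : symb k xi = enorm (xi + k) ^+ 2 - enorm k ^+ 2.
Proof.
rewrite /enorm !sqr_sqrtr ?dotv_ge0// /symb /dotv -sumrB; apply: eq_bigr => j _.
by rewrite !mxE; ring.
Qed.

Lemma shell_bound : exists2 K, 0 <= K & forall eps, 0 < eps -> eps <= 1 ->
  (Chat (eball (- k) (enorm k + eps) `\` eball (- k) (enorm k - eps)) <=
   (K * eps ^+ 2)%:E)%E.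
Proof.
set A := 4 * sqn P psi' * Normc.normc (fourier_const k).
have A0 : 0 <= A by rewrite !mulr_ge0 ?normc_ge0 ?sqn_ge0.
(* On the shell the symbol is at most [eps * (2 * enorm k + eps)] in absolute value, which is at
   most [eps * m] for [eps <= 1]. With [s = eps^-2] the exponent of [gauss] is then at least
   [- m^2]. *)
set m := 2 * enorm k + 1.
have k0 : 0 <= enorm k by exact: sqrtr_ge0.
exists (expR (m ^+ 2) * A); first by rewrite mulr_ge0 ?expR_ge0.
move=> eps e0 e1; set S := _ `\` _.
have mS : measurable S by apply: measurableD; exact: measurable_eball.
have s0 : 0 < (eps ^+ 2)^-1 by rewrite invr_gt0 exprn_gt0.
have xb := gauss_integral_bound s0; rewrite invrK -/A in xb.
have [ig _] := Chat_fourier (polygauss_schwartz s0 (polygauss_gauss k _)).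
have gS xi : S xi -> expR (- m ^+ 2) <= gauss k (eps ^+ 2)^-1 xi.
  rewrite /S /eball/= opprK => -[h1 /negP]; rewrite -leNgt => h2.
  rewrite ler_expR lerN2 ler_pdivrMl ?exprn_gt0// -exprMn symb_enorm.
  (* When [eps] exceeds [enorm k] the inner ball is empty and [h2] is void; the lower bound on the
     symbol then rests on [r >= 0]. *)
  have r0 : 0 <= enorm (xi + k) by exact: sqrtr_ge0.
  move: h1 h2 r0; rewrite /m; move: (enorm (xi + k)) (enorm k) k0 => r n n0 h1 h2 r0.
  have b1 : r ^+ 2 - n ^+ 2 <= eps * (2 * n + 1) by nra.
  have b2 : - (eps * (2 * n + 1)) <= r ^+ 2 - n ^+ 2 by nra.
  move: b1 b2; move: (r ^+ 2 - n ^+ 2) (eps * _) => t a b1 b2; nra.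
have c0 : 0 < expR (m ^+ 2) by exact: expR_gt0.
have h : ((expR (- m ^+ 2))%:E * Chat S <= (A * eps ^+ 2)%:E)%E.
  rewrite -(integral_cst _ mS) integral_mkcond.
  apply: (@le_trans _ _ (\int[Chat]_xi (gauss k (eps ^+ 2)^-1 xi)%:E)%E).
    apply: le_integral_nomeas => xi; rewrite /patch; case: ifPn => //.
    - by move=> _; rewrite lee_fin expR_ge0.
    - by rewrite inE => /gS; rewrite lee_fin.
    - by move=> _; change ((0 : R)%:E <= (gauss k (eps ^+ 2)^-1 xi)%:E)%E;
        rewrite lee_fin gauss_ge0.
  by rewrite (rintegrable_fin ig) lee_fin.
by move: h; rewrite expRN lee_pdivrMl// -EFinM mulrA.
Qed.

Lemma shell_not_cvg (l : \bar R) : (0 < l)%E ->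
  ~ ((eps^-1)%:E * Chat (eball (- k) (enorm k + eps) `\`
                          eball (- k) (enorm k - eps)))%E @[eps --> 0^'+] --> l.
Proof.
move=> l0 h; have [K K0 HK] := shell_bound.
suff h0 : ((eps^-1)%:E * Chat (eball (- k) (enorm k + eps) `\`
    eball (- k) (enorm k - eps)))%E @[eps --> 0^'+] --> 0%E.
  by move: l0; rewrite (cvg_unique (@ereal_hausdorff R) h h0) ltxx.
apply: (@squeeze_cvge _ _ _ _ (fun=> 0%E) _ (fun eps : R => (K * eps)%:E)).
- near=> eps; have e0 : 0 < eps by near: eps; exact: nbhs_right_gt.
  rewrite mule_ge0 ?lee_fin ?invr_ge0 ?(ltW e0)//=.
  rewrite lee_pdivrMl//; apply: (le_trans (HK _ e0 _)).
    by near: eps; exact: nbhs_right_le.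
  by rewrite -EFinM lee_fin [leRHS]mulrCA -expr2.
- exact: cvg_cst.
- apply: cvg_EFin; first exact: nearW.
  rewrite -[X in _ --> X](mulr0 K); apply: cvgM; first exact: cvg_cst.
  exact: cvg_at_right_filter.
Unshelve. all: end_near.
Qed.

End main_estimate.

Theorem proposition3 (R : realType) (d : nat) (disp : measure_display)
  (Omega : measurableType disp) (P : probability Omega R)
  (tau : 'rV[R]_d -> Omega -> Omega)
  (P_complete : measure_is_complete P) (tau_action : measurable_action P tau)
  (k : 'rV[R]_d) (k_neq0 : k != 0)
  (V : Omega -> R) (V_L2 : V \in Lfun P 2%:E)
  (V_centered : \int[P]_(w in setT) V w = 0)
  (Chat : {measure set 'rV[R]_d -> \bar R})
  (Chat_fourier : is_fourier_measure (covariance_function P tau V) Chat)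
  (Chat_sphere : exists2 l : \bar R, (0 < l)%E &
     ((eps^-1)%:E * Chat (eball (- k) (enorm k + eps) `\`
                          eball (- k) (enorm k - eps)))%E
       @[eps --> 0^'+] --> l)
  (delta : R) (delta_gt0 : 0 < delta) :
  ~ exists (E : R -> R) (psi : R -> Omega -> R[i]),
      [/\ class_C2_on (X := R^o) setT (fun x : R => `|x|%:E)
            `[0, delta[ E,
          class_C2_on (X := Omega -> Rcomplex R) (in_cLp P 2%:E)
            (cLnorm P 2%:E) `[0, delta[ psi,
          forall lam, lam \in `[0, delta[ ->
            eigen_equation P tau k V lam (E lam) (psi lam),
          E 0 = 0 &
          {ae P, forall w, psi 0 w = 1}].
Proof.
move=> [E [psi [C2E C2psi eig E0 psi0]]].
have [mV LV] := Lfun2_cLp V_L2; have [l l_gt0 Chat_l] := Chat_sphere.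
have [E' [psi' [Lpsi' FO]]] := first_order delta_gt0 V_L2 C2E C2psi eig E0 psi0.
exact: (shell_not_cvg tau_action Lpsi' mV LV V_centered FO Chat_fourier l_gt0 Chat_l).
Qed.
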